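(* Let $\nu>0$, $T>0$, $u_0\in\mathcal{M}(\mathbb{R}^2)$ and $u\in L^4(0,T;L^{4/3}(\mathbb{R}^2))$. Let $u_1,u_2\in L^4(0,T;L^4(\mathbb{R}^2)\cap L^{4/3}(\mathbb{R}^2))$ with $u_1-u_2\in L^\infty(0,T;H^{-1}(\mathbb{R}^2))$, $u_1(t)-u_2(t)\in L^1(\mathbb{R}^2)$ for a.e. $t\in(0,T)$, and $$\lim_{t\downarrow0}\ \operatorname*{ess\,sup}_{s\in(0,t)}\int_{\mathbb{R}^2}(u_1(s,x)-u_2(s,x))\varphi(x)\,dx=0\quad\text{for all }\varphi\in C_0^\infty(\mathbb{R}^2),$$ be two solutions $v=u_1$, $v=u_2$ of the linear equation $$\int_0^T\!\!\int_{\mathbb{R}^2}(\varphi_t+\nu\Delta\varphi+K(u)\cdot\nabla\varphi)\,v\,dx\,dt+\int_{\mathbb{R}^2}\varphi(0,x)\,u_0(dx)=0$$ for all $C^2$ functions $\varphi$ on $[0,T]\times\mathbb{R}^2$ with compact support in $[0,T)\times\mathbb{R}^2$. Then $u_1\equiv u_2$.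
   Context: $\mathcal{M}(\mathbb{R}^2)$ is the space of finite Radon measures; $H^{-1}(\mathbb{R}^2)$ is the dual of $H^1(\mathbb{R}^2)$. The Biot–Savart kernel is $k(x)=\frac{(-x_2,x_1)}{2\pi|x|^2}$, $x\ne0$, and $K(z)=k*z$. *)

(* Defs.v *)
From mathcomp Require Import all_boot all_order all_algebra.
From mathcomp Require Import all_classical all_reals all_analysis.
Import numFieldNormedType.Exports.
Import Order.TTheory GRing.Theory Num.Theory.

Set Implicit Arguments.
Unset Strict Implicit.
Unset Printing Implicit Defensive.

Local Open Scope classical_set_scope.
Local Open Scope ring_scope.

Section Defs.
Variable R : realType.

Definition R2 := (R * R)%type.
Definition RxR2 := (R * (R * R))%type.

Definition leb1 := (@lebesgue_measure R).
Definition leb2 := (leb1 \x leb1)%E.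

Definition pdiff {V : normedModType R} (v : V) (f : V -> R) : V -> R :=
  fun x => 'D_v f x.

Fixpoint isCk {V : normedModType R} (dirs : seq V) (k : nat) (f : V -> R)
  : Prop :=
  match k with
  | 0%N => continuous f
  | k'.+1 => continuous f /\
      (forall v, v \in dirs -> (forall x, derivable f x v) /\
                              isCk dirs k' (pdiff v f))
  end.

Definition dirs2 : seq R2 := [:: ((1:R), (0:R)); ((0:R), (1:R))].
Definition et : RxR2 := ((1:R), ((0:R), (0:R))).
Definition ex1 : RxR2 := ((0:R), ((1:R), (0:R))).
Definition ex2 : RxR2 := ((0:R), ((0:R), (1:R))).
Definition dirs3 : seq RxR2 := [:: et; ex1; ex2].

Definition compact_supp2 (f : R2 -> R) : Prop :=
  exists r : R, forall x : R2, r < `|x| -> f x = 0.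

Definition Cc_inf2 (f : R2 -> R) : Prop :=
  (forall k, isCk dirs2 k f) /\ compact_supp2 f.

(* C^1 compactly supported functions on R^2 (dense in H^1(R^2)) *)
Definition Cc1_2 (f : R2 -> R) : Prop := isCk dirs2 1 f /\ compact_supp2 f.

Definition H1norm (f : R2 -> R) : R :=
  Num.sqrt (Rintegral leb2 setT (fun x =>
     f x ^+ 2 + pdiff ((1:R), (0:R)) f x ^+ 2 + pdiff ((0:R), (1:R)) f x ^+ 2)).

Definition jointly_measurable (v : R -> R2 -> R) : Prop :=
  measurable_fun setT (fun p : RxR2 => v p.1 p.2).

Definition in_LpLq (p : nat) (q : \bar R) (T : R) (v : R -> R2 -> R) : Prop :=
  jointly_measurable v /\
  (\int[leb1]_(t in `]0%R, T[) (Lnorm leb2 q (fun x => (v t x)%:E)) ^+ p < +oo)%E.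

(* w \in L^oo(0,T; H^{-1}(R^2)), H^{-1} norm computed by duality with
   C^1_c functions (dense in H^1). *)
Definition in_Linf_Hm1 (T : R) (w : R -> R2 -> R) : Prop :=
  jointly_measurable w /\
  exists M : R, {ae leb1, forall t, 0 < t < T ->
    forall phi, Cc1_2 phi ->
      `|Rintegral leb2 setT (fun x => w t x * phi x)| <= M * H1norm phi}.

Definition esssup_on (A : set R) (g : R -> R) : \bar R :=
  ereal_inf [set y : \bar R | {ae leb1, forall s, A s -> ((g s)%:E <= y)%E}].

(* Biot--Savart kernel k(x) = (-x2, x1) / (2 pi |x|^2)  (value 0 at x = 0,
   a null set) and K(z) = k * z. *)
Definition kBS1 (x : R2) : R := - x.2 / (2 * pi * (x.1 ^+ 2 + x.2 ^+ 2)).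
Definition kBS2 (x : R2) : R := x.1 / (2 * pi * (x.1 ^+ 2 + x.2 ^+ 2)).
Definition KBS1 (z : R2 -> R) (x : R2) : R :=
  Rintegral leb2 setT (fun y => kBS1 (x.1 - y.1, x.2 - y.2) * z y).
Definition KBS2 (z : R2 -> R) (x : R2) : R :=
  Rintegral leb2 setT (fun y => kBS2 (x.1 - y.1, x.2 - y.2) * z y).

(* Admissible test functions: C^2 on R x R^2 (hence on [0,T] x R^2) whose
   restriction to [0,T] x R^2 has compact support in [0,T) x R^2. *)
Definition test_fun (T : R) (phi : RxR2 -> R) : Prop :=
  isCk dirs3 2 phi /\
  exists r delta : R, 0 < delta /\
    forall (t : R) (x : R2), 0 <= t -> (T - delta <= t \/ r < `|x|) ->
      phi (t, x) = 0.

(* Weak formulation of  v_t + K(u).grad v = nu Lap v,  v(0) = u0, where the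
   finite signed Radon measure u0 is given as u0p - u0n (Jordan decomposition)
   with u0p, u0n finite (Borel) measures on R^2. *)
Definition weak_sol (nu T : R) (u : R -> R2 -> R)
    (u0p u0n : {finite_measure set R2 -> \bar R}) (v : R -> R2 -> R) : Prop :=
  forall phi : RxR2 -> R, test_fun T phi ->
    Rintegral leb1 `]0, T[ (fun t =>
      Rintegral leb2 setT (fun x =>
        (pdiff et phi (t, x)
         + nu * (pdiff ex1 (pdiff ex1 phi) (t, x)
                 + pdiff ex2 (pdiff ex2 phi) (t, x))
         + (KBS1 (u t) x * pdiff ex1 phi (t, x)
            + KBS2 (u t) x * pdiff ex2 phi (t, x))) * v t x))
    + (Rintegral u0p setT (fun x => phi (0, x))
       - Rintegral u0n setT (fun x => phi (0, x))) = 0.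

End Defs.

(* Main.v *)
From HB Require Import structures.
Require Import Defs.
From mathcomp Require Import all_boot all_order all_algebra.
From mathcomp Require Import all_classical all_reals all_analysis.
From mathcomp Require Import measurable_realfun ring lra.
Import numFieldNormedType.Exports.
Import Order.TTheory GRing.Theory Num.Theory.
Local Open Scope classical_set_scope.
Local Open Scope ring_scope.

Set Implicit Arguments.
Unset Strict Implicit.
Unset Printing Implicit Defensive.

(* The difference w of two solutions satisfies the weak equation with zero
   initial datum and a drift b = K(u).  Testing with ramp(a - t)^3 rho_e(x - .),
   where rho_e is a C^2 mollifier of product form, gives
   W_t = nu Lap W - div ((b w) * rho_e) in the sense of distributions on
   (-oo, T), where W = w * rho_e is extended by 0 to t <= 0, so W vanishes at
   time 0.  Multiplying by W and using div b = 0, the drift term becomes the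
   pairing of grad W with the commutator d = (b w) * rho_e - b (w * rho_e) and
   is absorbed by the viscosity, so that the integral of W^2 over space-time is
   at most T / (2 nu) times that of |d|^2.  By the Hardy-Littlewood-Sobolev
   inequality, b lies in L^4 of space-time; as w does too, continuity of
   translations in L^p gives d -> 0 in L^2 when e -> 0, whence w = 0. *)

(** The commutator [d] is paired with grad W and never differentiated, so no derivative of the drift
    enters: it is enough that [b] and [w] lie in L^4 of space-time, an exponent matched by the
    plane, where convolution with a kernel of size 1/|x| maps L^(4/3) to L^4. No weak derivative of
    [w] is taken either. Products of convolutions are expanded into integrals over (x, y, z); Fubini
    puts the x-integral inside, where integrations by parts and div b = 0 only meet products of two
    mollifiers. The factor T / (2 nu) is made of 2 from (W^2)' = 2 W W', of 1 / (4 nu) from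
    completing the square, and of T from integrating W(a)^2 over 0 < a < T, which gives time s the
    weight T - s <= T. Exponents stay integers because an L^(4/3) density is written [s ^+ 3] with
    [s] in L^4; the Hardy-Littlewood-Sobolev bound then follows by testing the potential against the
    cube of its own truncation and absorbing. *)

Lemma measurable_invr (R : realType) : measurable_fun setT (fun x : R => x^-1).
Proof.
(* The real power -1 is the inverse on nonnegative arguments, hence the detour through x^2; at 0
   both sides are 0. *)
rewrite (_ : (fun x : R => x^-1) = (fun x => x * (x ^+ 2) `^ (-1))).
  apply: measurable_funM => //.
  apply: (measurableT_comp (measurable_powR (-1))).
  exact: measurable_funX.
apply/funext => x; rewrite powR_inv1 ?sqr_ge0//.
have [->|x0] := eqVneq x 0; first by rewrite invr0 mul0r.
by field.
Qed.

(** Recursion on the expression. Atoms are looked up among the hypotheses, so measurability facts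
    are put into the context before the call. The rule for differences precedes the one for sums, a
    difference being a sum with an opposite. *)
Ltac mfun :=
  lazymatch goal with
  | H : measurable_fun _ ?f |- measurable_fun _ ?f => exact: H
  | |- measurable_fun _ (fun _ => ?c) => exact: measurable_cst
  | |- measurable_fun _ (fun x => x) => exact: measurable_id
  | |- measurable_fun _ fst => exact: measurable_fst
  | |- measurable_fun _ snd => exact: measurable_snd
  | |- measurable_fun _ (fun x => EFin (@?f x)) =>
      apply/measurable_EFinP; mfun
  | |- measurable_fun _ (fun x => (@?f x, @?g x)) =>
      apply: (@measurable_fun_pair _ _ _ _ _ _ f g); mfun
  | |- measurable_fun _ (fun x => fst (@?f x)) =>
      apply: (measurableT_comp measurable_fst (g := f)); mfun
  | |- measurable_fun _ (fun x => snd (@?f x)) =>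
      apply: (measurableT_comp measurable_snd (g := f)); mfun
  | |- measurable_fun _ (fun x => GRing.add (@?f x) (GRing.opp (@?g x))) =>
      apply: (@measurable_funB _ _ _ _ f g); mfun
  | |- measurable_fun _ (fun x => GRing.add (@?f x) (@?g x)) =>
      apply: (@measurable_funD _ _ _ _ f g); mfun
  | |- measurable_fun _ (fun x => GRing.mul (@?f x) (@?g x)) =>
      apply: (@measurable_funM _ _ _ _ f g); mfun
  | |- measurable_fun _ (fun x => GRing.opp (@?f x)) =>
      apply: (@measurable_funN _ _ _ _ f); mfun
  | |- measurable_fun _ (fun x => GRing.exp (@?f x) ?n) =>
      apply: (@measurable_funX _ _ _ _ f n); mfun
  | |- measurable_fun _ (fun x => Num.norm (@?f x)) =>
      apply: (measurableT_comp (@normr_measurable _ setT) (g := f)); mfun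
  | |- measurable_fun _ (fun x => GRing.inv (@?f x)) =>
      apply: (measurableT_comp (@measurable_invr _) (g := f)); mfun
  | |- measurable_fun _ (fun x => Order.max (@?f x) (@?g x)) =>
      apply: (@measurable_maxr _ _ _ _ f g); mfun
  | |- measurable_fun _ (fun x => Order.min (@?f x) (@?g x)) =>
      apply: (@measurable_minr _ _ _ _ f g); mfun
  | |- measurable_fun _ (fun x => Order.le (@?f x) (@?g x)) =>
      apply: (@measurable_fun_ler _ _ _ _ f g); mfun
  | |- measurable_fun _ (fun x => Order.lt (@?f x) (@?g x)) =>
      apply: (@measurable_fun_ltr _ _ _ _ f g); mfun
  | |- measurable_fun _ (fun x => andb (@?f x) (@?g x)) =>
      apply: (@measurable_and _ _ _ f g); mfun
  | |- measurable_fun _ (fun x => orb (@?f x) (@?g x)) =>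
      apply: (@measurable_or _ _ _ f g); mfun
  | |- measurable_fun _ (fun x => negb (@?f x)) =>
      apply: (@measurable_neg _ _ _ f); mfun
  | H : measurable_fun _ ?f |- measurable_fun _ (fun x => ?f (@?g x)) =>
      apply: (measurableT_comp H (g := g)); mfun
  | |- measurable_fun _ _ => try (apply: measurable_fun_ifT; mfun)
  | |- _ => idtac
  end.

(** * Real-valued integrals and Lebesgue measure on the plane *)

Section ge0_real_integrals.
Local Open Scope ereal_scope.
Context d (T : measurableType d) (R : realType) (m : {measure set T -> \bar R}).
Implicit Types f g : T -> R.

Lemma le_ge0_integralT f g : measurable_fun setT f -> measurable_fun setT g ->
  (forall x, 0 <= f x)%R -> (forall x, f x <= g x)%R ->
  \int[m]_x (f x)%:E <= \int[m]_x (g x)%:E.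
Proof.
move=> mf mg f0 fg; apply: ge0_le_integral => //.
- by move=> x _; rewrite lee_fin.
- by mfun.
- by mfun.
- by move=> x _; rewrite lee_fin.
Qed.

Lemma ge0_integralDT f g : measurable_fun setT f -> measurable_fun setT g ->
  (forall x, 0 <= f x)%R -> (forall x, 0 <= g x)%R ->
  \int[m]_x (f x + g x)%:E = \int[m]_x (f x)%:E + \int[m]_x (g x)%:E.
Proof.
move=> mf mg f0 g0; rewrite -ge0_integralD//.
- by move=> x _; rewrite lee_fin.
- by mfun.
- by move=> x _; rewrite lee_fin.
- by mfun.
Qed.

Lemma ge0_integralZlT f (k : R) : measurable_fun setT f ->
  (forall x, 0 <= f x)%R -> (0 <= k)%R ->
  \int[m]_x (k * f x)%:E = k%:E * \int[m]_x (f x)%:E.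
Proof.
move=> mf f0 k0; rewrite -ge0_integralZl//.
- by mfun.
- by move=> x _; rewrite lee_fin.
Qed.

End ge0_real_integrals.

Lemma lte_EFin_mul (R : realType) (c : R) (y : \bar R) :
  0 <= c -> (y < +oo)%E -> (c%:E * y < +oo)%E.
Proof. by move=> c0 yoo; apply: lte_mul_pinfty; rewrite ?lee_fin. Qed.

Section tonelli.
Local Open Scope ereal_scope.
Context d1 d2 (X : measurableType d1) (Y : measurableType d2) (R : realType).
Variables (m1 : {sigma_finite_measure set X -> \bar R})
  (m2 : {sigma_finite_measure set Y -> \bar R}).

(** The diagonal rectangles F n x G n suffice because both exhaustions increase: a point is covered
    from the larger of its two indices on. *)
Lemma sigma_finite_prod : sigma_finite setT (m1 \x m2).
Proof.
have /sigma_finiteP[F [FT ndF Foo]] := sigma_finiteT m1.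
have /sigma_finiteP[G [GT ndG Goo]] := sigma_finiteT m2.
exists (fun n => F n `*` G n) => [|n]; last first.
  have [? ?] := Foo n; have [? ?] := Goo n.
  split; first exact: measurableX.
  by rewrite product_measure1E// lte_mul_pinfty// ge0_fin_numE.
apply/seteqP; split => -[x y]// _.
have [[n _ Fx] [k _ Gy]] : (\bigcup_i F i) x /\ (\bigcup_i G i) y.
  by rewrite -FT -GT.
exists (maxn n k) => //; split.
  by move: x Fx; exact/subsetPset/ndF/leq_maxl.
by move: y Gy; exact/subsetPset/ndG/leq_maxr.
Qed.

Lemma tonelli1 (f : X * Y -> R) : measurable_fun setT f ->
  (forall z, 0 <= f z)%R ->
  \int[m1 \x m2]_z (f z)%:E = \int[m1]_x \int[m2]_y (f (x, y))%:E.
Proof.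
move=> mf f0; rewrite (fubini_tonelli1 (fun z => (f z)%:E))//.
by mfun.
Qed.

Lemma tonelli (f : X -> Y -> R) : measurable_fun setT (fun z => f z.1 z.2) ->
  (forall x y, 0 <= f x y)%R ->
  \int[m1]_x \int[m2]_y (f x y)%:E = \int[m2]_y \int[m1]_x (f x y)%:E.
Proof.
move=> mf f0; rewrite (fubini_tonelli (fun z => (f z.1 z.2)%:E))//.
- by mfun.
- by move=> z; rewrite lee_fin.
Qed.

Lemma measurable_tonelliF (f : X -> Y -> R) :
  measurable_fun setT (fun z => f z.1 z.2) -> (forall x y, 0 <= f x y)%R ->
  measurable_fun setT (fun x => \int[m2]_y (f x y)%:E).
Proof.
move=> mf f0.
apply: (measurable_fun_fubini_tonelli_F (fun z => (f z.1 z.2)%:E)) => //.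
- by mfun.
- by move=> z; rewrite lee_fin.
Qed.

Lemma measurable_tonelliG (f : X -> Y -> R) :
  measurable_fun setT (fun z => f z.1 z.2) -> (forall x y, 0 <= f x y)%R ->
  measurable_fun setT (fun y => \int[m1]_x (f x y)%:E).
Proof.
move=> mf f0.
apply: (measurable_fun_fubini_tonelli_G (fun z => (f z.1 z.2)%:E)) => //.
- by mfun.
- by move=> z; rewrite lee_fin.
Qed.

End tonelli.

(* Copies of Lebesgue measure on the canonical measurable structures of [R] and
   [R * R]: [lebesgue_measure] lives on [measurableTypeR R], and the product
   measure has no sigma-finite instance, so iterated products would not typecheck. *)
Definition lam1 (R : realType) (A : set R) : \bar R := @lebesgue_measure R A.

Section lam1_measure.
Variable R : realType.
Notation lam1 := (@lam1 R).

Let lam10 : lam1 set0 = 0%E. Proof. exact: (@measure0 _ _ _ (@lebesgue_measure R)). Qed.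
Let lam1_ge0 A : (0 <= lam1 A)%E. Proof. exact: (@measure_ge0 _ _ _ (@lebesgue_measure R)). Qed.
Let lam1_sigma_additive : semi_sigma_additive lam1.
Proof. exact: (@measure_semi_sigma_additive _ _ _ (@lebesgue_measure R)). Qed.

HB.instance Definition _ := isMeasure.Build _ _ _ lam1
  lam10 lam1_ge0 lam1_sigma_additive.

Let lam1_sigma_finite : sigma_finite setT lam1.
Proof. exact: (@sigma_finiteT _ _ _ (@lebesgue_measure R)). Qed.

HB.instance Definition _ := @Measure_isSigmaFinite.Build _ _ _ lam1 lam1_sigma_finite.

End lam1_measure.

Definition lam2 (R : realType) (A : set (R * R)%type) : \bar R :=
  (@lam1 R \x @lam1 R)%E A.

Section lam2_measure.
Variable R : realType.
Notation lam2 := (@lam2 R).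

Let lam20 : lam2 set0 = 0%E.
Proof. exact: (@measure0 _ _ _ (@lam1 R \x @lam1 R)%E). Qed.
Let lam2_ge0 A : (0 <= lam2 A)%E.
Proof. exact: (@measure_ge0 _ _ _ (@lam1 R \x @lam1 R)%E). Qed.
Let lam2_sigma_additive : semi_sigma_additive lam2.
Proof. exact: (@measure_semi_sigma_additive _ _ _ (@lam1 R \x @lam1 R)%E). Qed.

HB.instance Definition _ := isMeasure.Build _ _ _ lam2
  lam20 lam2_ge0 lam2_sigma_additive.

Let lam2_sigma_finite : sigma_finite setT lam2.
Proof. exact: sigma_finite_prod. Qed.

HB.instance Definition _ := @Measure_isSigmaFinite.Build _ _ _ lam2 lam2_sigma_finite.

End lam2_measure.

Arguments lam1 {R}.
Arguments lam2 {R}.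

Section lam.
Context {R : realType}.

(** The identity between the two measurable structures is measurable and pushes Lebesgue measure
    forward to [lam1]. *)
Lemma ge0_integral_lam1 (D : set R) (f : R -> \bar R) : measurable D ->
  measurable_fun D f -> (forall x, D x -> 0 <= f x)%E ->
  (\int[lam1]_(x in D) f x = \int[@lebesgue_measure R]_(x in D) f x)%E.
Proof.
move=> mD mf f0.
pose g := (fun x : R => x) : measurableTypeR R -> R.
have mg : measurable_fun setT g by move=> _ Y mY; rewrite setTI.
transitivity (\int[pushforward (@lebesgue_measure R) g]_(x in D) f x)%E.
  exact: eq_measure_integral.
by rewrite ge0_integral_pushforward// => x; rewrite inE; exact: f0.
Qed.

Lemma integral_lam1 (D : set R) (f : R -> \bar R) : measurable D ->
  measurable_fun D f ->
  (\int[lam1]_(x in D) f x = \int[@lebesgue_measure R]_(x in D) f x)%E.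
Proof.
move=> mD mf; rewrite [LHS]integralE [RHS]integralE.
rewrite -ge0_integral_lam1//; last exact: measurable_funepos.
by rewrite -ge0_integral_lam1//; exact: measurable_funeneg.
Qed.

Lemma tonelli2 (f : R * R -> R) : measurable_fun setT f ->
  (forall z, 0 <= f z)%R ->
  (\int[lam2]_z (f z)%:E = \int[lam1]_x \int[lam1]_y (f (x, y))%:E)%E.
Proof. exact: tonelli1. Qed.

End lam.

Section basics.
Context {R : realType}.

(** By uniqueness of Lebesgue measure only the intervals ]c, d] have to be checked. *)
Lemma lebesgue_measure_shift (a : R) (A : set R) : measurable A ->
  lam1 ((fun x => x + a) @^-1` A) = lam1 A.
Proof.
move=> mA.
have mf : measurable_fun setT
    ((fun x : R => x + a) : measurableTypeR R -> measurableTypeR R).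
  by apply: measurable_funD.
pose g_mixin := isMeasurableFun.Build _ _ _ _ _ mf.
pose g : {mfun measurableTypeR R >-> measurableTypeR R} :=
  HB.pack (fun x : R => x + a) g_mixin.
rewrite -[LHS]/(pushforward (@lebesgue_measure R) g A).
apply/esym/lebesgue_measure_unique => //= _ [[c d]] _ <-.
rewrite /pushforward.
rewrite (_ : _ @^-1` _ = `]c - a, d - a]%classic); last first.
  by apply/seteqP; split => x /=; rewrite !in_itv/= ltrBlDr lerBrDr.
rewrite /= !lebesgue_measure_itv/= !lte_fin ltrD2r; case: ifP => // _.
by rewrite -!EFinB; congr EFin; ring.
Qed.

Lemma lam1_itv (i : interval R) :
  lam1 [set` i] = ((if i.1 < i.2 then (i.2 : \bar R) - i.1 else 0)%E : \bar R).
Proof. exact: lebesgue_measure_itv. Qed.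

Lemma ge0_integral_shift (a : R) (f : R -> \bar R) : measurable_fun setT f ->
  (forall x, 0 <= f x)%E -> (\int[lam1]_x f (x + a)%R = \int[lam1]_x f x)%E.
Proof.
move=> mf f0.
pose g (x : R) := x + a.
have mg : measurable_fun setT g by apply: measurable_funD.
rewrite -[LHS]/(\int[lam1]_(x in g @^-1` setT) (f \o g) x)%E.
rewrite -ge0_integral_pushforward//.
apply: eq_measure_integral => A mA AS; exact: lebesgue_measure_shift.
Qed.

Lemma ge0_integral_opp (f : R -> \bar R) : measurable_fun setT f ->
  (forall x, 0 <= f x)%E -> (\int[lam1]_x f (- x)%R = \int[lam1]_x f x)%E.
Proof.
move=> mf f0.
pose g (x : R) := - x.
have mg : measurable_fun setT g by exact: oppr_measurable.
rewrite -[LHS]/(\int[lam1]_(x in g @^-1` setT) (f \o g) x)%E.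
rewrite -ge0_integral_pushforward//.
apply: eq_measure_integral => A mA AS; exact: lebesgue_measureN.
Qed.

Lemma ge0_integral_shift2 (a b : R) (f : R * R -> R) : measurable_fun setT f ->
  (forall x, 0 <= f x) ->
  (\int[lam2]_x (f (x.1 + a, x.2 + b)%R)%:E = \int[lam2]_x (f x)%:E)%E.
Proof.
move=> mf f0; rewrite tonelli2; [|by mfun|by move=> z; exact: f0]; rewrite (tonelli2 mf f0).
transitivity (\int[lam1]_x \int[lam1]_y (f ((x + a)%R, y))%:E)%E.
  apply: eq_integral => x _.
  rewrite (@ge0_integral_shift b (fun y => (f ((x + a)%R, y))%:E))//; last first.
    by move=> y; rewrite lee_fin.
  by mfun.
rewrite (@ge0_integral_shift a (fun x => \int[lam1]_y (f (x, y))%:E)%E)//.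
- by apply: measurable_tonelliF => //; mfun.
- by move=> x; apply: integral_ge0 => y _; rewrite lee_fin.
Qed.

Lemma ge0_integral_opp2 (f : R * R -> R) : measurable_fun setT f ->
  (forall x, 0 <= f x) ->
  (\int[lam2]_x (f (- x.1, - x.2)%R)%:E = \int[lam2]_x (f x)%:E)%E.
Proof.
move=> mf f0; rewrite tonelli2; [|by mfun|by move=> z; exact: f0]; rewrite (tonelli2 mf f0).
transitivity (\int[lam1]_x \int[lam1]_y (f ((- x)%R, y))%:E)%E.
  apply: eq_integral => x _.
  rewrite (@ge0_integral_opp (fun y => (f ((- x)%R, y))%:E))//; last first.
    by move=> y; rewrite lee_fin.
  by mfun.
rewrite (@ge0_integral_opp (fun x => \int[lam1]_y (f (x, y))%:E)%E)//.
- by apply: measurable_tonelliF => //; mfun.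
- by move=> x; apply: integral_ge0 => y _; rewrite lee_fin.
Qed.

Lemma ge0_integral_sub2 (a b : R) (f : R * R -> R) : measurable_fun setT f ->
  (forall x, 0 <= f x) ->
  (\int[lam2]_x (f (a - x.1, b - x.2)%R)%:E = \int[lam2]_x (f x)%:E)%E.
Proof.
move=> mf f0.
rewrite -(@ge0_integral_opp2 f)//.
rewrite -(@ge0_integral_shift2 (- a) (- b) (fun x => f (- x.1, - x.2)))//=; last by mfun.
by apply: eq_integral => x _; rewrite !opprD !opprK addrC [- x.2 + b]addrC.
Qed.

Lemma ge0_integral_prod (f g : R -> R) : measurable_fun setT f ->
  measurable_fun setT g -> (forall x, 0 <= f x) -> (forall x, 0 <= g x) ->
  (\int[lam2]_x (f x.1 * g x.2)%:E =
   \int[lam1]_x (f x)%:E * \int[lam1]_x (g x)%:E)%E.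
Proof.
move=> mf mg f0 g0.
rewrite tonelli2; [|by mfun|by move=> x; rewrite mulr_ge0].
have mf' : measurable_fun setT (fun x => (f x)%:E) by mfun.
have mg' : measurable_fun setT (fun x => (g x)%:E) by mfun.
under eq_integral => x _.
  under eq_integral do rewrite EFinM.
  rewrite /= ge0_integralZl//; last by rewrite lee_fin.
  over.
  by move=> y _; rewrite lee_fin.
rewrite ge0_integralZr//.
  by move=> y _; rewrite lee_fin.
by apply: integral_ge0 => y _; rewrite lee_fin.
Qed.

(** For [d = 0] this is the layer-cake formula for 1/a used in [kap_near]; for [a = 0] it measures
    the decaying weights that appear in [kap_near] and [kap_far]. *)
Lemma integral_inv_sqr (a d : R) : 0 < a + d ->
  (\int[lam1]_(c in `[a, +oo[) (((c + d) ^+ 2)^-1)%:E = ((a + d)^-1)%:E)%E.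
Proof.
move=> ad.
have cF x : a <= x ->
    is_derive x 1 (fun c : R => - (c + d)^-1) ((x + d) ^+ 2)^-1.
  move=> ax; have xd : x + d != 0 by rewrite gt_eqF//; lra.
  have h : is_derive x 1 (fun c : R => c + d) 1.
    by apply: is_derive_eq; rewrite addr0.
  have h1 := @is_deriveV _ (fun c : R => c + d) x 1 1 xd h.
  by apply: is_derive_eq; rewrite /GRing.scale/= mulr1 opprK.
have cf : continuous (fun c : R => c + d).
  by move=> x; apply: cvgD; [exact: cvg_id|exact: cvg_cst].
have cv x : a <= x -> {for x, continuous (fun c : R => ((c + d) ^+ 2)^-1)}.
  move=> ax; apply: cvgV.
    by rewrite expf_neq0// gt_eqF//; lra.
  apply: (@continuous_comp _ _ _ (fun c : R => c + d) (fun c => c ^+ 2)).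
    exact: cf.
  exact: exprn_continuous.
rewrite integral_lam1//; last by apply: measurable_funTS; mfun.
rewrite (@ge0_continuous_FTC2y _ _ (fun c : R => - (c + d)^-1) a 0).
- by rewrite -EFinB sub0r opprK.
- by move=> x ax; rewrite invr_ge0 sqr_ge0.
- apply/continuous_within_itvcyP; split.
    by move=> x; rewrite in_itv/= andbT => /ltW ax; exact: cv.
  by apply: cvg_at_right_filter; exact: cv.
- rewrite -oppr0; apply: cvgN; apply/gtr0_cvgV0.
    near=> x; have : a < x by near: x; apply: nbhs_pinfty_gt; rewrite num_real.
    by lra.
  apply/cvgryPge => A; near=> x.
  have : A - d <= x by near: x; apply: nbhs_pinfty_ge; rewrite num_real.
  by lra.
- by move=> x /ltW ax; have [] := cF x ax.
- apply: cvg_at_right_filter.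
  have [+ _] := cF a (lexx _).
  by move=> /derivable1_diffP/differentiable_continuous.
- move=> x; rewrite in_itv/= andbT => /ltW ax.
  by rewrite derive1E; have [] := cF x ax.
Unshelve. all: by end_near. Qed.

Lemma integral_inv_sqr_norm (d : R) : 0 < d ->
  (\int[lam1]_c (((`|c| + d) ^+ 2)^-1)%:E = (2 / d)%:E)%E.
Proof.
move=> d0.
rewrite integral_lam1//; last by mfun.
rewrite (@ge0_symfun_integralT _ (fun c : R => ((`|c| + d) ^+ 2)^-1)).
- rewrite (_ : [set x | 0 <= x] = `[0, +oo[%classic); last first.
    by apply/seteqP; split => x /=; rewrite in_itv/= andbT.
  transitivity (2 * \int[@lebesgue_measure R]_(c in `[0%R, +oo[) (((c + d) ^+ 2)^-1)%:E)%E; last first.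
    rewrite -integral_lam1//; last by apply: measurable_funTS; mfun.
    by rewrite integral_inv_sqr add0r// -EFinM.
  congr (_ * _)%E; apply: eq_integral.
  move=> x; rewrite inE/= in_itv/= andbT => x0.
  by rewrite ger0_norm.
- by move=> x; rewrite invr_ge0 sqr_ge0.
- move=> x; apply: cvgV.
    by rewrite expf_neq0// gt_eqF// ltr_wpDl.
  apply: (@continuous_comp _ _ _ (fun c : R => `|c| + d) (fun c => c ^+ 2)).
    apply: cvgD; last exact: cvg_cst.
    exact: norm_continuous.
  exact: exprn_continuous.
- by move=> x /=; rewrite normrN.
Qed.

End basics.

(* Up to a constant, a majorant of the Biot-Savart kernel; the l1 norm makes it
   integrable on product domains by one-variable computations. *)
Definition kap (R : realType) (z : R * R) : R := (`|z.1| + `|z.2|)^-1.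

Section kernel.
Context {R : realType}.

Lemma kap_ge0 (z : R * R) : 0 <= kap z.
Proof. by rewrite invr_ge0 addr_ge0. Qed.

Lemma measurable_kap : measurable_fun setT (@kap R).
Proof. by rewrite /kap; mfun. Qed.

Lemma measurable_box (c : R) :
  measurable_fun setT (fun z : R * R => \1_(`[- c, c]%classic) z.1 * \1_(`[- c, c]%classic) z.2 : R).
Proof.
have h : measurable_fun setT (\1_(`[- c, c]%classic) : R -> R).
  by apply: measurable_indic; exact: measurable_itv.
by mfun.
Qed.

Lemma integral_box (c : R) : 0 <= c ->
  (\int[lam2]_z (\1_(`[- c, c]%classic) z.1 * \1_(`[- c, c]%classic) z.2)%:E
   = (4 * c ^+ 2)%:E :> \bar R)%E.
Proof.
move=> c0; rewrite ge0_integral_prod//.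
rewrite integral_indic// setIT /= lam1_itv/= lte_fin.
case: ifPn; first by move=> _; rewrite -EFinD -EFinM; congr EFin; ring.
rewrite -leNgt => h; have -> : c = 0 by lra.
by rewrite mul0e expr0n/= mulr0.
Qed.

(** Layer cake instead of polar coordinates: [kap z] is the integral of c^-2 over c >= |z.1| +
    |z.2|. After Tonelli only areas of l1 balls are left, and these are bounded by squares of
    half-side min(c, r). *)
Lemma kap_near (r : R) : 0 < r ->
  (\int[lam2]_z (kap z * (if `|z.1| + `|z.2| < r then 1 else 0))%:E
   <= (32 * r)%:E)%E.
Proof.
move=> r0.
pose F (z : R * R) (c : R) : R := if `|z.1| + `|z.2| <= c then
   (if `|z.1| + `|z.2| < r then ((c + 0) ^+ 2)^-1 else 0) else 0.
have mF : measurable_fun setT (fun p : (R * R) * R => F p.1 p.2).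
  by rewrite /F; mfun.
have F0 z c : 0 <= F z c.
  by rewrite /F; case: ifP => // _; case: ifP => // _; rewrite invr_ge0 sqr_ge0.
have mFE : measurable_fun setT (fun p : (R * R) * R => (F p.1 p.2)%:E).
  by mfun.
have inner z : ((kap z * (if `|z.1| + `|z.2| < r then 1 else 0))%:E <=
    \int[lam1]_c (F z c)%:E)%E.
  have : (0 <= \int[lam1]_c (F z c)%:E)%E.
    by apply: integral_ge0 => c _; rewrite lee_fin.
  rewrite /F /kap; case: ifPn => [zr _|_]; last by rewrite mulr0.
  have [->|z0] := eqVneq (`|z.1| + `|z.2|) 0.
    rewrite invr0 mul0r; apply: integral_ge0 => c _.
    by case: ifP => //; rewrite lee_fin invr_ge0 sqr_ge0.
  rewrite mulr1 -(addr0 (`|z.1| + `|z.2|)) -integral_inv_sqr ?addr0; last first.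
    by rewrite lt_neqAle eq_sym z0 addr_ge0.
  rewrite integral_mkcond le_eqVlt; apply/orP; left; apply/eqP.
  apply: eq_integral => c _; rewrite patchE mem_setE in_itv/= andbT addr0.
  by case: ifP.
apply: (@le_trans _ _ (\int[lam2]_z \int[lam1]_c (F z c)%:E)%E).
  apply: ge0_le_integral => //.
  - by move=> z _; rewrite lee_fin mulr_ge0 ?kap_ge0//; case: ifP.
  - by have h := measurable_kap; mfun.
  - exact: measurable_tonelliF.
have -> : (\int[lam2]_z \int[lam1]_c (F z c)%:E = \int[lam1]_c \int[lam2]_z (F z c)%:E)%E by exact: tonelli.
apply: (@le_trans _ _ (\int[lam1]_c ((16 * r ^+ 2) * ((`|c| + r) ^+ 2)^-1)%:E)%E).
  apply: ge0_le_integral => //.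
  - by move=> c _; apply: integral_ge0 => z _; rewrite lee_fin.
  - exact: measurable_tonelliG.
  - by mfun.
  (* For c <= 0 the condition |z.1| + |z.2| <= c leaves only c = 0, where the inverse of 0 is 0. *)
  - move=> c _ /=; have [c0|c0] := ltP 0 c; last first.
      rewrite integral0_eq; last first.
        move=> z _; rewrite /F; case: ifPn => // h.
        have -> : c = 0.
          have a0 := normr_ge0 z.1; have b0 := normr_ge0 z.2; lra.
        by rewrite addr0 expr0n/= invr0; case: ifP.
      rewrite lee_fin; apply: divr_ge0; last exact: sqr_ge0.
      by apply: mulr_ge0; [exact: ler0n|exact: sqr_ge0].
    apply: (@le_trans _ _ (\int[lam2]_z ((c ^+ 2)^-1 * (\1_(`[- (Num.min c r), Num.min c r]%classic) z.1 * \1_(`[- (Num.min c r), Num.min c r]%classic) z.2))%:E)%E).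
      apply: le_ge0_integralT => //.
      - by apply: (measurableT_comp mF (g := fun z => (z, c))); mfun.
      - by have h := measurable_box (Num.min c r); mfun.
      - move=> z; rewrite /F addr0; case: ifPn => h1; last first.
          by rewrite !mulr_ge0// invr_ge0 sqr_ge0.
        case: ifPn => h2; last first.
          by rewrite !mulr_ge0// invr_ge0 sqr_ge0.
        have a0 := normr_ge0 z.1; have b0 := normr_ge0 z.2.
        have A1 : `|z.1| <= Num.min c r by rewrite le_min; apply/andP; split; lra.
        have A2 : `|z.2| <= Num.min c r by rewrite le_min; apply/andP; split; lra.
        by rewrite !indicE !mem_setE !in_itv/= -!ler_norml A1 A2 !mulr1.
    rewrite ge0_integralZlT//; last 2 first.
    - exact: measurable_box.
    - by rewrite invr_ge0 sqr_ge0.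
    have m0 : 0 <= Num.min c r by rewrite le_min (ltW c0) (ltW r0).
    rewrite integral_box// -EFinM lee_fin gtr0_norm//.
    (* This turns c^-2 times the area 4 min(c, r)^2 into 16 r^2 / (c + r)^2, integrable in c with
       total 16 r^2 * (2 / r) = 32 r. *)
    have h : Num.min c r * (c + r) <= 2 * (c * r).
      by rewrite minEle; case: ifPn => h; nra.
    rewrite mulrC -ler_pdivlMr ?invr_gt0 ?exprn_gt0// invrK mulrAC.
    rewrite ler_pdivlMr ?exprn_gt0 ?addr_gt0//.
    rewrite -mulrA -exprMn (_ : 16 * _ * _ = 4 * (2 * (c * r)) ^+ 2); last by ring.
    rewrite ler_pM2l// ler_sqr ?nnegrE// ?mulr_ge0 ?addr_ge0 ?(ltW c0) ?(ltW r0)//.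
rewrite ge0_integralZlT//; last 3 first.
- by mfun.
- by move=> c; rewrite invr_ge0 sqr_ge0.
- by rewrite mulr_ge0 ?sqr_ge0.
rewrite integral_inv_sqr_norm// -EFinM lee_fin.
by rewrite le_eqVlt; apply/orP; left; apply/eqP; field; rewrite gt_eqF.
Qed.

(** If a + b >= r, both a + r and b + r are at most 2 (a + b), so (a + b)^-4 <= 16 (a + r)^-2 (b +
    r)^-2. The majorant is a product, with integral 16 (2 / r)^2. *)
Lemma kap_far (r : R) : 0 < r ->
  (\int[lam2]_z (kap z ^+ 4 * (if `|z.1| + `|z.2| < r then 0 else 1))%:E
   <= (64 / r ^+ 2)%:E)%E.
Proof.
move=> r0.
apply: (@le_trans _ _ (\int[lam2]_z (16 * (((`|z.1| + r) ^+ 2)^-1 * ((`|z.2| + r) ^+ 2)^-1))%:E)%E).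
  apply: le_ge0_integralT.
  - have := measurable_kap; move=> h; mfun.
  - by mfun.
  - by move=> z; rewrite mulr_ge0 ?exprn_ge0 ?kap_ge0//; case: ifP.
  - move=> z; rewrite /kap; have a0 := normr_ge0 z.1; have b0 := normr_ge0 z.2.
    move: a0 b0; move: (`|z.1|) (`|z.2|) => a b a0 b0.
    case: ltP => h.
      by rewrite mulr0 !mulr_ge0// invr_ge0 sqr_ge0.
    have ab : 0 < a + b by lra.
    rewrite mulr1 exprVn -invfM ler_pdivlMr; last by rewrite mulr_gt0 ?exprn_gt0; lra.
    rewrite mulrC ler_pdivrMr ?exprn_gt0// -exprMn.
    rewrite (_ : 16 * _ = ((2 * (a + b)) ^+ 2) ^+ 2); last by ring.
    rewrite ler_sqr ?nnegrE ?sqr_ge0 ?mulr_ge0//; [nra|lra|lra].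
rewrite ge0_integralZlT//; last 2 first.
- by mfun.
- by move=> z; rewrite mulr_ge0// invr_ge0 sqr_ge0.
rewrite (@ge0_integral_prod _ (fun c => ((`|c| + r) ^+ 2)^-1) (fun c => ((`|c| + r) ^+ 2)^-1)); last 4 first.
- by mfun.
- by mfun.
- by move=> x; rewrite invr_ge0 sqr_ge0.
- by move=> x; rewrite invr_ge0 sqr_ge0.
rewrite integral_inv_sqr_norm// -!EFinM lee_fin.
by rewrite le_eqVlt; apply/orP; left; apply/eqP; field; rewrite gt_eqF.
Qed.

Lemma measurable_box_norm (c : R) :
  measurable_fun setT (fun z : R * R => (`|z.1| <= c) && (`|z.2| <= c)).
Proof. by mfun. Qed.

Lemma integral_box_norm (c : R) : 0 <= c ->
  (\int[lam2]_z (if (`|z.1| <= c) && (`|z.2| <= c) then 1 else 0)%:E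
   = (4 * c ^+ 2)%:E :> \bar R)%E.
Proof.
move=> c0; rewrite -integral_box//; apply: eq_integral => z _.
rewrite !indicE !mem_setE !in_itv/= -!ler_norml.
by case: (`|z.1| <= c); case: (`|z.2| <= c); rewrite /= ?(mulr1, mulr0).
Qed.

End kernel.

(** * Hardy-Littlewood-Sobolev inequality *)

Section hls.
Context {R : realType}.
Local Notation ksub x y := (kap (x.1 - y.1, x.2 - y.2)).

Lemma kap_sym (x y : R * R) : ksub x y = ksub y x.
Proof. by rewrite /kap/= distrC [`|x.2 - _|]distrC. Qed.

(* Split the kernel at distance [rho]: on the near part [r <= t], on the far part
   Young's inequality [r ^ 3 k <= m r ^ 4 + m ^ -3 k ^ 4]. *)
Lemma hls_inner (r : R * R -> R) (X t rho m : R) (a : R * R) :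
  measurable_fun setT r -> (forall x, 0 <= r x) -> 0 <= t -> 0 < rho -> 0 < m ->
  (\int[lam2]_y (r y ^+ 4)%:E <= X%:E)%E ->
  (\int[lam2]_y ((if r y <= t then r y ^+ 3 else 0) * ksub a y)%:E
   <= (t ^+ 3 * (32 * rho) + m * X + m ^- 3 * (64 / rho ^+ 2))%:E)%E.
Proof.
move=> mr r0 t0 rho0 m0 rX.
have mk := @measurable_kap R.
pose nearf z := kap z * (if `|z.1| + `|z.2| < rho then 1 else 0).
pose farf z := kap z ^+ 4 * (if `|z.1| + `|z.2| < rho then 0 else 1).
have mn : measurable_fun setT nearf by rewrite /nearf; mfun.
have mf : measurable_fun setT farf by rewrite /farf; mfun.
have n0 z : 0 <= nearf z by rewrite mulr_ge0 ?kap_ge0//; case: ifP.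
have f0 z : 0 <= farf z by rewrite mulr_ge0 ?exprn_ge0 ?kap_ge0//; case: ifP.
pose ns y := nearf (a.1 - y.1, a.2 - y.2).
pose fs y := farf (a.1 - y.1, a.2 - y.2).
have mns : measurable_fun setT ns by rewrite /ns; mfun.
have mfs : measurable_fun setT fs by rewrite /fs; mfun.
apply: (@le_trans _ _ (\int[lam2]_y (t ^+ 3 * ns y + (m * r y ^+ 4 + m ^- 3 * fs y))%:E)%E).
  apply: le_ge0_integralT.
  - by mfun.
  - by mfun.
  - by move=> y; rewrite mulr_ge0 ?kap_ge0//; case: ifP => // _; rewrite exprn_ge0.
  - move=> y; rewrite /ns /fs /nearf /farf /=.
    have := kap_ge0 (a.1 - y.1, a.2 - y.2); move: (kap _) => k k0.
    have mV : 0 < m ^- 3 by rewrite invr_gt0 exprn_gt0.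
    have R0 : 0 <= t ^+ 3 * k by rewrite mulr_ge0 ?exprn_ge0.
    have R1 : 0 <= m * r y ^+ 4 by rewrite mulr_ge0 ?exprn_ge0// ltW.
    have R2 : 0 <= m ^- 3 * k ^+ 4 by rewrite mulr_ge0 ?exprn_ge0// ltW.
    case: ifPn => ry; last first.
      by rewrite mul0r; case: ifP; rewrite !(mulr1, mulr0) ?addr0 ?add0r ?addr_ge0.
    case: ifPn => _; rewrite !(mulr1, mulr0) ?addr0 ?add0r.
      rewrite -[leLHS]addr0 lerD// ler_wpM2r// lerXn2r// nnegrE//.
    (* Young by cases: k <= m r gives r^3 k <= m r^4, while r < k / m gives r^3 k <= m^-3 k^4. *)
    have [km|km] := leP k (m * r y).
      apply: (@le_trans _ _ (m * r y ^+ 4)); last by rewrite lerDl.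
      rewrite [leRHS](_ : _ = r y ^+ 3 * (m * r y)); last by ring.
      by rewrite ler_wpM2l// exprn_ge0.
    apply: (@le_trans _ _ (m ^- 3 * k ^+ 4)); last by rewrite lerDr.
    rewrite (exprSr k 3) mulrA ler_wpM2r// mulrC ler_pdivlMr ?exprn_gt0//.
    by rewrite -exprMn lerXn2r ?nnegrE ?mulr_ge0// 1?mulrC ltW.
have c0 : 0 <= m ^- 3 by rewrite invr_ge0 exprn_ge0// ltW.
rewrite ge0_integralDT//; last 4 first.
- by mfun.
- by mfun.
- by move=> y; apply: mulr_ge0; [rewrite exprn_ge0|exact: n0].
- move=> y; apply: addr_ge0; apply: mulr_ge0 => //; last exact: f0.
    exact: ltW.
  by rewrite exprn_ge0.
rewrite ge0_integralDT//; last 4 first.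
- by mfun.
- by mfun.
- by move=> y; rewrite mulr_ge0 ?exprn_ge0// ltW.
- by move=> y; apply: mulr_ge0 => //; exact: f0.
rewrite !ge0_integralZlT//; last 5 first.
- by mfun.
- by move=> y; rewrite exprn_ge0.
- exact: ltW.
- by move=> y; exact: n0.
- by rewrite exprn_ge0.
- rewrite -addrA !EFinD; apply: leeD; last apply: leeD.
  + rewrite [leRHS]EFinM; apply: lee_wpmul2l; first by rewrite lee_fin exprn_ge0.
    by rewrite (ge0_integral_sub2 a.1 a.2 mn n0); exact: kap_near.
  + by rewrite [leRHS]EFinM; apply: lee_wpmul2l => //; rewrite lee_fin ltW.
  + rewrite [leRHS]EFinM; apply: lee_wpmul2l; first by rewrite lee_fin.
    by rewrite (ge0_integral_sub2 a.1 a.2 mf f0); exact: kap_far.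
- by move=> y; exact: f0.
Qed.

(** With t = 64 s, rho = s^-2 and m = s / 8 the inner bound times s^3 equals (32 * 64^3 + X / 8 +
    8^3 * 64) s^4; [hlsC] collects the terms without X. *)
Definition hlsC : R := 32 * 64 ^+ 3 + 8 ^+ 3 * 64.

(* The plane of values (s x, r y) is cut along [r y = 64 s x]; on each side the
   inner bound is applied with a radius proportional to the inverse square of
   the fixed value. The term [X / 2] is absorbed in [hls]. *)
Lemma hls_bilinear (s r : R * R -> R) (X : R) :
  measurable_fun setT s -> (forall x, 0 <= s x) ->
  measurable_fun setT r -> (forall x, 0 <= r x) ->
  (\int[lam2]_y (s y ^+ 4)%:E <= 1)%E ->
  (\int[lam2]_y (r y ^+ 4)%:E = X%:E)%E ->
  (\int[lam2]_x \int[lam2]_y (r x ^+ 3 * (s y ^+ 3 * ksub x y))%:E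
    <= (hlsC + X / 2)%:E)%E.
Proof.
move=> ms s0 mr r0 sS rX.
have mk := @measurable_kap R.
have k0 := @kap_ge0 R.
pose F x y := s x ^+ 3 * ((if r y <= 64 * s x then r y ^+ 3 else 0) * ksub x y).
pose G x y := r x ^+ 3 * ((if s y <= 64^-1 * r x then s y ^+ 3 else 0) * ksub x y).
have X0 : 0 <= X.
  by rewrite -lee_fin -rX; apply: integral_ge0 => y _; rewrite lee_fin exprn_ge0.
have mF : measurable_fun setT (fun z => F z.1 z.2) by rewrite /F; mfun.
have mG : measurable_fun setT (fun z => G z.1 z.2) by rewrite /G; mfun.
have F0 x y : 0 <= F x y.
  by rewrite /F !mulr_ge0 ?exprn_ge0//; case: ifP => // _; rewrite exprn_ge0.
have G0 x y : 0 <= G x y.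
  by rewrite /G !mulr_ge0 ?exprn_ge0//; case: ifP => // _; rewrite exprn_ge0.
have mF' : measurable_fun setT (fun z => F z.2 z.1).
  by apply: (measurableT_comp mF (g := fun z => (z.2, z.1))); mfun.
have mF2 x : measurable_fun setT (F x).
  by apply: (measurableT_comp mF (g := fun z => (x, z))); mfun.
have mF1 x : measurable_fun setT (F ^~ x).
  by apply: (measurableT_comp mF (g := fun z => (z, x))); mfun.
have mG2 x : measurable_fun setT (G x).
  by apply: (measurableT_comp mG (g := fun z => (x, z))); mfun.
apply: (@le_trans _ _ (\int[lam2]_x \int[lam2]_y (F y x)%:E +
    \int[lam2]_x \int[lam2]_y (G x y)%:E)%E).
  rewrite -ge0_integralD//; last 4 first.
  - by move=> x _; apply: integral_ge0 => y _; rewrite lee_fin.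
  - by apply: (@measurable_tonelliF _ _ _ _ _ _ (fun x y => F y x)).
  - by move=> x _; apply: integral_ge0 => y _; rewrite lee_fin.
  - exact: measurable_tonelliF.
  apply: ge0_le_integral => //.
  - move=> x _; apply: integral_ge0 => y _.
    by rewrite lee_fin !mulr_ge0 ?exprn_ge0.
  - apply: measurable_tonelliF => [|x y]; first by mfun.
    by rewrite !mulr_ge0 ?exprn_ge0.
  - apply: emeasurable_funD.
    + by apply: (@measurable_tonelliF _ _ _ _ _ _ (fun x y => F y x)).
    + exact: measurable_tonelliF.
  - move=> x _ /=; rewrite -ge0_integralDT//.
    apply: le_ge0_integralT.
    + by mfun.
    + by have h1 := mF1 x; have h2 := mG2 x; mfun.
    + by move=> y; rewrite !mulr_ge0 ?exprn_ge0.
    + move=> y; have [h|h] := leP (r x) (64 * s y).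
        rewrite -[leLHS]addr0 lerD// /F h kap_sym mulrCA.
        by rewrite le_eqVlt; apply/orP; left; apply/eqP; ring.
      rewrite -[leLHS]add0r lerD// /G ifT//.
      by rewrite mulrC ler_pdivlMr// mulrC ltW.
have Sge0 : (0 <= \int[lam2]_y (s y ^+ 4)%:E)%E.
  by apply: integral_ge0 => y _; rewrite lee_fin exprn_ge0.
have H1 : (\int[lam2]_x \int[lam2]_y (F y x)%:E <= (hlsC + X / 8)%:E)%E.
  rewrite (@tonelli _ _ _ _ _ lam2 lam2 (fun x y => F y x))//.
  apply: (@le_trans _ _ (\int[lam2]_y ((hlsC + X / 8) * s y ^+ 4)%:E)%E).
    apply: ge0_le_integral => //.
    - by move=> x _; apply: integral_ge0 => y _; rewrite lee_fin.
    - exact: measurable_tonelliF.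
    - by mfun.
    - move=> x _ /=.
      have [sx0|sx0] := eqVneq (s x) 0.
        rewrite integral0_eq; last by move=> y _; rewrite /F sx0 expr0n/= mul0r.
        by rewrite sx0 expr0n/= mulr0.
      have sx : 0 < s x by rewrite lt_neqAle eq_sym sx0 s0.
      rewrite ge0_integralZlT ?exprn_ge0//; last 2 first.
      - by mfun.
      - by move=> y; rewrite mulr_ge0//; case: ifP => // _; rewrite exprn_ge0.
      have h1 : 0 <= 64 * s x by rewrite mulr_ge0.
      have h2 : 0 < s x ^- 2 by rewrite invr_gt0 exprn_gt0.
      have h3 : 0 < s x / 8 by rewrite divr_gt0.
      have h4 : (\int[lam2]_y (r y ^+ 4)%:E <= X%:E)%E by rewrite rX.
      have h5 : (0 <= (s x ^+ 3)%:E)%E by rewrite lee_fin exprn_ge0.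
      have := lee_wpmul2l h5 (@hls_inner r X _ _ _ x mr r0 h1 h2 h3 h4).
      move=> h; apply: (le_trans h).
      rewrite -EFinM lee_fin le_eqVlt; apply/orP; left; apply/eqP.
        by rewrite /hlsC; field.
  rewrite ge0_integralZlT//; last 3 first.
  - by mfun.
  - by move=> y; rewrite exprn_ge0.
  - by rewrite addr_ge0 ?divr_ge0// /hlsC; lra.
  rewrite -[leRHS]mule1 lee_wpmul2l// lee_fin.
  by rewrite addr_ge0 ?divr_ge0// /hlsC; lra.
have H2 : (\int[lam2]_x \int[lam2]_y (G x y)%:E <= (X * (3 / 8))%:E)%E.
  apply: (@le_trans _ _ (\int[lam2]_y ((3 / 8) * r y ^+ 4)%:E)%E).
    apply: ge0_le_integral => //.
    - by move=> x _; apply: integral_ge0 => y _; rewrite lee_fin.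
    - exact: measurable_tonelliF.
    - by mfun.
    - move=> x _ /=.
      have [sx0|sx0] := eqVneq (r x) 0.
        rewrite integral0_eq; last by move=> y _; rewrite /G sx0 expr0n/= mul0r.
        by rewrite sx0 expr0n/= mulr0.
      have sx : 0 < r x by rewrite lt_neqAle eq_sym sx0 r0.
      rewrite ge0_integralZlT ?exprn_ge0//; last 2 first.
      - by mfun.
      - by move=> y; rewrite mulr_ge0//; case: ifP => // _; rewrite exprn_ge0.
      have h1 : 0 <= 64^-1 * r x by rewrite mulr_ge0.
      (* With t = r / 64, this radius and m = r / 8, the inner bound times r^3 is (1/16 + 1/8 + 1/8)
         r^4 = (5/16) r^4, at most (3/8) r^4. Together with the X / 8 of the other side this leaves
         X / 2. *)
      have h2 : 0 < 8 ^+ 3 * r x ^- 2.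
        by apply: mulr_gt0; [rewrite exprn_gt0|rewrite invr_gt0 exprn_gt0].
      have h3 : 0 < r x / 8 by rewrite divr_gt0.
      have h5 : (0 <= (r x ^+ 3)%:E)%E by rewrite lee_fin exprn_ge0.
      have := lee_wpmul2l h5 (@hls_inner s 1 _ _ _ x ms s0 h1 h2 h3 sS).
      move=> h; apply: (le_trans h).
      rewrite -EFinM lee_fin.
        rewrite [leLHS](_ : _ = (5 / 16) * r x ^+ 4); last by field.
        by apply: ler_wpM2r; [rewrite exprn_ge0|lra].
  rewrite ge0_integralZlT//; last 2 first.
  - by mfun.
  - by move=> y; rewrite exprn_ge0.
  by rewrite rX -EFinM lee_fin mulrC.
apply: (le_trans (leeD H1 H2)).
by rewrite -EFinD lee_fin; lra.
Qed.

End hls.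

Section hls_potential.
Context {R : realType}.
Local Notation ksub x y := (kap (x.1 - y.1, x.2 - y.2)).
Local Notation hlsC := (@hlsC R).
Implicit Type s : R * R -> R.

(** Majorant of the Biot-Savart potential of a density of modulus s^3; the density is in L^(4/3)
    exactly when s is in L^4. *)
Definition rpot (s : R * R -> R) (x : R * R) : \bar R :=
  (\int[lam2]_y (s y ^+ 3 * ksub x y)%:E)%E.

Lemma measurable_rpot s : measurable_fun setT s -> (forall x, 0 <= s x) ->
  measurable_fun setT (rpot s).
Proof.
move=> ms s0; have mk := @measurable_kap R.
have h0 (x y : R * R) : 0 <= s y ^+ 3 * ksub x y.
  by rewrite mulr_ge0 ?exprn_ge0 ?kap_ge0.
have h1 : measurable_fun setT (fun z : (R * R) * (R * R) => s z.2 ^+ 3 * ksub z.1 z.2) by mfun.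
exact: (measurable_tonelliF lam2 h1 h0).
Qed.
Lemma rpot_ge0 s x : (forall x, 0 <= s x) -> (0 <= rpot s x)%E.
Proof.
move=> s0; apply: integral_ge0 => y _.
by rewrite lee_fin mulr_ge0 ?exprn_ge0 ?kap_ge0.
Qed.

Lemma min_rpot_fin s x (N : nat) : (forall x, 0 <= s x) ->
  Order.min (rpot s x) N%:R%:E \is a fin_num.
Proof.
move=> s0; rewrite ge0_fin_numE; last by rewrite le_min rpot_ge0//= lee_fin ler0n.
by rewrite gt_min ltry orbT.
Qed.

(** Cut in height and in space, the potential has a finite fourth-power integral beforehand, which
    the absorption of X / 2 requires. *)
Definition rtrunc s (N : nat) (x : R * R) : R :=
  if (`|x.1| <= N%:R) && (`|x.2| <= N%:R)
  then fine (Order.min (rpot s x) N%:R%:E) else 0.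

Lemma rtrunc_le s N x : (forall x, 0 <= s x) ->
  [/\ 0 <= rtrunc s N x, rtrunc s N x <= N%:R & ((rtrunc s N x)%:E <= rpot s x)%E].
Proof.
move=> s0; have p0 := rpot_ge0 x s0; rewrite /rtrunc; case: ifPn => // _.
have h0 : (0 <= Order.min (rpot s x) N%:R%:E)%E.
  by rewrite le_min p0 lee_fin ler0n.
have h1 : (Order.min (rpot s x) N%:R%:E <= N%:R%:E)%E by rewrite ge_min lexx orbT.
have h2 : (Order.min (rpot s x) N%:R%:E <= rpot s x)%E by rewrite ge_min lexx.
have hf := min_rpot_fin x N s0.
split; first exact: fine_ge0.
  by rewrite -lee_fin fineK.
by rewrite fineK.
Qed.

Lemma measurable_rtrunc s N : measurable_fun setT s -> (forall x, 0 <= s x) ->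
  measurable_fun setT (rtrunc s N).
Proof.
move=> ms s0; apply: measurable_fun_ifT.
- exact: measurable_box_norm.
- apply: (measurableT_comp (@fine_measurable R setT measurableT)).
  apply: measurable_mine; first exact: measurable_rpot.
  exact: measurable_cst.
- exact: measurable_cst.
Qed.

(** The truncation r is its own test function: r^4 <= r^3 * [rpot s], so the bilinear bound reads X
    <= hlsC + X / 2 with X the integral of r^4, and X is finite. *)
Lemma rtrunc_bound s N : measurable_fun setT s -> (forall x, 0 <= s x) ->
  (\int[lam2]_y (s y ^+ 4)%:E <= 1)%E ->
  (\int[lam2]_x (rtrunc s N x ^+ 4)%:E <= (2 * hlsC)%:E)%E.
Proof.
move=> ms s0 sS; set r := rtrunc s N.
have mr : measurable_fun setT r by exact: measurable_rtrunc.
have r0 x : 0 <= r x by have [] := rtrunc_le N x s0.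
have rN x : r x <= N%:R by have [] := rtrunc_le N x s0.
have fin : (\int[lam2]_x (r x ^+ 4)%:E < +oo)%E.
  apply: (@le_lt_trans _ _ (\int[lam2]_x (N%:R ^+ 4 *
     (if (`|x.1| <= N%:R) && (`|x.2| <= N%:R) then 1 else 0))%:E)%E).
    apply: le_ge0_integralT.
    - by mfun.
    - by mfun.
    - by move=> x; rewrite exprn_ge0.
    - move=> x; have := rN x; have := r0 x; rewrite /r /rtrunc.
      case: ifPn => _ h1 h2; last by rewrite expr0n/= mulr0.
      by rewrite mulr1 lerXn2r// nnegrE.
  rewrite ge0_integralZlT; [|by mfun|by move=> x; case: ifP|by rewrite exprn_ge0].
  by rewrite integral_box_norm// -EFinM ltry.
have nn : (0 <= \int[lam2]_x (r x ^+ 4)%:E)%E.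
  by apply: integral_ge0 => x _; rewrite lee_fin exprn_ge0.
have rE : (\int[lam2]_x (r x ^+ 4)%:E)%E =
    (fine (\int[lam2]_x (r x ^+ 4)%:E)%E)%:E.
  by rewrite fineK// ge0_fin_numE.
have := @hls_bilinear R s r _ ms s0 mr r0 sS rE.
set X := fine _ in rE * => h.
suff : (X%:E <= (hlsC + X / 2)%:E)%E by rewrite rE !lee_fin; lra.
apply: le_trans h; rewrite -rE.
have mk := @measurable_kap R.
apply: ge0_le_integral => //.
- by move=> x _; rewrite lee_fin exprn_ge0.
- by mfun.
- apply: (@measurable_tonelliF _ _ _ _ _ _ (fun x y => r x ^+ 3 * (s y ^+ 3 * ksub x y))).
    by mfun.
  by move=> x y; rewrite !mulr_ge0 ?exprn_ge0 ?kap_ge0.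
- move=> x _ /=; rewrite ge0_integralZlT//; last 3 first.
  + by mfun.
  + by move=> y; rewrite mulr_ge0 ?exprn_ge0 ?kap_ge0.
  + by rewrite exprn_ge0.
  rewrite exprSr EFinM lee_wpmul2l ?lee_fin ?exprn_ge0//.
  by have [] := rtrunc_le N x s0.
Qed.

(* [v] need not be measured against [rpot s] itself, which may be infinite on
   a null set. *)
Lemma hls s (v : R * R -> R) : measurable_fun setT s -> (forall x, 0 <= s x) ->
  (\int[lam2]_y (s y ^+ 4)%:E <= 1)%E ->
  measurable_fun setT v -> (forall x, (`|v x|%:E <= rpot s x)%E) ->
  (\int[lam2]_x (v x ^+ 4)%:E <= (2 * hlsC)%:E)%E.
Proof.
move=> ms s0 sS mv vs.
pose g N x := ((rtrunc s N x) ^+ 4)%:E.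
have mg N : measurable_fun setT (g N).
  by have h := measurable_rtrunc N ms s0; rewrite /g; mfun.
have g0 N x : (0 <= g N x)%E.
  by rewrite lee_fin exprn_ge0//; have [] := rtrunc_le N x s0.
have ndg x : {homo g ^~ x : n m / (n <= m)%N >-> (n <= m)%E}.
  move=> n m nm; rewrite lee_fin.
  have [h1 h2 h3] := rtrunc_le n x s0; have [k1 k2 k3] := rtrunc_le m x s0.
  apply: lerXn2r; rewrite ?nnegrE//; move: h1 h2 h3 k1 k2 k3; rewrite /rtrunc.
  have nmR : n%:R <= m%:R :> R by rewrite ler_nat.
  case: ifPn => // /andP[xn yn]; rewrite (le_trans xn nmR) (le_trans yn nmR)/=.
  move=> _ _ _ _ _ _; apply: fine_le.
  - exact: min_rpot_fin.
  - exact: min_rpot_fin.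
  - by rewrite le_min ge_min lexx/= ge_min lee_fin nmR orbT.
have cg x : g ^~ x @ \oo --> limn (g ^~ x).
  by apply: ereal_nondecreasing_is_cvgn => n m; exact: ndg.
have gl x : ((v x ^+ 4)%:E <= limn (g ^~ x))%E.
  apply: lime_ge; first exact: cg.
  (* Once N exceeds |v x| and both |x.1| and |x.2|, neither cut of [rtrunc] goes below |v x|. *)
  near=> N; rewrite lee_fin.
  have [r0 _ _] := rtrunc_le N x s0.
  rewrite -[leLHS]ger0_norm ?exprn_even_ge0// normrX.
  apply: lerXn2r; rewrite ?nnegrE//.
  rewrite /rtrunc ifT; last first.
    apply/andP; split; near: N.
      exact: nbhs_infty_ger.
    exact: nbhs_infty_ger.
  rewrite -lee_fin fineK; last exact: min_rpot_fin.
  rewrite le_min vs/= lee_fin.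
  by near: N; exact: nbhs_infty_ger.
apply: (@le_trans _ _ (\int[lam2]_x limn (g ^~ x))%E).
  apply: ge0_le_integral => //.
  - by move=> x _; rewrite lee_fin exprn_even_ge0.
  - by mfun.
  - by apply: (emeasurable_fun_cvg g) => // x _; exact: cg.
rewrite monotone_convergence//.
apply: lime_le.
  apply: ereal_nondecreasing_is_cvgn => n m nm; apply: ge0_le_integral => //.
  by move=> x _; exact: ndg.
by apply: nearW => N; exact: rtrunc_bound.
Unshelve. all: by end_near. Qed.

Lemma rpot_scale s (k : R) x : measurable_fun setT s -> (forall x, 0 <= s x) ->
  0 <= k -> rpot (fun y => k * s y) x = ((k ^+ 3)%:E * rpot s x)%E.
Proof.
move=> ms s0 k0; have mk := @measurable_kap R.
rewrite /rpot -ge0_integralZlT; last 3 first.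
- by mfun.
- by move=> y; rewrite mulr_ge0 ?exprn_ge0 ?kap_ge0.
- by rewrite exprn_ge0.
by apply: eq_integral => y _; rewrite exprMn mulrA.
Qed.

(** The scale that normalizes a fourth-power integral bounded by S; taking 1 + S keeps it invertible
    when S = 0. *)
Lemma fourth_root (S : R) : 0 <= S -> exists2 c : R, 0 < c & c ^+ 4 = 1 + S.
Proof.
move=> S0; have S1 : 0 < 1 + S by lra.
exists (Num.sqrt (Num.sqrt (1 + S))); first by rewrite !sqrtr_gt0.
by rewrite (exprM _ 2 2) !sqr_sqrtr// ?sqrtr_ge0// ltW.
Qed.

Lemma hls_normalize s (S c : R) : measurable_fun setT s -> (forall x, 0 <= s x) ->
  0 < c -> c ^+ 4 = 1 + S -> 0 <= S -> (\int[lam2]_y (s y ^+ 4)%:E <= S%:E)%E ->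
  (\int[lam2]_y ((c^-1 * s y) ^+ 4)%:E <= 1)%E.
Proof.
move=> ms s0 c0 cS S0 sS.
under eq_integral do rewrite exprMn exprVn cS.
rewrite ge0_integralZlT; [|by mfun|by move=> x; rewrite exprn_ge0|]; last first.
  by rewrite invr_ge0; lra.
apply: (@le_trans _ _ ((1 + S)^-1%:E * S%:E)%E).
  by apply: lee_wpmul2l => //; rewrite lee_fin invr_ge0; lra.
by rewrite -EFinM lee_fin mulrC ler_pdivrMr ?mul1r; lra.
Qed.

(** The potential is cubic in s, so its fourth power scales like c^12 = (1 + S)^3. *)
Lemma hls_scaled s (v : R * R -> R) (S : R) :
  measurable_fun setT s -> (forall x, 0 <= s x) ->
  0 <= S -> (\int[lam2]_y (s y ^+ 4)%:E <= S%:E)%E ->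
  measurable_fun setT v -> (forall x, (`|v x|%:E <= rpot s x)%E) ->
  (\int[lam2]_x (v x ^+ 4)%:E <= (2 * hlsC * (1 + S) ^+ 3)%:E)%E.
Proof.
move=> ms s0 S0 sS mv vs; have [c c0 cS] := fourth_root S0.
have ci0 : 0 <= c^-1 by rewrite invr_ge0 ltW.
have ms' : measurable_fun setT (fun y => c^-1 * s y) by mfun.
have mv' : measurable_fun setT (fun y => c^-1 ^+ 3 * v y) by mfun.
have h : (\int[lam2]_x ((c^-1 ^+ 3 * v x) ^+ 4)%:E <= (2 * hlsC)%:E)%E.
  apply: (@hls (fun y => c^-1 * s y) (fun y => c^-1 ^+ 3 * v y) ms').
  - by move=> x; rewrite mulr_ge0.
  - exact: hls_normalize S0 sS.
  - exact: mv'.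
  - move=> x; rewrite rpot_scale// normrM EFinM ger0_norm ?exprn_ge0//.
    by apply: lee_wpmul2l => //; rewrite lee_fin exprn_ge0.
have -> : (\int[lam2]_x (v x ^+ 4)%:E =
    ((1 + S) ^+ 3)%:E * \int[lam2]_x ((c^-1 ^+ 3 * v x) ^+ 4)%:E)%E.
  rewrite -ge0_integralZlT; last 3 first.
  - by mfun.
  - by move=> x; rewrite exprn_even_ge0.
  - by rewrite exprn_ge0; lra.
  apply: eq_integral => x _; congr EFin; rewrite -cS; field.
  by rewrite gt_eqF.
rewrite [X in (_ <= X%:E)%E]mulrC [leRHS]EFinM; apply: lee_wpmul2l => //.
by rewrite lee_fin exprn_ge0//; lra.
Qed.

(** The indicator of a box equals its own cube, so it may play the role of [r] in [hls_bilinear].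
    The outcome is the absolute convergence over box x plane that Fubini asks for in
    [pot_divfree]. *)
Lemma hls_box s (S N : R) : measurable_fun setT s -> (forall x, 0 <= s x) ->
  0 <= S -> (\int[lam2]_y (s y ^+ 4)%:E <= S%:E)%E -> 0 <= N ->
  (\int[lam2]_x \int[lam2]_y
    ((if (`|x.1| <= N) && (`|x.2| <= N) then 1 else 0) * (s y ^+ 3 * ksub x y))%:E
   < +oo)%E.
Proof.
move=> ms s0 S0 sS N0; have [c c0 cS] := fourth_root S0.
have ci0 : 0 <= c^-1 by rewrite invr_ge0 ltW.
have ms' : measurable_fun setT (fun y => c^-1 * s y) by mfun.
pose r (x : R * R) : R := if (`|x.1| <= N) && (`|x.2| <= N) then 1 else 0.
have mr : measurable_fun setT r by rewrite /r; mfun.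
have r0 x : 0 <= r x by rewrite /r; case: ifP.
have rN : (\int[lam2]_y (r y ^+ 4)%:E = (4 * N ^+ 2)%:E)%E.
  rewrite -integral_box_norm//; apply: eq_integral => y _.
  by rewrite /r; case: ifP; rewrite ?expr1n ?expr0n.
have s0' x : 0 <= c^-1 * s x by rewrite mulr_ge0.
have mk := @measurable_kap R.
have := @hls_bilinear R _ r _ ms' s0' mr r0 (hls_normalize ms s0 c0 cS S0 sS) rN.
move=> h.
have -> : (\int[lam2]_x \int[lam2]_y (r x * (s y ^+ 3 * ksub x y))%:E =
    \int[lam2]_x ((c ^+ 3)%:E * \int[lam2]_y (r x ^+ 3 * ((c^-1 * s y) ^+ 3 * ksub x y))%:E))%E.
  apply: eq_integral => x _; rewrite -ge0_integralZlT; last 3 first.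
  - by mfun.
  - by move=> y; rewrite !mulr_ge0 ?exprn_ge0 ?kap_ge0.
  - by rewrite exprn_ge0 ?ltW.
  apply: eq_integral => y _; congr EFin.
  have -> : r x ^+ 3 = r x by rewrite /r; case: ifP; rewrite ?expr1n ?expr0n.
  by field; rewrite gt_eqF.
rewrite ge0_integralZl//.
- apply: lte_mul_pinfty => //; rewrite ?lee_fin ?exprn_ge0 ?ltW//.
  by rewrite (le_lt_trans h)// ltry.
- apply: (@measurable_tonelliF _ _ _ _ _ _ (fun x y => r x ^+ 3 * ((c^-1 * s y) ^+ 3 * ksub x y))).
    by mfun.
  by move=> x y; rewrite !mulr_ge0 ?exprn_ge0 ?kap_ge0.
- by move=> x _; apply: integral_ge0 => y _; rewrite lee_fin !mulr_ge0 ?exprn_ge0 ?kap_ge0.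
- by rewrite lee_fin exprn_ge0 ?ltW.
Qed.

End hls_potential.

(** * Continuity of translations *)

Section small_sequences.
Local Open Scope ereal_scope.
Context {R : realType}.
Implicit Type u : (\bar R)^nat.

(** Convergence to 0 of nonnegative extended sequences, phrased through upper bounds only: it passes
    to smaller sequences and asks for no finiteness of the early terms. *)
Definition small u := forall e : R, (0 < e)%R -> \forall n \near \oo, u n <= e%:E.

Lemma cvg_small u : u @ \oo --> 0 -> small u.
Proof.
move=> /fine_cvgP[fu /cvgrPdist_le cu] e e0.
have := cu _ e0; apply: filterS2 fu => n fn; rewrite sub0r normrN => h.
by rewrite -(fineK fn) lee_fin (le_trans (ler_norm _)).
Qed.

Lemma small_cvg u : (forall n, 0 <= u n) -> small u -> u @ \oo --> 0.
Proof.
move=> u0 su; apply/fine_cvgP; split.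
  apply: filterS (su 1%R ltr01) => n h.
  by rewrite ge0_fin_numE// (le_lt_trans h)// ltry.
apply/cvgrPdist_le => e e0; apply: filterS (su _ e0) => n h.
rewrite sub0r normrN ger0_norm ?fine_ge0//.
by rewrite -lee_fin fineK// ge0_fin_numE// (le_lt_trans h)// ltry.
Qed.

Lemma le_small u v : (forall n, u n <= v n) -> small v -> small u.
Proof.
by move=> uv sv e e0; apply: filterS (sv e e0) => n; exact: le_trans.
Qed.

Lemma smallD u v : small u -> small v -> small (fun n => u n + v n).
Proof.
move=> su sv e e0; have e2 : (0 < e / 2)%R by rewrite divr_gt0.
apply: filterS2 (su _ e2) (sv _ e2) => n h1 h2.
by rewrite [e]splitr EFinD leeD.
Qed.

Lemma smallZ u (k : R) : (0 <= k)%R -> small u -> small (fun n => k%:E * u n).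
Proof.
move=> k0 su e e0; have k1 : (0 < k + 1)%R by rewrite ltr_wpDl.
apply: filterS (su _ (divr_gt0 e0 k1)) => n h.
apply: (@le_trans _ _ (k%:E * (e / (k + 1))%:E)).
  by apply: lee_wpmul2l => //; rewrite lee_fin.
rewrite -EFinM lee_fin mulrA ler_pdivrMr// mulrC ler_wpM2l// ?ltW//.
by rewrite ltrDl.
Qed.

Lemma small_approx u : (forall e : R, (0 < e)%R ->
  exists2 v, small v & \forall n \near \oo, u n <= v n + e%:E) -> small u.
Proof.
move=> h e e0; have e2 : (0 < e / 2)%R by rewrite divr_gt0.
have [v sv uv] := h _ e2; apply: filterS2 uv (sv _ e2) => n uvn h1.
by rewrite (le_trans uvn)// [in leRHS](splitr e) EFinD leeD2r.
Qed.

End small_sequences.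

Section translation1.
Context {R : realType}.
Implicit Types f g : R -> R.

Lemma small_dominated d (T : measurableType d) (m : {measure set T -> \bar R})
    (F : nat -> T -> R) (G : T -> R) :
  (forall n, measurable_fun setT (F n)) -> (forall n x, 0 <= F n x <= G x) ->
  measurable_fun setT G -> (\int[m]_x (G x)%:E < +oo)%E ->
  (forall x, F ^~ x @ \oo --> 0) ->
  small (fun n => \int[m]_x (F n x)%:E)%E.
Proof.
move=> mF FG mG iG cF.
have mFE n : measurable_fun setT (fun x => (F n x)%:E).
  by have := mF n => h; mfun.
have iGE : m.-integrable setT (fun x => (G x)%:E).
  apply/integrableP; split; first by mfun.
  rewrite (_ : (fun x => _) = (fun x => (G x)%:E))//.
  apply/funext => x /=; rewrite ger0_norm//.
  by have /andP[h1 h2] := FG 0%N x; exact: le_trans h2.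
have cFE : {ae m, forall x, setT x -> (F n x)%:E @[n --> \oo] --> 0%E}.
  by apply: aeW => x _; apply: cvg_EFin; [exact: nearW|exact: cF].
have FGE : {ae m, forall x n, setT x -> (`|(F n x)%:E| <= (G x)%:E)%E}.
  apply: aeW => x n _; rewrite lee_fin /=.
  by have /andP[h1 h2] := FG n x; rewrite ger0_norm.
have [_ _] := dominated_convergence measurableT mFE (measurable_cst 0%E) cFE iGE FGE.
by rewrite integral0 => /cvg_small.
Qed.

Lemma expr_max_le (a b : R) n : 0 <= a -> 0 <= b ->
  Num.max a b ^+ n <= a ^+ n + b ^+ n.
Proof.
by move=> a0 b0; rewrite maxEle; case: ifP => _; rewrite (lerDl, lerDr) exprn_ge0.
Qed.

Lemma indic_int_lty (c : R) :
  (\int[lam1]_s ((if `|s| <= c then 1 else 0) : R)%:E < +oo)%E.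
Proof.
rewrite (_ : (fun s => _) = (fun s => ((\1_(`[- c, c]%classic) s) : R)%:E)); last first.
  apply/funext => s; rewrite indicE mem_setE in_itv/= -ler_norml.
  by case: (_ <= _).
rewrite integral_indic// setIT /= lam1_itv/=.
by case: ifP => // _; rewrite -EFinD ltry.
Qed.

(** A continuous g approximates f in L^1 on a neighbourhood of the support; the translations of g
    are handled by dominated convergence, and the error f - g is counted twice, at s and at the
    shifted point. *)
Lemma translation_small_bounded f (M : R) : measurable_fun setT f -> 0 <= M ->
  (forall s, `|f s| <= M) -> (forall s, M < `|s| -> f s = 0) ->
  forall z : R^nat, z @ \oo --> 0 ->
  small (fun n => \int[lam1]_s `|f (s + z n) - f s|%:E)%E.
Proof.
move=> mf M0 fM f0 z z0.
(* The margin 2 allows for shifts of size at most 1: if |s| <= M + 1 both s and its translate lie in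
   [E], otherwise f vanishes at both. *)
pose E : set R := `[- (M + 2), M + 2]%classic.
have mE : measurable E by exact: measurable_itv.
have Efin : (@lebesgue_measure R E < +oo)%E.
  by rewrite lebesgue_measure_itv/=; case: ifP => // _; rewrite -EFinD ltry.
have intf : (@lebesgue_measure R).-integrable E (EFin \o f).
  apply: measurable_bounded_integrable => //.
    exact: measurable_funTS.
  exists M; split; first exact: num_real.
  by move=> x Mx s _ /=; rewrite (le_trans (fM s))// ltW.
have [g_ [cg ig hg]] := approximation_continuous_integrable mE Efin intf.
apply: small_approx => e e0.
have e4 : 0 < e / 4 by rewrite divr_gt0.
have [N _ hN] := cvg_small hg e4.
pose g := g_ N; have {}cg : continuous g by exact: cg.
have mg : measurable_fun setT g by exact: continuous_measurable_fun.
pose h s := (if `|s| <= M + 2 then 1 else 0) * `|f s - g s|.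
have mh : measurable_fun setT h by rewrite /h; mfun.
have h0 s : 0 <= h s by rewrite mulr_ge0//; case: ifP.
have hE : (\int[lam1]_s (h s)%:E <= (e / 4)%:E)%E.
  rewrite integral_lam1//; last by mfun.
  apply: le_trans (hN N (leqnn N)).
  rewrite [leRHS]integral_mkcond le_eqVlt; apply/orP; left; apply/eqP.
  apply: eq_integral => s _; rewrite patchE mem_setE in_itv/= -ler_norml /h.
  by case: ifP; rewrite ?mul1r ?mul0r.
(* The guard on |z n| makes the dominating function valid for every n; it is eventually true. *)
pose K n s := (if `|s| <= M + 1 then 1 else 0) *
  (if `|z n| <= 1 then `|g (s + z n) - g s| else 0).
have mK n : measurable_fun setT (K n) by rewrite /K; mfun.
have K0 n s : 0 <= K n s by rewrite mulr_ge0//; case: ifP.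
have [B B0 gB] : exists2 B : R, 0 <= B & forall s, `|s| <= M + 2 -> `|g s| <= B.
  have /compact_bounded[B [_ Br]] : compact (g @` E).
    apply: continuous_compact; last exact: segment_compact.
    exact: continuous_subspaceT.
  exists (`|B| + 1) => // s sM; apply: Br.
    by rewrite ltr_pwDr// ler_norm.
  by exists s => //; rewrite /E /= in_itv/= -ler_norml.
have b0 := indic_int_lty (M + 1).
exists (fun n => \int[lam1]_s (K n s)%:E)%E.
  apply: (@small_dominated _ _ lam1 K (fun s : R => (2 * B) * (if `|s| <= M + 1 then 1 else 0) : R)).
  - by [].
  - move=> n s; rewrite K0/= /K mulrC.
    case: (leP `|s| (M + 1)) => sM; last by rewrite !mulr0.
    rewrite !mulr1; case: ifPn => zn; last by rewrite mulr_ge0.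
    rewrite mulrDl mul1r (le_trans (ler_normB _ _))// lerD// gB//; last by lra.
    by rewrite (le_trans (ler_normD _ _))//; lra.
  - by mfun.
  - rewrite ge0_integralZlT; [|by mfun|by move=> s; case: ifP|by rewrite mulr_ge0].
    by apply: lte_mul_pinfty => //; rewrite lee_fin mulr_ge0.
  - move=> s; rewrite -(mulr0 (if `|s| <= M + 1 then 1 else 0 : R)).
    apply: cvgM; first exact: cvg_cst.
    apply/cvgrPdist_le => d d0.
    have szs : s + z n @[n --> \oo] --> s.
      by rewrite -[X in _ --> X]addr0; apply: cvgD => //; exact: cvg_cst.
    have := cvg_comp _ _ szs (cg s) => /cvgrPdist_le/(_ _ d0).
    apply: filterS => n hn; rewrite sub0r normrN.
    by case: ifP => _; rewrite ?normr0 ?(ltW d0)// normr_id distrC.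
have z1 : \forall n \near \oo, `|z n| <= 1.
  by move/cvgr0Pnorm_le : z0; apply.
apply: filterS z1 => n zn.
apply: (@le_trans _ _ (\int[lam1]_s (K n s + (h (s + z n) + h s))%:E)%E).
  apply: le_ge0_integralT.
  - by mfun.
  - by have := mK n => mKn; mfun.
  - by [].
  - move=> s; have := K0 n s; have := h0 s; have := h0 (s + z n).
    rewrite /K /h zn; have [sM|sM] := leP `|s| (M + 1).
      have sz : `|s + z n| <= M + 2 by rewrite (le_trans (ler_normD _ _))//; lra.
      rewrite sz (_ : `|s| <= M + 2); last by lra.
      rewrite !mul1r => _ _ _.
      rewrite (_ : f (s + z n) - f s = (g (s + z n) - g s) +
        ((f (s + z n) - g (s + z n)) - (f s - g s))); last by ring.
      by rewrite (le_trans (ler_normD _ _))// lerD2l (le_trans (ler_normB _ _)).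
    rewrite !mul0r add0r => h1 h2 _.
    have sz : M < `|s + z n|.
      by have := ler_normB (s + z n) (z n); rewrite addrK; lra.
    have -> : f (s + z n) - f s = 0 by rewrite !f0 ?subrr//; lra.
    by rewrite normr0 addr_ge0.
have mKn := mK n.
rewrite ge0_integralDT//; last 2 first.
- by mfun.
- by move=> s; rewrite addr_ge0.
rewrite ge0_integralDT//; last by mfun.
have mhE : measurable_fun setT (fun s : R => (h s)%:E) by mfun.
rewrite (@ge0_integral_shift _ (z n) (fun s => (h s)%:E) mhE)//.
rewrite leeD2l// (le_trans (leeD hE hE))// -EFinD lee_fin; lra.
Qed.

(** Truncation in height and in space approximates f in L^(p+1). For a function bounded by N one has
    |x|^(p+1) <= (2 N)^p |x| on differences x, which reduces its translations to the L^1 case. *)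
Lemma translation_small f (p : nat) : measurable_fun setT f ->
  (\int[lam1]_s (`|f s| ^+ p.+1)%:E < +oo)%E ->
  forall z : R^nat, z @ \oo --> 0 ->
  small (fun n => \int[lam1]_s (`|f (s + z n) - f s| ^+ p.+1)%:E)%E.
Proof.
move=> mf fp z z0.
pose t (N : nat) s := if (`|f s| <= N%:R) && (`|s| <= N%:R) then f s else 0.
have mt N : measurable_fun setT (t N) by rewrite /t; mfun.
have st : small (fun N => \int[lam1]_s (`|f s - t N s| ^+ p.+1)%:E)%E.
  apply: (small_dominated (G := fun s => `|f s| ^+ p.+1)) => //.
  - by move=> n; have := mt n => h; mfun.
  - move=> n s; rewrite exprn_ge0//= lerXn2r ?nnegrE// /t.
    by case: ifP; rewrite ?subrr ?normr0 ?subr0.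
  - by mfun.
  - move=> s; apply: cvg_near_cst; near=> n.
    rewrite /t ifT ?subrr ?normr0 ?expr0n//.
    by apply/andP; split; near: n; exact: nbhs_infty_ger.
apply: small_approx => e e0.
(* The difference is split as x + (y - w), of size at most 3 max(|x|, |y|, |w|), and the power of a
   maximum is at most the sum of the powers. *)
pose c : R := 3 ^+ p.+1.
have c0 : 0 < c by rewrite exprn_gt0.
have e4 : 0 < e / (c * 2) by rewrite divr_gt0// mulr_gt0.
have [N _ /(_ N (leqnn N))/= hN] := st _ e4.
pose g := t N.
have mg := mt N.
have gN s : `|g s| <= N%:R by rewrite /g /t; case: ifP => [/andP[]//|]; rewrite normr0.
have g0 s : N%:R < `|s| -> g s = 0.
  by rewrite /g /t => sN; rewrite [X in _ && X]leNgt sN andbF.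
exists (fun n => (c * (2 * N%:R) ^+ p)%:E * \int[lam1]_s `|g (s + z n) - g s|%:E)%E.
  apply: smallZ; first by rewrite mulr_ge0 ?exprn_ge0 ?mulr_ge0// ltW.
  exact: (@translation_small_bounded g N%:R).
apply: nearW => n.
pose k s := c * `|f s - g s| ^+ p.+1.
have mk : measurable_fun setT k by rewrite /k; mfun.
have k0 s : 0 <= k s by rewrite mulr_ge0 ?exprn_ge0// ltW.
have mgz : measurable_fun setT (fun s : R => `|g (s + z n) - g s|) by mfun.
apply: (@le_trans _ _ (\int[lam1]_s ((c * (2 * N%:R) ^+ p) * `|g (s + z n) - g s| + (k (s + z n) + k s))%:E)%E).
  apply: le_ge0_integralT.
  - by mfun.
  - by mfun.
  - by move=> s; rewrite exprn_ge0.
  - move=> s; rewrite (_ : f (s + z n) - f s = (g (s + z n) - g s) +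
      ((f (s + z n) - g (s + z n)) - (f s - g s))); last by ring.
    rewrite /k -mulrA -!mulrDr.
    have : `|g (s + z n) - g s| <= 2 * N%:R.
      by rewrite (le_trans (ler_normB _ _))// mulrDl mul1r lerD.
    move: (g (s + z n) - g s) (f (s + z n) - g (s + z n)) (f s - g s) => x y w xN.
    have xp : `|x| ^+ p.+1 <= (2 * N%:R) ^+ p * `|x|.
      by rewrite exprSr ler_wpM2r// lerXn2r ?nnegrE// mulr_ge0.
    apply: (@le_trans _ _ (c * (`|x| ^+ p.+1 + (`|y| ^+ p.+1 + `|w| ^+ p.+1)))); last first.
      by rewrite ler_wpM2l ?lerD2r// ltW.
    pose mx := Num.max `|x| (Num.max `|y| `|w|).
    have mx0 : 0 <= mx by rewrite le_max normr_ge0.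
    apply: (@le_trans _ _ ((3 * mx) ^+ p.+1)).
      rewrite lerXn2r ?nnegrE ?mulr_ge0//.
      have h1 : `|x| <= mx by rewrite le_max lexx.
      have h2 : `|y| <= mx by rewrite !le_max lexx orbT.
      have h3 : `|w| <= mx by rewrite !le_max lexx !orbT.
      have := ler_normD x (y - w); have := ler_normB y w; lra.
    rewrite exprMn ler_wpM2l ?(ltW c0)// /mx.
    have hx : 0 <= `|x| ^+ p.+1 by rewrite exprn_ge0.
    have hy : 0 <= `|y| ^+ p.+1 by rewrite exprn_ge0.
    have hw : 0 <= `|w| ^+ p.+1 by rewrite exprn_ge0.
    rewrite (le_trans (expr_max_le _ _ _))// ?le_max ?normr_ge0// lerD2l.
    exact: expr_max_le.
rewrite ge0_integralDT; [|by mfun|by mfun| |by move=> s; rewrite addr_ge0]; last first.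
  by move=> s; rewrite !mulr_ge0 ?exprn_ge0 ?mulr_ge0// ltW.
rewrite ge0_integralZlT; [|by []|by []|]; last first.
  by rewrite mulr_ge0 ?exprn_ge0 ?mulr_ge0// ltW.
rewrite leeD2l// ge0_integralDT//; last by mfun.
have mkE : measurable_fun setT (fun s : R => (k s)%:E) by mfun.
rewrite (@ge0_integral_shift _ (z n) (fun s => (k s)%:E) mkE)//.
have kE : (\int[lam1]_s (k s)%:E <= (e / 2)%:E)%E.
  rewrite ge0_integralZlT; [|by mfun|by move=> s; rewrite exprn_ge0|exact: ltW].
  apply: (@le_trans _ _ (c%:E * (e / (c * 2))%:E)%E).
    by apply: lee_wpmul2l => //; rewrite lee_fin ltW.
  rewrite -EFinM lee_fin le_eqVlt; apply/orP; left; apply/eqP; field.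
  by rewrite gt_eqF.
by rewrite (le_trans (leeD kE kE))// -EFinD lee_fin -splitr.
Unshelve. all: by end_near. Qed.

(** Dominated convergence in the parameter: almost every slice lies in L^(p+1), so its inner
    integral tends to 0, and that integral is bounded by a multiple of the slice norm. Planar
    translations are later composed of two such one-variable shifts. *)
Lemma translation_small_slice d (X : measurableType d)
    (m : {sigma_finite_measure set X -> \bar R}) (f : X -> R -> R) (p : nat) :
  measurable_fun setT (fun z => f z.1 z.2) ->
  (\int[m]_x \int[lam1]_s (`|f x s| ^+ p.+1)%:E < +oo)%E ->
  forall z : R^nat, z @ \oo --> 0 ->
  small (fun n => \int[m]_x \int[lam1]_s (`|f x (s + z n) - f x s| ^+ p.+1)%:E)%E.
Proof.
move=> mf fp z z0; pose c : R := 2 ^+ p.+1.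
have c0 : 0 < c by rewrite exprn_gt0.
have mfx x : measurable_fun setT (f x).
  by apply: (measurableT_comp mf (g := fun s => (x, s))); mfun.
pose F n x := (\int[lam1]_s (`|f x (s + z n) - f x s| ^+ p.+1)%:E)%E.
pose G0 x := (\int[lam1]_s (`|f x s| ^+ p.+1)%:E)%E.
pose G x := (c%:E * (G0 x + G0 x))%E.
have mF n : measurable_fun setT (F n).
  apply: (@measurable_tonelliF _ _ _ _ _ lam1 (fun x s => `|f x (s + z n) - f x s| ^+ p.+1)).
    apply: measurable_funX; apply: (measurableT_comp (@normr_measurable _ setT)).
    apply: measurable_funB => //.
    by apply: (measurableT_comp mf (g := fun y : X * R => (y.1, y.2 + z n))); mfun.
  by move=> x s; rewrite exprn_ge0.
have G00 x : (0 <= G0 x)%E by apply: integral_ge0 => s _; rewrite lee_fin exprn_ge0.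
have mG0 : measurable_fun setT G0.
  apply: (@measurable_tonelliF _ _ _ _ _ lam1 (fun x s => `|f x s| ^+ p.+1)).
    by mfun.
  by move=> x s; rewrite exprn_ge0.
have mG00 : measurable_fun setT (fun x => G0 x + G0 x)%E by exact: emeasurable_funD.
have mG : measurable_fun setT G.
  by apply: measurable_funeM.
have FG n x : (0 <= F n x <= G x)%E.
  apply/andP; split.
    by apply: integral_ge0 => s _; rewrite lee_fin exprn_ge0.
  have mx := mfx x.
  apply: (@le_trans _ _ (\int[lam1]_s (c * (`|f x (s + z n)| ^+ p.+1 + `|f x s| ^+ p.+1))%:E)%E).
    apply: le_ge0_integralT.
    - by mfun.
    - by mfun.
    - by move=> s; rewrite exprn_ge0.
    - move=> s; move: (f x (s + z n)) (f x s) => u v.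
      pose w := Num.max `|u| `|v|.
      have w0 : 0 <= w by rewrite le_max normr_ge0.
      apply: (@le_trans _ _ ((2 * w) ^+ p.+1)).
        rewrite lerXn2r ?nnegrE ?mulr_ge0//.
        have h1 : `|u| <= w by rewrite le_max lexx.
        have h2 : `|v| <= w by rewrite le_max lexx orbT.
        by have := ler_normB u v; lra.
      rewrite exprMn ler_wpM2l ?(ltW c0)// /w.
      have hu : 0 <= `|u| ^+ p.+1 by rewrite exprn_ge0.
      have hv : 0 <= `|v| ^+ p.+1 by rewrite exprn_ge0.
      exact: expr_max_le.
  rewrite ge0_integralZlT; [|by mfun|by move=> s; rewrite addr_ge0 ?exprn_ge0|exact: ltW].
  rewrite ge0_integralDT; [|by mfun|by mfun|by move=> s; rewrite exprn_ge0|by move=> s; rewrite exprn_ge0].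
  have nx (s : R) : (0 <= (`|f x s| ^+ p.+1)%:E)%E by rewrite lee_fin exprn_ge0.
  have mxE : measurable_fun setT (fun s : R => (`|f x s| ^+ p.+1)%:E) by mfun.
  rewrite (@ge0_integral_shift _ (z n) (fun s => (`|f x s| ^+ p.+1)%:E) mxE nx)//.
have iG0 : m.-integrable setT G0.
  apply/integrableP; split => //.
  by under eq_integral do rewrite gee0_abs//.
have iG : m.-integrable setT G by apply: integrableZl => //; exact: integrableD.
have cF : {ae m, forall x, setT x -> F ^~ x @ \oo --> 0%E}.
  have := integrable_ae measurableT iG0.
  apply: filterS => x /(_ I) fx _.
  apply: small_cvg; first by move=> n; have /andP[] := FG n x.
  apply: translation_small => //.
  by move: fx; rewrite ge0_fin_numE.
have FGE : {ae m, forall x n, setT x -> (`|F n x| <= G x)%E}.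
  by apply: aeW => x n _; have /andP[h1 h2] := FG n x; rewrite gee0_abs.
have [_ _] := dominated_convergence measurableT mF (measurable_cst 0%E) cF iG FGE.
by rewrite integral0 => /cvg_small.
Qed.

End translation1.

(** * Test functions and mollifiers *)

Section C1D.
Context {R : realType}.
Implicit Types f g h : R -> R.

Fixpoint C1D (k : nat) f : Prop :=
  if k is k'.+1 then [/\ continuous f, forall x, derivable f x 1 & C1D k' (derive1 f)]
  else continuous f.

Lemma C1DW k f : C1D k.+1 f -> C1D k f.
Proof.
elim: k f => [f []//|k ih f [cf df df']]; split => //; exact: ih.
Qed.

Lemma derive1_shift f (a : R) : (forall x, derivable f x 1) ->
  derive1 (fun s => f (s - a)) = (fun s => (derive1 f) (s - a)).
Proof.
move=> df; apply/funext => s; rewrite !derive1E.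
have h : is_derive s 1 (fun s : R => s - a) 1 by apply: is_derive_eq; rewrite subr0.
have h1 : is_derive (s - a) 1 f ('D_1 f (s - a)) by apply: DeriveDef.
have := @is_derive1_comp _ f (fun s : R => s - a) s _ _ h1 h.
by rewrite mulr1 => -[].
Qed.

Lemma C1D_shift k f (a : R) : C1D k f -> C1D k (fun s => f (s - a)).
Proof.
elim: k f => [|k ih] f.
  move=> cf x; apply: (@continuous_comp _ _ _ (fun s : R => s - a) f); last exact: cf.
  by apply: cvgB; [exact: cvg_id|exact: cvg_cst].
move=> [cf df df']; split.
- move=> x; apply: (@continuous_comp _ _ _ (fun s : R => s - a) f); last exact: cf.
  by apply: cvgB; [exact: cvg_id|exact: cvg_cst].
- move=> s.
  have h : is_derive s 1 (fun s : R => s - a) 1 by apply: is_derive_eq; rewrite subr0.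
  have h1 : is_derive (s - a) 1 f ('D_1 f (s - a)) by apply: DeriveDef.
  by have := @is_derive1_comp _ f (fun s : R => s - a) s _ _ h1 h => -[].
- by rewrite derive1_shift//; exact: ih.
Qed.

Definition tensor3 (f g h : R -> R) (p : RxR2 R) : R := f p.1 * (g p.2.1 * h p.2.2).

Lemma tensor3_continuous f g h : continuous f -> continuous g -> continuous h ->
  continuous (tensor3 f g h).
Proof.
move=> cf cg ch p; apply: cvgM.
  apply: (@continuous_comp _ _ _ fst f); [exact: cvg_fst|exact: cf].
apply: cvgM.
  apply: (@continuous_comp _ _ _ (fun p : RxR2 R => p.2.1) g); last exact: cg.
  apply: (@continuous_comp _ _ _ snd fst); [exact: cvg_snd|exact: cvg_fst].
apply: (@continuous_comp _ _ _ (fun p : RxR2 R => p.2.2) h); last exact: ch.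
apply: (@continuous_comp _ _ _ snd snd); [exact: cvg_snd|exact: cvg_snd].
Qed.

(** On the line through a in direction v the function is f up to a constant factor, so the
    difference quotients agree exactly and no multivariate calculus is needed. *)
Lemma is_derive_line (F : RxR2 R -> R) (v a : RxR2 R) f (s c : R) :
  derivable f s 1 ->
  (forall u : R, F (u *: v + a) = f (u + s) * c) ->
  derivable F a v /\ 'D_v F a = (derive1 f) s * c.
Proof.
move=> df Fv.
have E : (fun u : R => u^-1 *: ((F \o shift a) (u *: v) - F a)) =
   (fun u : R => u^-1 *: ((f \o shift s) (u *: 1) - f s) * c).
  apply/funext => u /=; rewrite Fv -[a in F a]add0r -(scale0r v) Fv add0r.
  by rewrite /GRing.scale/= mulr1 -mulrBl mulrA.
have cv : u^-1 *: ((F \o shift a) (u *: v) - F a) @[u --> (0:R)^'] --> (derive1 f) s * c.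
  rewrite E; apply: cvgM; last exact: cvg_cst.
  by rewrite derive1E; exact: df.
by split; [apply/cvg_ex; exists ((derive1 f) s * c)|apply: cvg_lim].
Qed.

Lemma tensor3_et f g h : (forall x, derivable f x 1) ->
  (forall p, derivable (tensor3 f g h) p (et R)) /\
  pdiff (et R) (tensor3 f g h) = tensor3 (derive1 f) g h.
Proof.
move=> df.
have H p := @is_derive_line (tensor3 f g h) (et R) p f p.1 (g p.2.1 * h p.2.2) (df _).
have E p (u : R) : tensor3 f g h (u *: et R + p) = f (u + p.1) * (g p.2.1 * h p.2.2).
  by rewrite /tensor3/= /GRing.scale/= mulr1 !mulr0 !add0r.
by split => [p|]; [case: (H p (E p))|apply/funext => p; case: (H p (E p))].
Qed.

Lemma tensor3_ex1 f g h : (forall x, derivable g x 1) ->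
  (forall p, derivable (tensor3 f g h) p (ex1 R)) /\
  pdiff (ex1 R) (tensor3 f g h) = tensor3 f (derive1 g) h.
Proof.
move=> df.
have H p := @is_derive_line (tensor3 f g h) (ex1 R) p g p.2.1 (f p.1 * h p.2.2) (df _).
have E p (u : R) : tensor3 f g h (u *: ex1 R + p) = g (u + p.2.1) * (f p.1 * h p.2.2).
  by rewrite /tensor3/= /GRing.scale/= mulr1 !mulr0 !add0r mulrCA.
split => [p|]; first by case: (H p (E p)).
by apply/funext => p; case: (H p (E p)) => _; rewrite /pdiff => ->; rewrite mulrCA.
Qed.

Lemma tensor3_ex2 f g h : (forall x, derivable h x 1) ->
  (forall p, derivable (tensor3 f g h) p (ex2 R)) /\
  pdiff (ex2 R) (tensor3 f g h) = tensor3 f g (derive1 h).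
Proof.
move=> df.
have H p := @is_derive_line (tensor3 f g h) (ex2 R) p h p.2.2 (f p.1 * g p.2.1) (df _).
have E p (u : R) : tensor3 f g h (u *: ex2 R + p) = h (u + p.2.2) * (f p.1 * g p.2.1).
  by rewrite /tensor3/= /GRing.scale/= mulr1 !mulr0 !add0r mulrA mulrC.
split => [p|]; first by case: (H p (E p)).
apply/funext => p; case: (H p (E p)) => _; rewrite /pdiff => ->.
by rewrite /tensor3 mulrA mulrC.
Qed.

(** A partial derivative of a tensor product is again a tensor product, with one factor
    differentiated, so the induction closes. *)
Lemma tensor3_isCk k f g h : C1D k f -> C1D k g -> C1D k h ->
  isCk (dirs3 R) k (tensor3 f g h).
Proof.
elim: k f g h => [|k ih] f g h; first exact: tensor3_continuous.
move=> cf cg ch; have := C1DW cf; have := C1DW cg; have := C1DW ch.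
case: cf => kf df df'; case: cg => kg dg dg'; case: ch => kh dh dh' wh wg wf.
split; first exact: tensor3_continuous.
move=> v; rewrite !inE => /or3P[] /eqP ->.
- by have [d1 ->] := tensor3_et g h df; split => //; exact: ih.
- by have [d1 ->] := tensor3_ex1 f h dg; split => //; exact: ih.
- by have [d1 ->] := tensor3_ex2 f g dh; split => //; exact: ih.
Qed.

End C1D.

Section mollifier.
Context {R : realType}.

Definition ramp (x : R) : R := Num.max 0 x.

Lemma ramp_ge0 x : 0 <= ramp x. Proof. by rewrite le_max lexx. Qed.

Lemma ramp_pos x : 0 <= x -> ramp x = x.
Proof. by move=> x0; apply/max_idPr. Qed.

Lemma ramp_neg x : x <= 0 -> ramp x = 0.
Proof. by move=> x0; apply/max_idPl. Qed.

Lemma ramp_continuous : continuous ramp.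
Proof.
move=> x; apply: continuous_max; first exact: cvg_cst.
exact: cvg_id.
Qed.

(** At the kink the difference quotient is O(|h|^(k+1)); this is where an exponent of at least 2 is
    used. *)
Lemma is_derive_rampX (k : nat) (x : R) :
  is_derive x 1 (fun x : R => ramp x ^+ k.+2) (k.+2%:R * ramp x ^+ k.+1).
Proof.
have [x0|x0|->] := ltgtP x 0.
- rewrite ramp_neg ?ltW// expr0n mulr0.
  have d0 : is_derive x 1 (fun _ : R => 0 : R) 0 by exact: is_derive_cst.
  apply: near_eq_is_derive d0; near=> y; rewrite ramp_neg ?expr0n// ltW//; near: y; exact: lt_nbhsl.
- rewrite ramp_pos ?ltW//.
  have d0 : is_derive x 1 (fun y : R => y ^+ k.+2) (k.+2%:R * x ^+ k.+1).
    have := @is_deriveX _ _ (fun y : R => y) k.+2 x 1 1 (is_derive_id _ _).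
    by rewrite exprfctE /GRing.scale/= mulr1.
  apply: near_eq_is_derive d0; near=> y.
  rewrite ramp_pos// ltW//; near: y; exact: lt_nbhsr.
- rewrite ramp_neg// expr0n mulr0.
  have cv : h^-1 *: (((fun x : R => ramp x ^+ k.+2) \o shift 0) (h *: 1) - ramp 0 ^+ k.+2)
      @[h --> (0:R)^'] --> (0:R).
    apply/cvgr0Pnorm_le => e e0.
    near=> h.
    have h0 : h != 0 by near: h; exact: nbhs_dnbhs_neq.
    have he : `|h| <= e by near: h; exact: dnbhs0_le.
    have h1 : `|h| <= 1 by near: h; exact: dnbhs0_le.
    rewrite /= /GRing.scale/= mulr1 addr0 (ramp_neg (lexx 0)) expr0n subr0.
    rewrite normrM normfV ler_pdivrMl ?normr_gt0//.
    have rh : ramp h <= `|h| by rewrite /ramp ge_max normr_ge0 ler_norm.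
    rewrite ger0_norm ?exprn_ge0 ?ramp_ge0//.
    apply: (@le_trans _ _ (`|h| ^+ k.+2)); first by rewrite lerXn2r ?nnegrE ?ramp_ge0.
    rewrite exprS ler_wpM2l// exprS (le_trans _ he)// ler_piMr//.
    by apply: exprn_ile1.
  by apply: DeriveDef; [apply/cvg_ex; exists 0|apply: cvg_lim].
Unshelve. all: by end_near. Qed.

Lemma derive1_eq (f g : R -> R) : (forall x : R, is_derive x 1 f (g x)) -> derive1 f = g.
Proof. by move=> h; apply/funext => x; rewrite derive1E; apply: derive_val. Qed.

Lemma C1D_build (f g h : R -> R) : (forall x : R, is_derive x 1 f (g x)) ->
  (forall x : R, is_derive x 1 g (h x)) -> continuous h -> C1D 2 f.
Proof.
move=> fg gh ch.
have cd (u v : R -> R) : (forall x : R, is_derive x 1 u (v x)) -> continuous u.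
  by move=> uv x; apply/differentiable_continuous/derivable1_diffP; exact: ex_derive.
split; [exact: cd fg|by move=> x; exact: ex_derive|].
rewrite (derive1_eq fg); split; [exact: cd gh|by move=> x; exact: ex_derive|].
by rewrite (derive1_eq gh).
Qed.

(** The cube is the least power of a positive part whose second derivative is continuous. [bump1]
    and [bump2] are the two derivatives. *)
Definition bump0 (e s : R) : R := ramp (e ^+ 2 - s ^+ 2) ^+ 3.
Definition bump1 (e s : R) : R := 3 * ramp (e ^+ 2 - s ^+ 2) ^+ 2 * (- (2 * s)).
Definition bump2 (e s : R) : R :=
  24 * s ^+ 2 * ramp (e ^+ 2 - s ^+ 2) - 6 * ramp (e ^+ 2 - s ^+ 2) ^+ 2.

Let is_derive_arg (e s : R) : is_derive s 1 (fun s : R => e ^+ 2 - s ^+ 2) (- (2 * s)).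
Proof.
by apply: is_derive_eq; rewrite /GRing.scale/=; ring.
Qed.

Lemma is_derive_bump0 (e s : R) : is_derive s 1 (bump0 e) (bump1 e s).
Proof.
have := @is_derive1_comp _ _ _ s _ _ (is_derive_rampX 1 (e ^+ 2 - s ^+ 2)) (is_derive_arg e s).
by [].
Qed.

Lemma is_derive_bump1 (e s : R) : is_derive s 1 (bump1 e) (bump2 e s).
Proof.
have h := @is_derive1_comp _ _ _ s _ _ (is_derive_rampX 0 (e ^+ 2 - s ^+ 2)) (is_derive_arg e s).
have h1 : is_derive s 1 (fun s : R => - (6 * s)) (- 6).
  by apply: is_derive_eq; rewrite /GRing.scale/= mulr1.
have h2 := is_deriveM h h1.
rewrite (_ : bump1 e = (fun s => (ramp (e ^+ 2 - s ^+ 2)) ^+ 2 * (- (6 * s)))); last first.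
  by apply/funext => x; rewrite /bump1; ring.
apply: is_derive_eq; rewrite /bump2 /GRing.scale/=; ring.
Qed.

Lemma bump2_continuous e : continuous (bump2 e).
Proof.
move=> s.
have cr : (ramp (e ^+ 2 - s ^+ 2)) @[s --> s] --> ramp (e ^+ 2 - s ^+ 2).
  apply: (@continuous_comp _ _ _ (fun s : R => e ^+ 2 - s ^+ 2) ramp); last exact: ramp_continuous.
  by apply: cvgB; [exact: cvg_cst|exact: exprn_continuous].
apply: cvgB; apply: cvgM => //.
- by apply: cvgM; [exact: cvg_cst|exact: exprn_continuous].
- exact: cvg_cst.
- by rewrite expr2; apply: cvgM.
Qed.

Lemma bump_supp (e s : R) : 0 <= e -> e <= `|s| ->
  [/\ bump0 e s = 0, bump1 e s = 0 & bump2 e s = 0].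
Proof.
move=> e0 es.
have r0 : ramp (e ^+ 2 - s ^+ 2) = 0.
  by apply: ramp_neg; rewrite subr_le0 -(real_normK (num_real s)) lerXn2r ?nnegrE.
by rewrite /bump0 /bump1 /bump2 r0 !expr0n/= !(mulr0, mul0r) subrr.
Qed.

Lemma bump0_ge0 (e s : R) : 0 <= bump0 e s.
Proof. by rewrite exprn_ge0// ramp_ge0. Qed.

Lemma bump0_even (e s : R) : bump0 e (- s) = bump0 e s.
Proof. by rewrite /bump0 sqrrN. Qed.

Lemma continuous_bounded_supp (f : R -> R) (e : R) : continuous f -> 0 <= e ->
  (forall s, e <= `|s| -> f s = 0) -> exists2 M : R, 0 <= M & forall s, `|f s| <= M.
Proof.
move=> cf e0 fe.
have /compact_bounded[B [_ Br]] : compact (f @` `[- e, e]).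
  apply: continuous_compact; last exact: segment_compact.
  exact: continuous_subspaceT.
exists (`|B| + 1) => // s; have [es|es] := leP e `|s|.
  by rewrite fe// normr0.
apply: Br; first by rewrite ltr_pwDr// ler_norm.
by exists s => //; rewrite /= in_itv/= -ler_norml ltW.
Qed.

(* A C^2 mollifier: test functions in the weak formulation are only required
   to be C^2, so a piecewise polynomial profile is enough. *)
Record mollifier (e : R) := Mollifier {
  eta0 : R -> R; eta1 : R -> R; eta2 : R -> R;
  eta0_derive : forall x : R, is_derive x 1 eta0 (eta1 x);
  eta1_derive : forall x : R, is_derive x 1 eta1 (eta2 x);
  eta2_continuous : continuous eta2;
  eta_supp : forall s, e <= `|s| -> [/\ eta0 s = 0, eta1 s = 0 & eta2 s = 0];
  eta0_ge0 : forall s, 0 <= eta0 s;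
  eta0_even : forall s, eta0 (- s) = eta0 s;
  eta0_int1 : (\int[lam1]_s (eta0 s)%:E = 1)%E }.

Lemma mollifier_exists (e : R) : 0 < e -> exists m : mollifier e, True.
Proof.
move=> e0.
have cb0 : continuous (bump0 e).
  move=> x; apply/differentiable_continuous/derivable1_diffP.
  by have := is_derive_bump0 e x => -[].
have mb : measurable_fun setT (bump0 e) by exact: continuous_measurable_fun.
have [M M0 bM] := continuous_bounded_supp cb0 (ltW e0)
  (fun s h => let: And3 h1 _ _ := bump_supp (ltW e0) h in h1).
have fin : (\int[lam1]_s (bump0 e s)%:E < +oo)%E.
  apply: (@le_lt_trans _ _ (\int[lam1]_s (M * (if `|s| <= e then 1 else 0))%:E)%E).
    apply: le_ge0_integralT => //.
    - by mfun.
    - exact: bump0_ge0.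
    - move=> s; case: ifPn => se; first by rewrite mulr1 (le_trans _ (bM s))// ler_norm.
      move: se; rewrite -ltNge mulr0 => /ltW se.
      by have [->] := bump_supp (ltW e0) se.
  rewrite ge0_integralZlT//; [|by mfun|by move=> s; case: ifP].
  by apply: lte_mul_pinfty => //; exact: indic_int_lty.
pose c := fine (\int[lam1]_s (bump0 e s)%:E)%E.
have cE : (\int[lam1]_s (bump0 e s)%:E = c%:E)%E.
  rewrite fineK// ge0_fin_numE//; apply: integral_ge0 => s _.
  by rewrite lee_fin bump0_ge0.
have c0 : 0 < c.
  rewrite -lte_fin -cE.
  (* On |s| <= e / 2 one has e^2 - s^2 >= (3/4) e^2, so [q] bounds the bump from below there and its
     mass is positive. *)
  pose q := (e ^+ 2 * (3 / 4)) ^+ 3.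
  have q0 : 0 < q by rewrite exprn_gt0// mulr_gt0 ?exprn_gt0// divr_gt0.
  apply: (@lt_le_trans _ _ (\int[lam1]_s (q * \1_(`[- (e / 2), e / 2]%classic) s)%:E)%E).
    rewrite ge0_integralZlT//; last exact: ltW.
    rewrite integral_indic// setIT /= lam1_itv/= lte_fin ifT; last by lra.
    by rewrite -EFinD -EFinM lte_fin mulr_gt0//; lra.
  apply: le_ge0_integralT => //.
  - by apply: measurable_funM => //; apply: measurable_indic.
  - by move=> s; rewrite mulr_ge0// ltW.
  - move=> s; rewrite indicE mem_setE in_itv/= -ler_norml.
    case: (leP `|s| (e / 2)) => se /=; last by rewrite mulr0 bump0_ge0.
    rewrite mulr1 /q /bump0 lerXn2r ?nnegrE ?ramp_ge0//.
      by rewrite mulr_ge0 ?sqr_ge0// divr_ge0.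
    rewrite /ramp le_max; apply/orP; right.
    have : `|s| ^+ 2 <= (e / 2) ^+ 2 by rewrite lerXn2r ?nnegrE// divr_ge0// ltW.
    by rewrite real_normK ?num_real// => h; lra.
have dZ (f g : R -> R) (x : R) : is_derive x 1 f (g x) ->
    is_derive x 1 (fun y => c^-1 * f y) (c^-1 * g x).
  by move=> h; exact: (@is_deriveZ _ _ _ f c^-1 x 1 (g x) h).
have d0 x := dZ _ _ x (is_derive_bump0 e x); have d1 x := dZ _ _ x (is_derive_bump1 e x).
have c2 : continuous (fun s => c^-1 * bump2 e s).
  by move=> x; apply: cvgM; [exact: cvg_cst|exact: bump2_continuous].
have supp s : e <= `|s| ->
    [/\ c^-1 * bump0 e s = 0, c^-1 * bump1 e s = 0 & c^-1 * bump2 e s = 0].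
  by move=> /(bump_supp (ltW e0))[-> -> ->]; rewrite mulr0.
have ge0 s : 0 <= c^-1 * bump0 e s by rewrite mulr_ge0 ?bump0_ge0// invr_ge0 ltW.
have even s : c^-1 * bump0 e (- s) = c^-1 * bump0 e s by rewrite bump0_even.
have int1 : (\int[lam1]_s (c^-1 * bump0 e s)%:E = 1)%E.
  rewrite ge0_integralZlT//; [|exact: bump0_ge0|by rewrite invr_ge0 ltW].
  by rewrite cE -EFinM mulVf// gt_eqF.
by exists (Mollifier d0 d1 c2 supp ge0 even int1).
Qed.

End mollifier.

(** * Integrability and Fubini for real-valued functions *)

Section real_integrals.
Context d (T : measurableType d) (R : realType) (m : {measure set T -> \bar R}).
Implicit Types f g : T -> R.

Definition itg f := m.-integrable setT (fun x => (f x)%:E).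

Lemma itgP f : measurable_fun setT f -> (\int[m]_x `|f x|%:E < +oo)%E -> itg f.
Proof.
move=> mf fo; apply/integrableP; split; first by mfun.
exact: fo.
Qed.

Lemma itg_lty f : itg f -> (\int[m]_x `|f x|%:E < +oo)%E.
Proof. by move=> /integrableP[]. Qed.

Lemma itg_measurable f : itg f -> measurable_fun setT f.
Proof. by move=> /measurable_int/measurable_EFinP. Qed.

Lemma itg_le f g : measurable_fun setT f -> measurable_fun setT g ->
  (forall x, `|f x| <= g x) -> (\int[m]_x (g x)%:E < +oo)%E -> itg f.
Proof.
move=> mf mg fg go; apply: itgP => //; apply: le_lt_trans go.
by apply: le_ge0_integralT => //; mfun.
Qed.

Lemma itg_dom f g : measurable_fun setT f -> itg g -> (forall x, `|f x| <= g x) -> itg f.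
Proof.
move=> mf ig fg; apply: (itg_le mf (itg_measurable ig) fg).
apply: le_lt_trans (itg_lty ig); apply: le_ge0_integralT.
- exact: itg_measurable.
- by have mg := itg_measurable ig; mfun.
- by move=> x; rewrite (le_trans _ (fg x)).
- by move=> x; exact: ler_norm.
Qed.

Lemma itgD f g : itg f -> itg g -> itg (fun x => f x + g x).
Proof. by move=> h1 h2; have := integrableD measurableT h1 h2. Qed.

Lemma itgB f g : itg f -> itg g -> itg (fun x => f x - g x).
Proof. by move=> h1 h2; have := integrableB measurableT h1 h2. Qed.

Lemma itgZ k f : itg f -> itg (fun x => k * f x).
Proof. by move=> h; have := integrableZl measurableT k h. Qed.

Lemma itgN f : itg f -> itg (fun x => - f x).
Proof. by move=> h; have := integrableN h. Qed.

Lemma itg_norm f : itg f -> itg (fun x => `|f x|).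
Proof.
move=> h; apply: itgP; first by have mf := itg_measurable h; mfun.
by under eq_integral do rewrite normr_id; exact: itg_lty.
Qed.

Lemma RintE f : itg f -> (\int[m]_x (f x)%:E)%E = (\int[m]_x f x)%:E.
Proof. by move=> h; rewrite /Rintegral fineK//; exact: (integrable_fin_num measurableT h). Qed.

Lemma RintD f g : itg f -> itg g ->
  \int[m]_x (f x + g x) = \int[m]_x f x + \int[m]_x g x.
Proof. exact: RintegralD. Qed.

Lemma RintB f g : itg f -> itg g ->
  \int[m]_x (f x - g x) = \int[m]_x f x - \int[m]_x g x.
Proof. exact: RintegralB. Qed.

Lemma RintZ k f : itg f -> \int[m]_x (k * f x) = k * \int[m]_x f x.
Proof. exact: RintegralZl. Qed.

(* Holds without integrability, because [fine] sends both infinities to [0]. *)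
Lemma RintN f : \int[m]_x (- f x) = - \int[m]_x f x.
Proof.
rewrite /Rintegral [in LHS]integralE [in RHS]integralE.
have -> : ((fun x => (- f x)%:E) ^\+ = (fun x => (f x)%:E) ^\-)%E.
  by rewrite -funeposN; congr (_ ^\+)%E.
have -> : ((fun x => (- f x)%:E) ^\- = (fun x => (f x)%:E) ^\+)%E.
  by rewrite -funenegN; congr (_ ^\-)%E.
case: (\int[_]_x _)%E => [r||]; case: (\int[_]_x _)%E => [r'||] //=; rewrite ?oppr0//.
by rewrite opprB.
Qed.

Lemma Rint0 : \int[m]_x (0 : R) = 0.
Proof. by rewrite /Rintegral integral0. Qed.

Lemma le_Rint f g : itg f -> itg g -> (forall x, f x <= g x) ->
  \int[m]_x f x <= \int[m]_x g x.
Proof. by move=> h1 h2 fg; apply: le_Rintegral. Qed.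

Lemma le_norm_Rint f : itg f -> `|\int[m]_x f x| <= \int[m]_x `|f x|.
Proof. by move=> h; apply: le_normr_Rintegral. Qed.

End real_integrals.

Section real_fubini.
Context d1 d2 (X : measurableType d1) (Y : measurableType d2) (R : realType).
Variables (m1 : {sigma_finite_measure set X -> \bar R})
  (m2 : {sigma_finite_measure set Y -> \bar R}).
Implicit Types f : X -> Y -> R.

Definition itg2 f := (m1 \x m2)%E.-integrable setT (fun z => (f z.1 z.2)%:E).

Lemma itg2P f : measurable_fun setT (fun z => f z.1 z.2) ->
  (\int[m1]_x \int[m2]_y `|f x y|%:E < +oo)%E -> itg2 f.
Proof.
move=> mf h; apply/integrable12ltyP; first by mfun.
exact: h.
Qed.

Lemma itg2_measurable f : itg2 f -> measurable_fun setT (fun z => f z.1 z.2).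
Proof. by move=> /measurable_int/measurable_EFinP. Qed.

Lemma itg2_lty f : itg2 f -> (\int[m1]_x \int[m2]_y `|f x y|%:E < +oo)%E.
Proof.
move=> h; have mf := measurable_int _ h.
by move/(integrable12ltyP m1 m2 mf): (h).
Qed.

Lemma itg2_swap f : itg2 f -> (\int[m2]_y \int[m1]_x `|f x y|%:E < +oo)%E.
Proof.
move=> h; have mf := itg2_measurable h.
have mf' : measurable_fun setT (fun z => `|f z.1 z.2|) by mfun.
by rewrite -(tonelli m1 m2 (f := fun x y => `|f x y|))//; exact: itg2_lty.
Qed.

(** No integrability is asked for: the extended integral is a difference of two Tonelli integrals,
    and [fine] is measurable. *)
Lemma measurable_Rint f : measurable_fun setT (fun z => f z.1 z.2) ->
  measurable_fun setT (fun x => \int[m2]_y f x y).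
Proof.
move=> mf; apply: (measurableT_comp (@fine_measurable R setT measurableT)
  (g := fun x => (\int[m2]_y (f x y)%:E)%E)).
rewrite (_ : (fun x => _) = (fun x => \int[m2]_y (Num.max (f x y) 0)%:E -
    \int[m2]_y (Num.max (- f x y) 0)%:E)%E).
  have max0 (r : R) : 0 <= Num.max r 0 by rewrite le_max lexx orbT.
  by apply: emeasurable_funB;
    [apply: (measurable_tonelliF m2 (f := fun x y => Num.max (f x y) 0))|
     apply: (measurable_tonelliF m2 (f := fun x y => Num.max (- f x y) 0))] => //; mfun.
by apply/funext => x; rewrite integralE; congr (_ - _)%E; apply: eq_integral => y _;
  rewrite ?funeposE ?funenegE EFin_max.
Qed.

Lemma itg2_ae1 f : itg2 f -> {ae m1, forall x, itg m2 (f x)}.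
Proof. exact: ae_integrable1. Qed.

Lemma itg2_ae2 f : itg2 f -> {ae m2, forall y, itg m1 (f ^~ y)}.
Proof. exact: ae_integrable2. Qed.

Lemma itg2_itg1 f : itg2 f -> itg m1 (fun x => \int[m2]_y f x y).
Proof.
move=> h; have /integrableP[mF Foo] := integrable_fubini_F h.
have mf : measurable_fun setT (fun x => \int[m2]_y f x y).
  exact: (measurableT_comp (@fine_measurable R setT measurableT) mF).
apply/integrableP; split; first by mfun.
apply: le_lt_trans Foo; apply: ge0_le_integral => //.
- by apply: measurableT_comp => //; mfun.
- exact: measurableT_comp.
- by move=> x _; rewrite /Rintegral /fubini_F; case: (\int[_]_y _)%E => [r||] /=; rewrite ?lexx ?leey.
Qed.

End real_fubini.

Section real_fubini_swap.
Context d1 d2 (X : measurableType d1) (Y : measurableType d2) (R : realType).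
Variables (m1 : {sigma_finite_measure set X -> \bar R})
  (m2 : {sigma_finite_measure set Y -> \bar R}).
Implicit Types f : X -> Y -> R.

Lemma itg2C f : itg2 m1 m2 f -> itg2 m2 m1 (fun y x => f x y).
Proof.
move=> h; apply: itg2P; last exact: itg2_swap.
have mf := itg2_measurable h.
exact: (measurableT_comp mf (measurable_fun_pair measurable_snd measurable_fst)).
Qed.

Lemma itg2_itg2 f : itg2 m1 m2 f -> itg m2 (fun y => \int[m1]_x f x y).
Proof. by move=> /itg2C/itg2_itg1. Qed.

(** The real inner integral agrees with the extended one on almost every slice only, hence the
    passage through almost everywhere equality on both sides. *)
Lemma RFubini f : itg2 m1 m2 f ->
  \int[m1]_x \int[m2]_y f x y = \int[m2]_y \int[m1]_x f x y.
Proof.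
move=> h; rewrite {1}/Rintegral [in RHS]/Rintegral; congr fine.
transitivity (\int[m1]_x \int[m2]_y (f x y)%:E)%E.
  apply: ae_eq_integral => //.
  - exact: measurable_int (itg2_itg1 h).
  - exact: measurable_fubini_F h.
  - by apply: filterS (itg2_ae1 h) => x hx _; rewrite RintE.
rewrite (Fubini h); apply: ae_eq_integral => //.
- exact: measurable_fubini_G h.
- exact: measurable_int (itg2_itg2 h).
- by apply: filterS (itg2_ae2 h) => x hx _; rewrite -RintE.
Qed.

Lemma RFubini_prod f : itg2 m1 m2 f ->
  \int[(m1 \x m2)%E]_z f z.1 z.2 = \int[m1]_x \int[m2]_y f x y.
Proof.
move=> h; rewrite {1}/Rintegral [in RHS]/Rintegral; congr fine.
rewrite -(integral12_prod_meas1 h); apply: ae_eq_integral => //.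
- exact: measurable_fubini_F h.
- exact: measurable_int (itg2_itg1 h).
- by apply: filterS (itg2_ae1 h) => x hx _; rewrite /fubini_F/= -RintE.
Qed.

Lemma itg2_mul (f : X -> R) (g : Y -> R) : itg m1 f -> itg m2 g ->
  itg2 m1 m2 (fun x y => f x * g y).
Proof.
move=> hf hg; have mf := itg_measurable hf; have mg := itg_measurable hg.
apply: itg2P; first by mfun.
rewrite (_ : (\int[m1]_x _)%E = \int[m1]_x (`|f x| * \int[m2]_y `|g y|)%:E)%E.
  apply: le_lt_trans (itg_lty (itgZ (\int[m2]_y `|g y|) hf)).
  apply: le_ge0_integralT; [by mfun|by mfun| |].
    by move=> x; rewrite mulr_ge0//; apply: Rintegral_ge0.
  by move=> x; rewrite normrM mulrC ler_wpM2r// ler_norm.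
apply: eq_integral => x _; rewrite -RintZ//; last exact: itg_norm.
rewrite -RintE; last by apply: itgZ; exact: itg_norm.
by apply: eq_integral => y _; rewrite normrM.
Qed.

Lemma Rint_mul (f : X -> R) (g : Y -> R) : itg m1 f -> itg m2 g ->
  \int[(m1 \x m2)%E]_z (f z.1 * g z.2) = \int[m1]_x f x * \int[m2]_y g y.
Proof.
move=> hf hg; rewrite (RFubini_prod (itg2_mul hf hg)) mulrC -RintZ//.
by apply: eq_Rintegral => x _; rewrite RintZ// mulrC.
Qed.

Lemma ge0_integral_mul (f : X -> R) (g : Y -> R) :
  measurable_fun setT f -> measurable_fun setT g ->
  (forall x, 0 <= f x) -> (forall y, 0 <= g y) ->
  (\int[(m1 \x m2)%E]_z (f z.1 * g z.2)%:E = \int[m1]_x (f x)%:E * \int[m2]_y (g y)%:E)%E.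
Proof.
move=> mf mg f0 g0; rewrite (tonelli1 m1 m2 (f := fun z => f z.1 * g z.2)); last 2 first.
- by mfun.
- by move=> z; rewrite mulr_ge0.
rewrite -ge0_integralZr//; last 3 first.
- by mfun.
- by move=> x _; rewrite lee_fin.
- by apply: integral_ge0 => y _; rewrite lee_fin.
by apply: eq_integral => x _; exact: (ge0_integralZlT m2 mg g0 (f0 x)).
Qed.

End real_fubini_swap.

(** * The Biot-Savart kernel is divergence free *)

Section ibp.
Context {R : realType}.

Lemma integral_supp_itv (f : R -> R) (N : R) : measurable_fun setT f ->
  (forall s, N < `|s| -> f s = 0) ->
  (\int[lam1]_s (f s)%:E = \int[@lebesgue_measure R]_(s in `[(- N)%R, N]) (f s)%:E)%E.
Proof.
move=> mf fN; rewrite -integral_lam1//; last by apply: measurable_funTS; mfun.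
rewrite [RHS]integral_mkcond; apply: eq_integral => s _.
rewrite patchE mem_setE in_itv/= -ler_norml.
by case: leP => // /fN ->.
Qed.

(** Only [v] has compact support. This lets [u] be the logarithmic stream function, which does not
    vanish at infinity. *)
Lemma integral_ibp (u u' v v' : R -> R) (N : R) : 0 < N ->
  (forall x : R, is_derive x 1 u (u' x)) -> continuous u' ->
  (forall x : R, is_derive x 1 v (v' x)) -> continuous v' ->
  (forall s, N <= `|s| -> v s = 0 /\ v' s = 0) ->
  (\int[lam1]_s (u s * v' s)%:E = - \int[lam1]_s (u' s * v s)%:E)%E.
Proof.
move=> N0 du cu' dv cv' vN.
have cd (f g : R -> R) : (forall x : R, is_derive x 1 f (g x)) -> continuous f.
  by move=> fg x; apply/differentiable_continuous/derivable1_diffP; exact: ex_derive.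
have cu := cd _ _ du; have cv := cd _ _ dv.
have mu := continuous_measurable_fun cu; have mu' := continuous_measurable_fun cu'.
have mv := continuous_measurable_fun cv; have mv' := continuous_measurable_fun cv'.
rewrite (@integral_supp_itv (fun s => u s * v' s) N); last 2 first.
- by apply: measurable_funM.
- by move=> s /ltW/vN[_ ->]; rewrite mulr0.
rewrite (@integral_supp_itv (fun s => u' s * v s) N); last 2 first.
- by apply: measurable_funM.
- by move=> s /ltW/vN[-> _]; rewrite mulr0.
rewrite (@integration_by_parts R u v u' v').
- have [-> _] : v N = 0 /\ v' N = 0 by apply: vN; rewrite ler_norm.
  have [-> _] : v (- N) = 0 /\ v' (- N) = 0 by apply: vN; rewrite normrN ler_norm.
  by rewrite !mulr0 subrr sub0e.
- by lra.
- exact: continuous_subspaceT.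
- split; first by move=> x _; exact: ex_derive.
    by apply: cvg_at_right_filter; exact: cu.
  by apply: cvg_at_left_filter; exact: cu.
- by move=> x _; rewrite derive1E; exact: derive_val.
- exact: continuous_subspaceT.
- split; first by move=> x _; exact: ex_derive.
    by apply: cvg_at_right_filter; exact: cv.
  by apply: cvg_at_left_filter; exact: cv.
- by move=> x _; rewrite derive1E; exact: derive_val.
Qed.

Lemma Rint_ibp (u u' v v' : R -> R) (N : R) : 0 < N ->
  (forall x : R, is_derive x 1 u (u' x)) -> continuous u' ->
  (forall x : R, is_derive x 1 v (v' x)) -> continuous v' ->
  (forall s, N <= `|s| -> v s = 0 /\ v' s = 0) ->
  \int[lam1]_s (u s * v' s) = - \int[lam1]_s (u' s * v s).
Proof. by move=> *; rewrite /Rintegral (@integral_ibp u u' v v' N)// fineN. Qed.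

End ibp.

Section divfree.
Context {R : realType}.

(** For c > 0 the singularity at the origin is smoothed in a way that keeps an explicit stream
    function, [logpot]; c = 0 gives back the Biot-Savart kernel. *)
Definition kreg1 (c : R) (z : R * R) : R := - z.2 / (2 * pi * (z.1 ^+ 2 + z.2 ^+ 2 + c)).
Definition kreg2 (c : R) (z : R * R) : R := z.1 / (2 * pi * (z.1 ^+ 2 + z.2 ^+ 2 + c)).

Lemma kreg0 : kreg1 0 = @kBS1 R /\ kreg2 0 = @kBS2 R.
Proof. by split; apply/funext => z; rewrite /kreg1 /kreg2 addr0. Qed.

(** |a| (|a| + |b|) <= 4 (a^2 + b^2), and 4 <= 2 pi. The bound is uniform in c, as the limit c -> 0
    requires. *)
Lemma kreg_aux (a b c : R) : 0 <= c ->
  `|a| / (2 * pi * (a ^+ 2 + b ^+ 2 + c)) <= (`|a| + `|b|)^-1.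
Proof.
move=> c0; have [->|a0] := eqVneq a 0.
  by rewrite normr0 mul0r invr_ge0 addr_ge0.
have pa : 0 < `|a| by rewrite normr_gt0.
have pb := normr_ge0 b.
have a2 : 0 < a ^+ 2 by rewrite exprn_even_gt0.
have b2 : 0 <= b ^+ 2 by rewrite sqr_ge0.
have p2 := pi_ge2 R.
rewrite ler_pdivrMr; last by rewrite mulr_gt0 ?mulr_gt0 ?pi_gt0//; lra.
rewrite mulrC ler_pdivlMr; last by lra.
rewrite -[a ^+ 2]real_normK ?num_real// -[b ^+ 2]real_normK ?num_real//.
rewrite -[a ^+ 2]real_normK ?num_real// in a2.
move: pa pb a2; move: `|a| `|b| => x y x0 y0 x2.
apply: (@le_trans _ _ (4 * (x ^+ 2 + y ^+ 2))); first by nra.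
apply: (@le_trans _ _ (2 * pi * (x ^+ 2 + y ^+ 2))); last first.
  by rewrite ler_wpM2l ?mulr_ge0 ?pi_ge0// lerDl.
by rewrite ler_wpM2r ?addr_ge0 ?sqr_ge0//; lra.
Qed.

Lemma kreg_bound (c : R) z : 0 <= c -> `|kreg1 c z| <= kap z /\ `|kreg2 c z| <= kap z.
Proof.
move=> c0; have d0 : 0 <= 2 * pi * (z.1 ^+ 2 + z.2 ^+ 2 + c).
  by rewrite mulr_ge0 ?mulr_ge0 ?pi_ge0// !addr_ge0 ?sqr_ge0.
split; rewrite normrM normfV ?normrN (ger0_norm d0) /kap.
  by rewrite [`|z.1| + _]addrC [z.1 ^+ 2 + _]addrC kreg_aux.
by rewrite kreg_aux.
Qed.

Lemma kBS_bound (z : R * R) : `|kBS1 z| <= kap z /\ `|kBS2 z| <= kap z.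
Proof. by have [<- <-] := kreg0; exact: kreg_bound. Qed.

Lemma measurable_kreg c : measurable_fun setT (kreg1 c) /\ measurable_fun setT (kreg2 c).
Proof. by rewrite /kreg1 /kreg2; split; mfun. Qed.

(** Outside the unit l1 ball around a the kernel is at most 1, inside it [kap_near] applies. The
    maximum with 0 covers a negative N. *)
Lemma kap_box_lty (a : R * R) (N : R) :
  (\int[lam2]_x (kap (x.1 - a.1, x.2 - a.2) *
     (if (`|x.1| <= N) && (`|x.2| <= N) then 1 else 0))%:E < +oo)%E.
Proof.
have mk := @measurable_kap R.
pose f (z : R * R) := kap z * (if `|z.1| + `|z.2| < 1 then 1 else 0).
have mf : measurable_fun setT f by rewrite /f; mfun.
have f0 z : 0 <= f z by rewrite mulr_ge0 ?kap_ge0//; case: ifP.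
apply: (@le_lt_trans _ _ (\int[lam2]_x (f (x.1 + - a.1, x.2 + - a.2) +
    (if (`|x.1| <= Num.max N 0) && (`|x.2| <= Num.max N 0) then 1 else 0))%:E)%E).
  apply: le_ge0_integralT.
  - by mfun.
  - by mfun.
  - by move=> x; rewrite mulr_ge0 ?kap_ge0//; case: ifP.
  - move=> x; rewrite /f /=; set k := kap _; have k0 : 0 <= k by exact: kap_ge0.
    have : (`|x.1| <= N) && (`|x.2| <= N) ->
        (`|x.1| <= Num.max N 0) && (`|x.2| <= Num.max N 0).
      by move=> /andP[h1 h2]; rewrite !le_max h1 h2.
    case: ifPn => [_ -> //|_ _]; last first.
      by rewrite mulr0 addr_ge0//; [rewrite mulr_ge0//; case: ifP|case: ifP].
    rewrite mulr1; case: ltP => h; first by rewrite mulr1 lerDl.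
    by rewrite mulr0 add0r /k /kap/= invf_le1// (lt_le_trans _ h).
rewrite ge0_integralDT; [|by mfun|by mfun|by move=> x; exact: f0|by move=> x; case: ifP].
rewrite (ge0_integral_shift2 (- a.1) (- a.2) mf f0).
apply: lte_add_pinfty.
  by rewrite (le_lt_trans (kap_near ltr01))// ltry.
by rewrite integral_box_norm ?ltry// le_max lexx orbT.
Qed.

Definition C1c (N : R) (p p' : R -> R) :=
  [/\ forall x : R, is_derive x 1 p (p' x), continuous p' &
      forall s, N <= `|s| -> p s = 0 /\ p' s = 0].

Lemma C1c_continuous N p p' : C1c N p p' -> continuous p.
Proof.
move=> [dp _ _] x; apply/differentiable_continuous/derivable1_diffP.
exact: ex_derive.
Qed.

Lemma C1c_bound N p p' : 0 < N -> C1c N p p' ->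
  exists2 M : R, 0 <= M & forall s, `|p s| <= M /\ `|p' s| <= M.
Proof.
move=> N0 cp; have [dp cp' pN] := cp.
have [M M0 hM] := continuous_bounded_supp (C1c_continuous cp) (ltW N0)
  (fun s h => (pN s h).1).
have [M' M'0 hM'] := continuous_bounded_supp cp' (ltW N0) (fun s h => (pN s h).2).
exists (Num.max M M'); first by rewrite le_max M0.
by move=> s; rewrite !le_max hM hM' orbT.
Qed.

(** Stream function of the regularized kernel: (kreg1, kreg2) is its rotated gradient (- d2, d1). *)
Definition logpot (c : R) (z : R * R) : R := ln (z.1 ^+ 2 + z.2 ^+ 2 + c) / (4 * pi).

Lemma logpot_derive1 (a c y x : R) : 0 < c ->
  is_derive x 1 (fun s : R => logpot c (s - a, y)) (kreg2 c (x - a, y)).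
Proof.
move=> c0; rewrite /logpot /kreg2 /=.
have d0 : 0 < (x - a) ^+ 2 + y ^+ 2 + c by rewrite ltr_wpDl// addr_ge0 ?sqr_ge0.
have d1 : is_derive x 1 (fun s : R => (s - a) ^+ 2 + y ^+ 2 + c) (2 * (x - a)).
  have h : is_derive x 1 (fun s : R => s - a) 1.
    by apply: is_derive_eq; rewrite subr0.
  have h2 : is_derive x 1 (fun s : R => (s - a) ^+ 2) (2 * (x - a)).
    rewrite (_ : (fun _ => _) = (fun s : R => s - a) ^+ 2); last first.
      by apply/funext => s; rewrite exprfctE.
    by apply: is_derive_eq; rewrite /GRing.scale /=; ring.
  by apply: is_derive_eq; rewrite !addr0.
have h3 := @is_derive1_comp R (@ln R) (fun s : R => (s - a) ^+ 2 + y ^+ 2 + c) x _ _ (is_derive1_ln d0) d1.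
have h4 := @is_deriveZ _ _ _ _ (4 * pi)^-1 _ _ _ h3.
rewrite (_ : (fun s => _) =  (4 * pi)^-1 *: (@ln R \o (fun s : R => (s - a) ^+ 2 + y ^+ 2 + c))); last first.
  by apply/funext => s; rewrite mulrC.
apply: is_derive_eq; rewrite /GRing.scale /=.
have := pi_gt0 R; move: (pi : R) => P p0; field.
by rewrite !gt_eqF.
Qed.

Lemma kreg_swap (c : R) (z : R * R) : kreg2 c (z.2, z.1) = - kreg1 c z.
Proof. by rewrite /kreg1 /kreg2/= mulNr opprK [z.2 ^+ 2 + _]addrC. Qed.

Lemma logpot_derive2 (a c y x : R) : 0 < c ->
  is_derive x 1 (fun s : R => logpot c (y, s - a)) (- kreg1 c (y, x - a)).
Proof.
move=> c0; rewrite -kreg_swap /=.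
rewrite (_ : (fun _ => _) = (fun s : R => logpot c (s - a, y))); last first.
  by apply/funext => s; rewrite /logpot/= [(s - a) ^+ 2 + _]addrC.
exact: logpot_derive1.
Qed.

Lemma kreg_continuous (c y a : R) : 0 < c ->
  continuous (fun s : R => kreg2 c (s - a, y)) /\
  continuous (fun s : R => kreg1 c (y, s - a)).
Proof.
move=> c0.
have h : continuous (fun s : R => kreg2 c (s - a, y)).
  move=> s; rewrite /kreg2/=.
  have cs : (fun s : R => s - a) @ s --> s - a.
    by apply: cvgB; [exact: cvg_id|exact: cvg_cst].
  apply: cvgM => //; apply: cvgV.
    rewrite !mulf_neq0 ?gt_eqF ?pi_gt0//.
    by rewrite ltr_wpDl// addr_ge0 ?sqr_ge0.
  apply: cvgM; first exact: cvg_cst.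
  apply: cvgD; last exact: cvg_cst.
  apply: cvgD; last exact: cvg_cst.
  by under eq_fun do rewrite expr2; rewrite expr2; exact: cvgM.
split => //.
rewrite (_ : (fun _ => _) = (fun s : R => - kreg2 c (s - a, y))).
  by move=> s; apply: cvgN; exact: h.
by apply/funext => s; rewrite (kreg_swap c (y, s - a)) opprK.
Qed.

(** The kernel is replaced by derivatives of the stream function L. Integrating by parts in the
    second variable for the first term and in the first variable for the second one gives the
    integral of L p' q' with opposite signs. *)
Lemma kreg_divfree (a : R * R) (c N : R) (p p' q q' : R -> R) :
  0 < c -> 0 < N -> C1c N p p' -> C1c N q q' ->
  (\int[lam2]_x (kreg1 c (x.1 - a.1, x.2 - a.2) * (p' x.1 * q x.2) +
                 kreg2 c (x.1 - a.1, x.2 - a.2) * (p x.1 * q' x.2))%:E = 0)%E.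
Proof.
move=> c0 N0 cp cq.
have [dp cp' pN] := cp; have [dq cq' qN] := cq.
have mp := continuous_measurable_fun (C1c_continuous cp).
have mq := continuous_measurable_fun (C1c_continuous cq).
have mp' := continuous_measurable_fun cp'.
have mq' := continuous_measurable_fun cq'.
have [M M0 pM] := C1c_bound N0 cp; have [K K0 qK] := C1c_bound N0 cq.
have [mk1 mk2] := measurable_kreg c.
have mL : measurable_fun setT (fun x : R * R => logpot c (x.1 - a.1, x.2 - a.2)).
  rewrite /logpot /=; apply: measurable_funM; last by mfun.
  apply: (measurableT_comp (@measurable_ln R) (g := fun x : R * R => (x.1 - a.1) ^+ 2 + (x.2 - a.2) ^+ 2 + c)).
  by mfun.
have bnd (f : R * R -> R) (g h : R -> R) (B : R) : measurable_fun setT f ->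
    measurable_fun setT g -> measurable_fun setT h ->
    (forall x, `|x.1| <= N -> `|x.2| <= N -> `|f x| <= B) ->
    (forall s, `|g s| <= M) -> (forall s, `|h s| <= K) ->
    (forall s, N <= `|s| -> g s = 0) -> (forall s, N <= `|s| -> h s = 0) ->
    itg2 lam1 lam1 (fun s t => f (s, t) * (g s * h t)).
  move=> mf mg mh fB gM hK gN hN.
  have B0 : 0 <= B by apply: (le_trans (normr_ge0 _) (fB (0, 0) _ _)); rewrite /= normr0 ltW.
  apply: (@itg_le _ _ R (lam1 \x lam1)%E (fun z => f (z.1, z.2) * (g z.1 * h z.2)) (fun z => B * (M * K) * (if (`|z.1| <= N) && (`|z.2| <= N) then 1 else 0))).
  - rewrite (_ : (fun z => _) = (fun z => f z * (g z.1 * h z.2))); last first.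
      by apply/funext => -[].
    by mfun.
  - by mfun.
  - move=> [s t] /=; case: ifPn => [/andP[sN tN]|].
      by rewrite mulr1 !normrM ler_pM ?mulr_ge0// ?fB// ler_pM.
    rewrite negb_and -!ltNge => /orP[] /ltW; first by move=> /gN ->; rewrite mul0r mulr0 normr0 mulr0.
    by move=> /hN ->; rewrite !mulr0 normr0.
  - rewrite ge0_integralZlT; [|by mfun|by move=> z; case: ifP|by rewrite !mulr_ge0].
    by rewrite (integral_box_norm (ltW N0)) -EFinM ltry.
have [BL hBL] : exists B, forall x : R * R, `|x.1| <= N -> `|x.2| <= N -> `|logpot c (x.1 - a.1, x.2 - a.2)| <= B.
  pose C := (N + `|a.1|) ^+ 2 + (N + `|a.2|) ^+ 2 + c.
  exists ((`|ln c| + `|ln C|) / (4 * pi)) => x x1 x2.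
  rewrite /logpot /= normrM normfV [`|4 * pi|]ger0_norm ?mulr_ge0 ?pi_ge0//.
  rewrite ler_wpM2r ?invr_ge0 ?mulr_ge0 ?pi_ge0//.
  set d := (x.1 - a.1) ^+ 2 + _ + _.
  have sq (u v : R) : `|u| <= N -> (u - v) ^+ 2 <= (N + `|v|) ^+ 2.
    move=> uN; rewrite -[(u - v) ^+ 2]real_normK ?num_real// lerXn2r ?nnegrE ?normr_ge0 ?addr_ge0 ?(ltW N0)//.
    by rewrite (le_trans (ler_normB _ _))// lerD2r.
  have cd : c <= d by rewrite lerDr addr_ge0 ?sqr_ge0.
  have dC : d <= C by rewrite lerD2r lerD// sq.
  have d0 : 0 < d by exact: lt_le_trans cd.
  have C0 : 0 < C by exact: lt_le_trans dC.
  have l1 : ln c <= ln d by rewrite ler_ln ?posrE.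
  have l2 : ln d <= ln C by rewrite ler_ln ?posrE.
  rewrite ler_norml; apply/andP; split.
    by have := ler_norm (- ln c); rewrite normrN; have := normr_ge0 (ln C); lra.
  by have := ler_norm (ln C); have := normr_ge0 (ln c); lra.
have [Bk hBk] : exists B, forall x : R * R, `|x.1| <= N -> `|x.2| <= N ->
    `|kreg1 c (x.1 - a.1, x.2 - a.2)| <= B /\ `|kreg2 c (x.1 - a.1, x.2 - a.2)| <= B.
  exists ((N + `|a.1| + (N + `|a.2|)) / (2 * pi * c)) => x x1 x2.
  have hN (u v : R) : `|u| <= N -> `|u - v| <= N + `|v|.
    by move=> uN; rewrite (le_trans (ler_normB _ _))// lerD2r.
  have h1 := hN _ a.1 x1; have h2 := hN _ a.2 x2.
  have d0 : 0 < 2 * pi * ((x.1 - a.1) ^+ 2 + (x.2 - a.2) ^+ 2 + c).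
    by rewrite mulr_gt0 ?mulr_gt0 ?pi_gt0// ltr_wpDl// addr_ge0 ?sqr_ge0.
  have dc : (2 * pi * ((x.1 - a.1) ^+ 2 + (x.2 - a.2) ^+ 2 + c))^-1 <= (2 * pi * c)^-1.
    rewrite lef_pV2 ?posrE//; last by rewrite mulr_gt0 ?mulr_gt0 ?pi_gt0.
    by rewrite ler_wpM2l ?mulr_ge0 ?pi_ge0// lerDr addr_ge0 ?sqr_ge0.
  have n1 := normr_ge0 (x.1 - a.1); have n2 := normr_ge0 (x.2 - a.2).
  rewrite /kreg1 /kreg2 /= !normrM !normrN normfV (gtr0_norm d0).
  by split; rewrite ler_pM ?invr_ge0 ?(ltW d0)//; lra.
have i1 : itg2 lam1 lam1 (fun s t => kreg1 c (s - a.1, t - a.2) * (p' s * q t)).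
  apply: (bnd (fun x => kreg1 c (x.1 - a.1, x.2 - a.2)) p' q Bk) => //.
  - by mfun.
  - by move=> x h1 h2; have [] := hBk x h1 h2.
  - by move=> s; have [] := pM s.
  - by move=> s; have [] := qK s.
  - by move=> s /pN[].
  - by move=> s /qN[].
have i2 : itg2 lam1 lam1 (fun s t => kreg2 c (s - a.1, t - a.2) * (p s * q' t)).
  apply: (bnd (fun x => kreg2 c (x.1 - a.1, x.2 - a.2)) p q' Bk) => //.
  - by mfun.
  - by move=> x h1 h2; have [] := hBk x h1 h2.
  - by move=> s; have [] := pM s.
  - by move=> s; have [] := qK s.
  - by move=> s /pN[].
  - by move=> s /qN[].
have i3 : itg2 lam1 lam1 (fun s t => logpot c (s - a.1, t - a.2) * (p' s * q' t)).
  apply: (bnd (fun x => logpot c (x.1 - a.1, x.2 - a.2)) p' q' BL) => //.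
  - by move=> s; have [] := pM s.
  - by move=> s; have [] := qK s.
  - by move=> s /pN[].
  - by move=> s /qN[].
have E1 : \int[lam2]_x (kreg1 c (x.1 - a.1, x.2 - a.2) * (p' x.1 * q x.2)) =
    \int[lam1]_s \int[lam1]_t (logpot c (s - a.1, t - a.2) * (p' s * q' t)).
  apply: (etrans (RFubini_prod i1)); apply: eq_Rintegral => s _.
  have dL (x : R) := logpot_derive2 a.2 (s - a.1) x c0.
  have cL : continuous (fun t : R => - kreg1 c (s - a.1, t - a.2)).
    by move=> t; apply: cvgN; apply: (kreg_continuous _ _ c0).2.
  have dv (x : R) : is_derive x 1 (fun t => p' s * q t) (p' s * q' x).
    by have dqx := dq x; exact: (@is_deriveZ _ _ _ q (p' s) x 1 (q' x) dqx).
  have cv : continuous (fun t => p' s * q' t).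
    by move=> t; apply: cvgM; [exact: cvg_cst|exact: cq'].
  rewrite (Rint_ibp N0 dL cL dv cv); last first.
    by move=> t /qN[-> ->]; rewrite mulr0.
  by rewrite -RintN; apply: eq_Rintegral => t _; rewrite mulNr opprK.
have E2 : \int[lam2]_x (kreg2 c (x.1 - a.1, x.2 - a.2) * (p x.1 * q' x.2)) =
    - \int[lam1]_s \int[lam1]_t (logpot c (s - a.1, t - a.2) * (p' s * q' t)).
  apply: (etrans (RFubini_prod i2)); rewrite (RFubini i2) (RFubini i3) -RintN; apply: eq_Rintegral => t _.
  have dL (x : R) := logpot_derive1 a.1 (t - a.2) x c0.
  have cL := (kreg_continuous (t - a.2) a.1 c0).1.
  have dv (x : R) : is_derive x 1 (fun s => q' t * p s) (q' t * p' x).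
    by have dpx := dp x; exact: (@is_deriveZ _ _ _ p (q' t) x 1 (p' x) dpx).
  have cv : continuous (fun s => q' t * p' s).
    by move=> s; apply: cvgM; [exact: cvg_cst|exact: cp'].
  transitivity (- - \int[lam1]_x (kreg2 c (x - a.1, t - a.2) * (q' t * p x))).
    by rewrite opprK; apply: eq_Rintegral => s _; rewrite [q' t * _]mulrC.
  rewrite -(Rint_ibp N0 dL cL dv cv); last first.
    by move=> s /pN[-> ->]; rewrite mulr0.
  by congr (- _); apply: eq_Rintegral => s _; rewrite [q' t * _]mulrC.
apply: (etrans (RintE (itgD i1 i2))); congr EFin.
by apply: (etrans (RintD i1 i2)); rewrite [X in X + _]E1 [X in _ + X]E2 addrN.
Qed.

(** Limit c = 1/(n+1) -> 0 of the regularized identity, dominated uniformly in c by [kap] on the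
    support of the test functions. *)
Lemma kBS_divfree (a : R * R) (N : R) (p p' q q' : R -> R) :
  0 < N -> C1c N p p' -> C1c N q q' ->
  (\int[lam2]_x (kBS1 (x.1 - a.1, x.2 - a.2) * (p' x.1 * q x.2) +
                 kBS2 (x.1 - a.1, x.2 - a.2) * (p x.1 * q' x.2))%:E = 0)%E.
Proof.
move=> N0 cp cq.
have [dp cp' pN] := cp; have [dq cq' qN] := cq.
have mp := continuous_measurable_fun (C1c_continuous cp).
have mq := continuous_measurable_fun (C1c_continuous cq).
have mp' := continuous_measurable_fun cp'.
have mq' := continuous_measurable_fun cq'.
have [M M0 pM] := C1c_bound N0 cp; have [K K0 qK] := C1c_bound N0 cq.
have mk := @measurable_kap R.
pose F c (x : R * R) := kreg1 c (x.1 - a.1, x.2 - a.2) * (p' x.1 * q x.2) +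
                 kreg2 c (x.1 - a.1, x.2 - a.2) * (p x.1 * q' x.2).
pose box (x : R * R) : R := if (`|x.1| <= N) && (`|x.2| <= N) then 1 else 0.
pose G (x : R * R) := (2 * (M * K)) * (kap (x.1 - a.1, x.2 - a.2) * box x).
have mF c : measurable_fun setT (F c).
  by have [h1 h2] := measurable_kreg c; rewrite /F; mfun.
have mG : measurable_fun setT G by rewrite /G /box; mfun.
have FG c x : 0 <= c -> `|F c x| <= G x.
  move=> c0; have [k1 k2] := kreg_bound (x.1 - a.1, x.2 - a.2) c0.
  rewrite /F /G /box; case: ifPn => xN; last first.
    have -> : p' x.1 * q x.2 = 0.
      move: xN; rewrite negb_and -!ltNge => /orP[] /ltW.
        by move/pN => [_ ->]; rewrite mul0r.
      by move/qN => [-> _]; rewrite mulr0.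
    have -> : p x.1 * q' x.2 = 0.
      move: xN; rewrite negb_and -!ltNge => /orP[] /ltW.
        by move/pN => [-> _]; rewrite mul0r.
      by move/qN => [_ ->]; rewrite mulr0.
    by rewrite !mulr0 addr0 normr0.
  have [p1 p2] := pM x.1; have [q1 q2] := qK x.2.
  rewrite mulr1 (le_trans (ler_normD _ _))//.
  set k := kap _ in k1 k2 *.
  rewrite (_ : 2 * (M * K) * k = k * (M * K) + k * (M * K)); last by ring.
  have lepM (u v w U V W : R) : `|u| <= U -> `|v| <= V -> `|w| <= W ->
      `|u * (v * w)| <= U * (V * W).
    by move=> *; rewrite !normrM ler_pM ?mulr_ge0// ler_pM.
  by apply: lerD; exact: lepM.
have iG : (@lam2 R).-integrable setT (fun x => (G x)%:E).
  have G0 x : 0 <= G x by rewrite (le_trans (normr_ge0 _) (FG 0 x (lexx 0))).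
  apply/integrableP; split; first by mfun.
  rewrite (_ : (fun x => _) = (fun x => (G x)%:E)); last first.
    by apply/funext => x /=; rewrite ger0_norm.
  rewrite ge0_integralZlT; [|by rewrite /box; mfun| |by rewrite !mulr_ge0]; last first.
    by move=> x; rewrite mulr_ge0 ?kap_ge0// /box; case: ifP.
  by apply: lte_mul_pinfty; rewrite ?lee_fin ?mulr_ge0//; exact: kap_box_lty.
have cF x : F n.+1%:R^-1 x @[n --> \oo] --> F 0 x.
  (* Away from the origin the denominators converge to a nonzero limit; at the origin the numerators
     vanish and the sequence is constantly 0. *)
  have kk (w : R * R) (b : R) : b / (2 * pi * (w.1 ^+ 2 + w.2 ^+ 2 + n.+1%:R^-1)) @[n --> \oo]
      --> b / (2 * pi * (w.1 ^+ 2 + w.2 ^+ 2 + 0)) \/ w = 0.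
    have [->|w0] := eqVneq w 0; [by right|left].
    apply: cvgM; first exact: cvg_cst.
    apply: cvgV.
      rewrite addr0 !mulf_neq0 ?gt_eqF ?pi_gt0//.
      rewrite lt_neqAle eq_sym paddr_eq0 ?sqr_ge0// !sqrf_eq0 addr_ge0 ?sqr_ge0// andbT.
      apply: contra w0 => /andP[/eqP h1 /eqP h2].
      by rewrite (surjective_pairing w) h1 h2.
    apply: cvgM; first exact: cvg_cst.
    apply: cvgD; first exact: cvg_cst.
    exact: cvg_harmonic.
  rewrite /F; apply: cvgD; apply: cvgM; try exact: cvg_cst.
  - rewrite /kreg1; have [//|->] := kk (x.1 - a.1, x.2 - a.2) (- (x.2 - a.2)).
    by under eq_fun do rewrite oppr0 mul0r; rewrite oppr0 mul0r; exact: cvg_cst.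
  - rewrite /kreg2; have [//|->] := kk (x.1 - a.1, x.2 - a.2) (x.1 - a.1).
    by under eq_fun do rewrite mul0r; rewrite mul0r; exact: cvg_cst.
have mFE c : measurable_fun setT (fun x => (F c x)%:E) by have h := mF c; mfun.
have cFE : {ae @lam2 R, forall x, setT x -> (F n.+1%:R^-1 x)%:E @[n --> \oo] --> (F 0 x)%:E}.
  by apply: aeW => x _; apply: cvg_EFin; [exact: nearW|exact: cF].
have FGE : {ae @lam2 R, forall x (n : nat), setT x -> (`|(F n.+1%:R^-1 x)%:E| <= (G x)%:E)%E}.
  by apply: aeW => x n _; rewrite lee_fin; apply: FG.
have [_ _] := dominated_convergence measurableT (fun n => mFE n.+1%:R^-1) (mFE 0) cFE iG FGE.
have [<- <-] := kreg0; rewrite -/(F 0).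
rewrite (_ : (fun n : nat => _) = (fun=> 0%E)); last first.
  by apply/funext => n; exact: (kreg_divfree a _ N0 cp cq).
by move=> h; apply/esym; apply: (cvg_unique _ (cvg_cst 0%E) h).
Qed.

End divfree.

(** * Weak derivatives in time *)

Section time.
Context {R : realType}.
Implicit Types (f g h : R -> R).

Lemma itg_bdd d (X : measurableType d) (m : {measure set X -> \bar R}) (f g : X -> R) (C : R) :
  itg m f -> measurable_fun setT g -> (forall s, `|g s| <= C) -> itg m (fun s => g s * f s).
Proof.
move=> hf mg gC; have mf := itg_measurable hf.
apply: (itg_dom _ (itgZ C (itg_norm hf))); first by mfun.
by move=> s; rewrite normrM ler_wpM2r.
Qed.

Lemma Rint_lebesgue (A : set R) f : measurable A -> measurable_fun setT f ->
  \int[@lebesgue_measure R]_(t in A) f t = \int[lam1]_t (\1_A t * f t).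
Proof.
move=> mA mf; rewrite Rintegral_mkcond /Rintegral; congr fine.
rewrite -integral_lam1//; last first.
  apply/measurable_EFinP; apply/(measurable_restrictT _ _).1 => //.
  exact: measurable_funTS.
apply: eq_integral => t _; rewrite patchE indicE; case: ifP => _.
  by rewrite mul1r.
by rewrite mul0r.
Qed.

Lemma itg_lebesgue f (A : set R) : measurable A -> itg lam1 f ->
  (@lebesgue_measure R).-integrable A (EFin \o f).
Proof.
move=> mA hf; have mf := itg_measurable hf.
apply: (@integrableS _ _ _ _ setT) => //.
apply/integrableP; split; first by apply/measurable_EFinP; exact: mf.
have /integrableP[_] := hf; rewrite integral_lam1//.
by have mf' := measurable_EFinP; apply/measurable_EFinP; mfun.
Qed.

(** By Lebesgue differentiation f is almost everywhere the derivative of its primitive, which is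
    locally constant below T. *)
Lemma ae_eq0_primitive f (T : R) : itg lam1 f ->
  (forall x, x < T -> \int[lam1]_t ((if t <= x then 1 else 0) * f t) = 0) ->
  {ae lam1, forall t, t < T -> f t = 0}.
Proof.
move=> hf f0; have mf := itg_measurable hf.
have locf : locally_integrable [set: R] f.
  have := integrable_locally measurableT (itg_lebesgue measurableT hf).
  by rewrite patch_setT.
have intf y : (@lebesgue_measure R).-integrable `]-oo, y] (EFin \o f).
  by apply: itg_lebesgue.
have := FTC1Ny intf locf; set F := fun x : R => _ => -[N [mN N0 hN]].
exists N; split => // x /= hx; apply: hN => /= hd; apply: hx => xT.
have [_ <-] := hd.
have F0 y : y < T -> F y = 0.
  move=> yT; rewrite /F Rint_lebesgue//.
  rewrite -[RHS](f0 y yT); apply: eq_Rintegral => t _; congr (_ * _).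
  by rewrite indicE mem_setE in_itv/=; case: (_ <= _).
rewrite derive1E.
have d0 : is_derive x 1 (fun _ : R => 0 : R) 0 by exact: is_derive_cst.
have : is_derive x 1 F 0.
  apply: near_eq_is_derive d0; near=> y; rewrite F0//; near: y; exact: lt_nbhsl.
by move=> hF; rewrite derive_val.
Unshelve. all: by end_near. Qed.

(** This converts the weight [ramp ^+ 3] carried by the time derivative into the weight
    [3 * ramp ^+ 2] carried by its primitive. *)
Lemma integral_cube (a s : R) :
  \int[lam1]_t (3 * ramp (a - t) ^+ 2 * (if s < t then 1 else 0)) = ramp (a - s) ^+ 3.
Proof.
have mr : measurable_fun setT (@ramp R) by exact: continuous_measurable_fun (@ramp_continuous R).
have [sa|sa] := ltP s a; last first.
  rewrite ramp_neg ?subr_le0// expr0n -[RHS](Rint0 lam1).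
  apply: eq_Rintegral => t _; case: ifPn => [st|_]; last by rewrite mulr0.
  by rewrite ramp_neg ?subr_le0 ?(le_trans sa (ltW st))// expr0n mulr0 mul0r.
have -> : ramp (a - s) ^+ 3 = \int[@lebesgue_measure R]_(t in `[s, a]) (3 * (a - t) ^+ 2).
  have dF (x : R) : is_derive x 1 (fun t => - (a - t) ^+ 3) (3 * (a - x) ^+ 2).
    have d1 : is_derive x 1 (fun t : R => a - t) (-1).
      by have := is_deriveB (is_derive_cst a x (1 : R)) (is_derive_id x (1 : R)); rewrite sub0r.
    have d3 := @is_deriveX _ _ (fun t : R => a - t) 3 x 1 (-1) d1.
    have d4 := is_deriveN d3.
    rewrite (_ : (fun t => _) = - (fun t : R => a - t) ^+ 3); last first.
      by apply/funext => t; rewrite exprfctE.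
    by apply: is_derive_eq; rewrite /GRing.scale/=; ring.
  have cF : continuous (fun t : R => - (a - t) ^+ 3).
    by move=> x; apply/differentiable_continuous/derivable1_diffP; exact: ex_derive.
  rewrite /Rintegral (@continuous_FTC2 _ _ (fun t => - (a - t) ^+ 3) _ _ sa).
  - by rewrite -EFinB/= subrr expr0n oppr0 sub0r opprK ramp_pos// subr_ge0 ltW.
  - apply: continuous_subspaceT => x; apply: cvgM; first exact: cvg_cst.
    apply: (@continuous_comp _ _ _ (fun t : R => a - t) (fun r => r ^+ 2)); last exact: exprn_continuous.
    by apply: cvgB; [exact: cvg_cst|exact: cvg_id].
  - split; first by move=> x _; exact: ex_derive.
      by apply: cvg_at_right_filter; exact: cF.
    by apply: cvg_at_left_filter; exact: cF.
  - by move=> x _; rewrite derive1E; exact: derive_val.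
rewrite Rint_lebesgue//; last by mfun.
rewrite /Rintegral; congr fine; apply: ae_eq_integral => //.
- by mfun; apply: (measurable_fun_ltr (f := fun=> s) (g := fun x => x)); mfun.
- apply/measurable_EFinP; apply: measurable_funM; last by mfun.
  exact: measurable_indic.
(* The closed interval [s, a] and the strict condition s < t differ in the point s only. *)
exists [set s]; split => //; first exact: lebesgue_measure_set1.
move=> t /= ht; apply: contrapT => ts; apply: ht => _; congr EFin.
rewrite indicE mem_setE in_itv/=.
have [ta|ta] := leP t a; last first.
  by rewrite andbF mul0r ramp_neg ?subr_le0 ?ltW// expr0n mulr0 mul0r.
rewrite andbT ramp_pos ?subr_ge0// mulrC; congr (_ * _).
have -> : (s < t) = (s <= t) by rewrite lt_neqAle; case: eqP => // st; case: ts.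
by case: (_ <= _).
Qed.

(* Second difference quotients of [ramp ^+ 2] converge to the Heaviside function. *)
Definition step_approx (d x : R) : R :=
  (ramp (x + 2 * d) ^+ 2 - 2 * ramp (x + d) ^+ 2 + ramp x ^+ 2) / (2 * d ^+ 2).

Lemma step_approx_pos d x : 0 < d -> 0 <= x -> step_approx d x = 1.
Proof.
move=> d0 x0; rewrite /step_approx !ramp_pos//; try lra.
by field; rewrite gt_eqF.
Qed.

Lemma step_approx_neg d x : 0 < d -> x <= - (2 * d) -> step_approx d x = 0.
Proof. by move=> d0 xd; rewrite /step_approx !ramp_neg; try lra. Qed.

Lemma step_approx_bound d x : 0 < d -> `|step_approx d x| <= 3.
Proof.
move=> d0; have [x0|x0] := leP 0 x.
  by rewrite step_approx_pos// normr1; lra.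
rewrite /step_approx (ramp_neg (ltW x0)) expr0n addr0 normrM normfV.
have d2 : 0 < d ^+ 2 by rewrite exprn_gt0.
rewrite [`|2 * _|]gtr0_norm; last by lra.
rewrite ler_pdivrMr; last by lra.
have h (c : R) : 0 <= c -> x + c <= c -> 0 <= ramp (x + c) ^+ 2 <= c ^+ 2.
  move=> c0 xc; rewrite sqr_ge0/= lerXn2r ?nnegrE ?ramp_ge0//.
  by rewrite ge_max c0.
have /andP[h1 h2] : 0 <= ramp (x + 2 * d) ^+ 2 <= (2 * d) ^+ 2 by apply: h; lra.
have /andP[h3 h4] : 0 <= ramp (x + d) ^+ 2 <= d ^+ 2 by apply: h; lra.
have e4 : (2 * d) ^+ 2 = 4 * d ^+ 2 by ring.
rewrite e4 in h2; rewrite ler_norml; apply/andP; split; lra.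
Qed.

(** Combining the hypothesis at a, a + d and a + 2 d gives the integral of f against
    [step_approx d], which tends to the integral of f up to a. *)
Lemma ramp2_zero f (T : R) : itg lam1 f -> (forall s, f s != 0 -> 0 < s < T) ->
  (forall a, a < T -> \int[lam1]_t (ramp (a - t) ^+ 2 * f t) = 0) ->
  {ae lam1, forall t, t < T -> f t = 0}.
Proof.
move=> hf fT h0; apply: ae_eq0_primitive => // a aT; have mf := itg_measurable hf.
have mr : measurable_fun setT (@ramp R) by exact: continuous_measurable_fun (@ramp_continuous R).
(* A step of at most (T - a) / 4 keeps a + 2 d below T, where the hypothesis is available. *)
pose d n : R := (T - a) / 4 / n.+1%:R.
have d0 n : 0 < d n by rewrite !divr_gt0 ?subr_gt0.
have dT n : a + 2 * d n < T.
  have : d n <= (T - a) / 4.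
    by rewrite ler_pdivrMr// ler_peMr ?ler1n// divr_ge0// subr_ge0 ltW.
  by move: aT; set t := d n; lra.
pose F n t := step_approx (d n) (a - t) * f t.
have mF n : measurable_fun setT (F n) by rewrite /F /step_approx; mfun.
have FG n t : `|F n t| <= 3 * `|f t|.
  by rewrite normrM ler_wpM2r// step_approx_bound.
have ir c : c < T -> itg lam1 (fun t => ramp (c - t) ^+ 2 * f t).
  move=> cT; apply: (itg_dom _ (itgZ (T ^+ 2) (itg_norm hf))); first by mfun.
  move=> t; rewrite normrM; have [->|/fT/andP[t0 tT]] := eqVneq (f t) 0.
    by rewrite normr0 !mulr0.
  rewrite ler_wpM2r// ger0_norm ?sqr_ge0//.
  have T0 : 0 <= T by rewrite ltW// (lt_trans t0).
  by rewrite lerXn2r ?nnegrE ?ramp_ge0// ge_max T0/=; lra.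
have F0 n : \int[lam1]_t F n t = 0.
  have aT1 : a + d n < T by have := dT n; have := d0 n; lra.
  have i1 := ir _ (dT n); have i2 := ir _ aT1; have i3 := ir _ aT.
  have E : F n = (fun t => (2 * d n ^+ 2)^-1 * ((ramp (a + 2 * d n - t) ^+ 2 * f t -
     2 * (ramp (a + d n - t) ^+ 2 * f t)) + ramp (a - t) ^+ 2 * f t)).
    apply/funext => t; rewrite /F /step_approx.
    rewrite (_ : a - t + 2 * d n = a + 2 * d n - t); last by ring.
    rewrite (_ : a - t + d n = a + d n - t); last by ring.
    ring.
  have i2' := itgZ 2 i2; have i12 := itgB i1 i2'; have i123 := itgD i12 i3.
  rewrite E (RintZ _ i123) (RintD i12 i3) (RintB i1 i2') (RintZ _ i2).
  by rewrite (h0 _ (dT n)) (h0 _ aT1) (h0 _ aT) mulr0 subr0 addr0 mulr0.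
have cF t : F n t @[n --> \oo] --> (if t <= a then 1 else 0) * f t.
  apply: cvgMl; case: ifPn => ta.
    rewrite (_ : (fun n => _) = (fun=> 1)); first exact: cvg_cst.
    by apply/funext => n; rewrite step_approx_pos// subr_ge0.
  rewrite -ltNge in ta.
  have at0 : 0 < (t - a) / 2 by rewrite divr_gt0// subr_gt0.
  have cd : d n @[n --> \oo] --> (0 : R).
    rewrite -(mulr0 ((T - a) / 4)); apply: cvgM; first exact: cvg_cst.
    exact: cvg_harmonic.
  apply: cvg_near_cst; move/cvgrPdist_le: cd => /(_ _ at0); apply: filterS => n.
  rewrite sub0r normrN gtr0_norm// => hn; apply/eqP; rewrite step_approx_neg//; lra.
have mFE n : measurable_fun setT (fun t => (F n t)%:E) by have h := mF n; mfun.
have mFl : measurable_fun setT (fun t : R => ((if t <= a then 1 else 0) * f t)%:E).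
  by mfun.
have cFE : {ae lam1, forall t, setT t -> (F n t)%:E @[n --> \oo] --> ((if t <= a then 1 else 0) * f t)%:E}.
  by apply: aeW => t _; apply: cvg_EFin; [exact: nearW|exact: cF].
have FGE : {ae lam1, forall t (n : nat), setT t -> (`|(F n t)%:E| <= (3 * `|f t|)%:E)%E}.
  by apply: aeW => t n _; rewrite lee_fin.
have [_ _] := dominated_convergence measurableT mFE mFl cFE (itgZ 3 (itg_norm hf)) FGE.
rewrite (_ : (fun n => _) = (fun=> 0%E)); last first.
  apply/funext => n; rewrite RintE ?F0//.
  by apply: (itg_dom (mF n) (itgZ 3 (itg_norm hf))).
by move=> hc; rewrite /Rintegral -(cvg_unique _ (cvg_cst 0%E) hc).
Qed.

Definition primitive h (a : R) : R := \int[lam1]_s ((if s < a then 1 else 0) * h s).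

Lemma measurable_primitive h : measurable_fun setT h -> measurable_fun setT (primitive h).
Proof.
move=> mh; apply: (@measurable_Rint _ _ _ _ _ lam1 (fun a s => (if s < a then 1 else 0) * h s)).
by mfun.
Qed.

Lemma step01 (b : bool) : `|(if b then 1 else 0) : R| <= 1.
Proof. by case: b; rewrite ?normr1 ?normr0. Qed.

Lemma itg_step h (a : R) : itg lam1 h -> itg lam1 (fun s => (if s < a then 1 else 0) * h s).
Proof.
by move=> hh; apply: (itg_bdd (C := 1)) => // [|s]; [mfun|exact: step01].
Qed.

Lemma primitive_bound h : itg lam1 h ->
  forall a, `|primitive h a| <= \int[lam1]_s `|h s|.
Proof.
move=> hh a; apply: (le_trans (le_norm_Rint (itg_step a hh))).
apply: le_Rint; [by apply: itg_norm; exact: itg_step|exact: itg_norm|].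
by move=> s; rewrite normrM ler_piMl// step01.
Qed.

Lemma itg_itv01 (T : R) : 0 < T -> itg lam1 (fun t : R => if (0 < t) && (t < T) then 1 else 0 : R).
Proof.
move=> T0; have mi : measurable_fun setT (fun t : R => if (0 < t) && (t < T) then 1 else 0 : R).
  apply: measurable_fun_ifT; [apply: measurable_and|by mfun|by mfun].
    by apply: (measurable_fun_ltr (f := fun=> 0) (g := fun x => x)); mfun.
  by mfun.
apply: (itg_le (g := fun t : R => if `|t| <= T then 1 else 0)) => //; last exact: indic_int_lty.
- by mfun.
- move=> t; case: ifPn => [/andP[t0 tT]|_]; last by rewrite normr0; case: ifP.
  by rewrite normr1 gtr0_norm// (ltW tT).
Qed.

Lemma integral_time (T s : R) : 0 < s < T ->
  \int[lam1]_a ((if (0 < a) && (a < T) then 1 else 0) * (if s < a then 1 else 0)) = T - s.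
Proof.
move=> /andP[s0 sT].
transitivity (\int[lam1]_a (\1_(`]s, T[%classic) a : R)).
  apply: eq_Rintegral => a _; rewrite indicE mem_setE in_itv/=.
  case: (ltP s a) => sa; last by rewrite mulr0.
  by rewrite (lt_trans s0 sa) mulr1; case: (_ < _).
by rewrite /Rintegral integral_indic// setIT /= lam1_itv/= lte_fin sT.
Qed.

(** The square is a double integral over s, r < a; by symmetry it is twice the part r < s. This
    replaces a chain rule for absolutely continuous functions. *)
Lemma primitive_sqr h (a : R) : itg lam1 h ->
  primitive h a ^+ 2 = 2 * \int[lam1]_s ((if s < a then 1 else 0) * (h s * primitive h s)).
Proof.
move=> hh; have mh := itg_measurable hh.
pose k s r := (if s < a then 1 else 0) * h s * ((if r < s then 1 else 0) * h r).
have ik : itg2 lam1 lam1 k.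
  apply: (itg_dom _ (itg2_mul (itg_norm hh) (itg_norm hh))).
    by rewrite /k; mfun.
  move=> [s r]; rewrite /k /= !normrM; apply: ler_pM; rewrite ?mulr_ge0//.
    by rewrite ler_piMl// step01.
  by rewrite ler_piMl// step01.
have E1 : \int[lam1]_s ((if s < a then 1 else 0) * (h s * primitive h s)) =
    \int[lam1]_s \int[lam1]_r k s r.
  apply: eq_Rintegral => s _; rewrite mulrA /k.
  by rewrite (RintZ _ (itg_step s hh)).
have i1 := itg2_itg1 ik; have i2 := itg2_itg2 ik.
rewrite mulr_natl mulr2n E1 {2}(RFubini ik) -RintD//.
rewrite expr2 {1}/primitive mulrC -(RintZ _ (itg_step a hh)).
apply: eq_Rintegral => s _.
have ks1 : itg lam1 (k s) by apply: itgZ; exact: itg_step.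
have ks2 : itg lam1 (k^~ s).
  rewrite (_ : k^~ s = (fun r => ((if s < r then 1 else 0) * h s) * ((if r < a then 1 else 0) * h r))); last first.
    by apply/funext => r; rewrite /k; ring.
  apply: (itg_bdd (C := `|h s|)); [exact: itg_step| |].
    apply: measurable_funM; last by mfun.
    apply: measurable_fun_ifT; [|by mfun|by mfun].
    by apply: (measurable_fun_ltr (f := fun=> s) (g := fun x => x)); mfun.
  by move=> r; rewrite normrM ler_piMl// step01.
rewrite -RintD// mulrC /primitive -(RintZ _ (itg_step a hh)).
rewrite /Rintegral; congr fine; apply: ae_eq_integral => //.
- by have := itgZ ((if s < a then 1 else 0) * h s) (itg_step a hh) => /itg_measurable ?; mfun.
- by have := itgD ks1 ks2 => /itg_measurable ?; mfun.
(* The two triangles r < s and s < r miss only the diagonal. *)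
exists [set s]; split => //; first exact: lebesgue_measure_set1.
move=> r /= hr; apply: contrapT => rs; apply: hr => _; congr EFin.
rewrite /k; have [sr|rs'|/esym//] := ltgtP s r.
  by case: (ltP r a) => ra; [rewrite (lt_trans sr ra)|]; ring.
by case: (ltP s a) => sa; [rewrite (lt_trans rs' sa)|]; ring.
Qed.

(* The hypothesis says [W' = h] with [W = 0] for nonpositive times, so that
   [W a ^ 2] is twice the integral of [h W] up to [a]. *)
Lemma time_identity (T : R) (W h : R -> R) : 0 < T -> itg lam1 W -> itg lam1 h ->
  (forall s, W s != 0 -> 0 < s < T) -> (forall s, h s != 0 -> 0 < s < T) ->
  (forall a, a < T -> \int[lam1]_t (3 * ramp (a - t) ^+ 2 * W t) =
                      \int[lam1]_t (ramp (a - t) ^+ 3 * h t)) ->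
  [/\ itg lam1 (fun s => W s ^+ 2), itg lam1 (fun s => h s * W s) &
  \int[lam1]_s (W s ^+ 2) = 2 * \int[lam1]_s ((T - s) * (h s * W s))].
Proof.
move=> T0 hW hh WT hT0 weak.
have mW := itg_measurable hW; have mh := itg_measurable hh.
pose H := primitive h; have mH := measurable_primitive mh.
pose B := \int[lam1]_s `|h s|.
have HB : forall a, `|H a| <= B := primitive_bound hh.
pose I (t : R) : R := if (0 < t) && (t < T) then 1 else 0.
have hI : itg lam1 I by exact: itg_itv01.
have mI := itg_measurable hI.
have I01 t : `|I t| <= 1 by exact: step01.
have hIH : itg lam1 (fun t => H t * I t) by apply: (itg_bdd (C := B)).
have WI t : W t = W t * I t.
  have [->|/WT] := eqVneq (W t) 0; first by rewrite mul0r.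
  by rewrite /I => ->; rewrite mulr1.
have mr : measurable_fun setT (@ramp R) by exact: continuous_measurable_fun (@ramp_continuous R).
have rampT a t : a < T -> I t != 0 -> 0 <= ramp (a - t) <= T.
  move=> aT; rewrite /I ramp_ge0; case: ifP => [/andP[t0 tT] _|]; last by rewrite eqxx.
  by rewrite ge_max (ltW T0)/=; move: aT t0; clear; lra.
have ramp2I a : a < T -> forall t, `|ramp (a - t) ^+ 2 * I t| <= T ^+ 2.
  move=> aT t; have [->|It] := eqVneq (I t) 0; first by rewrite mulr0 normr0 sqr_ge0.
  have /andP[r0 rT] := rampT a t aT It.
  rewrite normrM -[leRHS]mulr1 ler_pM// ger0_norm ?sqr_ge0// lerXn2r ?nnegrE//.
  by rewrite ltW.
pose D t := W t - H t * I t.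
have hD : itg lam1 D by exact: itgB.
have ir2 a : a < T -> itg lam1 (fun t => ramp (a - t) ^+ 2 * I t).
  move=> aT; apply: (itg_dom _ (itgZ (T ^+ 2) hI)); first by mfun.
  move=> t; have [->|It] := eqVneq (I t) 0; first by rewrite !mulr0 normr0.
  have I1 : I t = 1 by move: It; rewrite /I; case: ifP => //; rewrite eqxx.
  by have := ramp2I a aT t; rewrite I1 !mulr1.
have D0 a : a < T -> \int[lam1]_t (ramp (a - t) ^+ 2 * D t) = 0.
  move=> aT.
  (* Expanding H and exchanging the integrals, three times the weight [ramp ^+ 2] integrated over t
     > s becomes [ramp (a - s) ^+ 3], the right-hand side of [weak]. *)
  pose k t s := (ramp (a - t) ^+ 2 * I t) * ((if s < t then 1 else 0) * h s).
  have ik : itg2 lam1 lam1 k.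
    apply: (itg_dom _ (itg2_mul (itg_norm (ir2 a aT)) (itg_norm hh))).
      by rewrite /k; mfun.
    move=> [t s]; rewrite /k /= normrM; apply: ler_wpM2l => //.
    by rewrite normrM ler_piMl// step01.
  have iW : itg lam1 (fun t => ramp (a - t) ^+ 2 * W t).
    have := itg_bdd hW (g := fun t : R => ramp (a - t) ^+ 2 * I t) _ (ramp2I a aT).
    have -> : (fun s : R => ramp (a - s) ^+ 2 * I s * W s) = (fun t : R => ramp (a - t) ^+ 2 * W t).
      by apply/funext => t; rewrite [in RHS]WI; ring.
    by apply; mfun.
  have iH : itg lam1 (fun t => ramp (a - t) ^+ 2 * (H t * I t)).
    have := itg_bdd (ir2 a aT) mH HB.
    by congr (itg _ _); apply/funext => t; rewrite -/H; ring.
  rewrite (_ : (fun t => ramp (a - t) ^+ 2 * D t) = (fun t => ramp (a - t) ^+ 2 * W t - ramp (a - t) ^+ 2 * (H t * I t))); last first.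
    by apply/funext => t; rewrite mulrBr.
  rewrite RintB//; apply/eqP; rewrite subr_eq0; apply/eqP.
  have EH : \int[lam1]_t (ramp (a - t) ^+ 2 * (H t * I t)) = \int[lam1]_t \int[lam1]_s k t s.
    apply: eq_Rintegral => t _; rewrite /k (RintZ _ (itg_step t hh)) -/(primitive h t) -/H.
    ring.
  have nz3 : (3 : R) != 0 by rewrite pnatr_eq0.
  apply: (mulfI nz3); rewrite -(RintZ _ iW).
  under eq_Rintegral do rewrite mulrA.
  rewrite weak// EH (RFubini ik) -(RintZ _ (itg2_itg2 ik)).
  apply: eq_Rintegral => s _.
  have [h0|hs] := eqVneq (h s) 0.
    rewrite h0 mulr0 (_ : \int[lam1]_x k x s = 0) ?mulr0// -[RHS](Rint0 lam1).
    by apply: eq_Rintegral => t _; rewrite /k h0 !mulr0.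
  have /andP[s0 sT] := hT0 s hs.
  rewrite -integral_cube mulrC.
  have ist : itg lam1 (fun t => ramp (a - t) ^+ 2 * I t * (if s < t then 1 else 0)).
    have := itg_bdd (ir2 a aT) (g := fun t : R => if s < t then 1 else 0) _ (fun t => step01 (s < t)).
    have -> : (fun t => (if s < t then 1 else 0) * (ramp (a - t) ^+ 2 * I t)) =
       (fun t => ramp (a - t) ^+ 2 * I t * (if s < t then 1 else 0)).
      by apply/funext => t; rewrite mulrC.
    apply; apply: measurable_fun_ifT; [|by mfun|by mfun].
    by apply: (measurable_fun_ltr (f := fun=> s) (g := fun x => x)); mfun.
  rewrite (_ : \int[lam1]_x k x s = h s * \int[lam1]_t (ramp (a - t) ^+ 2 * I t * (if s < t then 1 else 0))); last first.
    by rewrite -RintZ//; apply: eq_Rintegral => t _; rewrite /k mulrA [RHS]mulrC.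
  rewrite mulrCA; congr (_ * _); rewrite -RintZ//.
  apply: eq_Rintegral => t _; case: ifPn => [st|_]; last by rewrite !mulr0.
  rewrite !mulr1 mulrA; have [It|It] := eqVneq (I t) 1; first by rewrite It mulr1.
  (* For t > s > 0 the factor [I t] can differ from 1 only if t >= T > a, where the ramp is 0. *)
  have ta : a - t <= 0.
    move: It; rewrite /I (lt_trans s0 st)/=; case: ltP; first by rewrite eqxx.
    by move=> Tt _; rewrite subr_le0 (le_trans (ltW aT)).
  by rewrite ramp_neg// expr0n /= !mulr0 mul0r.
have DT s : D s != 0 -> 0 < s < T.
  by rewrite /D WI -mulrBl /I; case: ifP => //; rewrite mulr0 eqxx.
have aeD : {ae lam1, forall t, W t = H t * I t}.
  have := ramp2_zero hD DT D0; apply: filterS => t ht.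
  have [D0t|Dt] := eqVneq (D t) 0; first by apply/eqP; rewrite -subr_eq0; apply/eqP.
  by have /andP[_ tT] := DT t Dt; move/eqP: Dt; rewrite ht.
have hH2 : itg lam1 (fun t => (H t * I t) ^+ 2).
  have := itg_bdd hIH mH HB; congr (itg _ _); apply/funext => t; rewrite -/H.
  by rewrite /I; case: ifP => _; rewrite ?mulr1 ?mulr0 ?expr2 ?mulr0.
have hhH : itg lam1 (fun t => h t * (H t * I t)).
  have := itg_bdd (C := B) hh (g := fun t : R => H t * I t).
  have -> : (fun s => H s * I s * h s) = (fun t => h t * (H t * I t)).
    by apply/funext => t; ring.
  apply; first by mfun.
  by move=> t; rewrite normrM -[leRHS]mulr1 ler_pM.
have aeitg (f g : R -> R) : measurable_fun setT f -> itg lam1 g -> {ae lam1, forall t, f t = g t} ->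
    itg lam1 f /\ \int[lam1]_t f t = \int[lam1]_t g t.
  move=> mf hg fg; have mg := itg_measurable hg.
  have E (u : R -> R) : measurable_fun setT u -> {ae lam1, forall t, u t = u t} -> True by [].
  split.
    apply: itgP => //; rewrite (_ : (\int[lam1]_x _)%E = \int[lam1]_x `|g x|%:E)%E; first exact: itg_lty.
    apply: ae_eq_integral => //; [by mfun|by mfun|].
    by apply: filterS fg => t -> _.
  rewrite /Rintegral; congr fine; apply: ae_eq_integral => //; [by mfun|by mfun|].
  by apply: filterS fg => t -> _.
have [i1 E1] : itg lam1 (fun s => W s ^+ 2) /\
   \int[lam1]_s (W s ^+ 2) = \int[lam1]_s ((H s * I s) ^+ 2).
  by apply: aeitg => //; [by mfun|by apply: filterS aeD => t ->].
have [i2 E2] : itg lam1 (fun s => h s * W s) /\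
   \int[lam1]_s (h s * W s) = \int[lam1]_s (h s * (H s * I s)).
  by apply: aeitg => //; [by mfun|by apply: filterS aeD => t ->].
have hTh (f : R -> R) : itg lam1 (fun s => h s * f s) -> itg lam1 (fun s => (T - s) * (h s * f s)).
  move=> hf; apply: (itg_dom _ (itgZ T (itg_norm hf))).
    by have mf := itg_measurable hf; apply: measurable_funM => //; mfun.
  move=> s; have [->|/hT0/andP[s0 sT]] := eqVneq (h s) 0; first by rewrite !mul0r normr0 !mulr0 normr0.
  by rewrite normrM ler_wpM2r// ger0_norm ?subr_ge0 ?ltW// gtrBl.
have [_ E3] : itg lam1 (fun s => (T - s) * (h s * W s)) /\
   \int[lam1]_s ((T - s) * (h s * W s)) = \int[lam1]_s ((T - s) * (h s * (H s * I s))).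
  apply: aeitg => //; [by mfun|exact: (hTh (fun s => H s * I s))|].
  by apply: filterS aeD => t ->.
split => //; rewrite E1 E3.
(* [primitive_sqr] is integrated over 0 < a < T; exchanging the integrals, s < a < T contributes the
   weight T - s. *)
pose k a s := I a * (if s < a then 1 else 0) * (h s * (H s * I s)).
have ik : itg2 lam1 lam1 k.
  apply: (itg_dom _ (itg2_mul (itg_norm hI) (itg_norm hhH))).
    by rewrite /k; mfun.
  by move=> [a s]; rewrite /k /= normrM ler_wpM2r// normrM ler_piMr// step01.
transitivity (2 * \int[lam1]_a \int[lam1]_s k a s).
  rewrite -(RintZ _ (itg2_itg1 ik)); apply: eq_Rintegral => a _.
  rewrite exprMn (_ : I a ^+ 2 = I a); last by rewrite /I; case: ifP; rewrite ?expr1n ?expr0n.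
  rewrite (primitive_sqr a hh) mulrAC -mulrA; congr (_ * _).
  have := itg_step a (hhH : itg lam1 (fun t => h t * (H t * I t))).
  move=> /(RintZ (I a)) E; rewrite -/H in E *.
  transitivity (I a * \int[lam1]_s ((if s < a then 1 else 0) * (h s * (H s * I s)))).
    congr (_ * _); apply: eq_Rintegral => s _; congr (_ * _).
    by have [->|/hT0] := eqVneq (h s) 0; rewrite ?mul0r// /I => ->; rewrite mulr1.
  by rewrite -E; apply: eq_Rintegral => s _; rewrite /k mulrA.
congr (_ * _); rewrite (RFubini ik); apply: eq_Rintegral => s _.
have [h0|hs] := eqVneq (h s) 0.
  rewrite h0 mul0r mulr0 -[RHS](Rint0 lam1).
  by apply: eq_Rintegral => t _; rewrite /k h0 mul0r mulr0.
rewrite -(integral_time (hT0 s hs)) mulrC.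
have iIs : itg lam1 (fun a => I a * (if s < a then 1 else 0)).
  apply: (itg_dom _ (itg_norm hI)); last by move=> a; rewrite normrM ler_piMr// step01.
  apply: measurable_funM; first by mfun.
  apply: measurable_fun_ifT; [|by mfun|by mfun].
  by apply: (measurable_fun_ltr (f := fun=> s) (g := fun x => x)); mfun.
by rewrite -(RintZ _ iIs); apply: eq_Rintegral => a _; rewrite /k mulrC.
Qed.

End time.

(** Measure for the pair (y, z) of integration variables of two convolutions, again copied to a
    canonical structure with a sigma-finite instance. *)
Definition lam4 (R : realType) (A : set ((R * R) * (R * R))%type) : \bar R :=
  (@lam2 R \x @lam2 R)%E A.

Section lam4_measure.
Variable R : realType.
Notation lam4 := (@lam4 R).

Let lam40 : lam4 set0 = 0%E.
Proof. exact: (@measure0 _ _ _ (@lam2 R \x @lam2 R)%E). Qed.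
Let lam4_ge0 A : (0 <= lam4 A)%E.
Proof. exact: (@measure_ge0 _ _ _ (@lam2 R \x @lam2 R)%E). Qed.
Let lam4_sigma_additive : semi_sigma_additive lam4.
Proof. exact: (@measure_semi_sigma_additive _ _ _ (@lam2 R \x @lam2 R)%E). Qed.

HB.instance Definition _ := isMeasure.Build _ _ _ lam4
  lam40 lam4_ge0 lam4_sigma_additive.

Let lam4_sigma_finite : sigma_finite setT lam4.
Proof. exact: sigma_finite_prod. Qed.

HB.instance Definition _ := @Measure_isSigmaFinite.Build _ _ _ lam4 lam4_sigma_finite.

End lam4_measure.
Arguments lam4 {R}.

(** * The energy inequality at a fixed time *)

Section kernels.
Context {R : realType}.
Implicit Types (f g b : R * R -> R) (al be : R * R -> R) (x y z : R * R) (e M : R).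

Definition box2 e x : R := if (`|x.1| <= e) && (`|x.2| <= e) then 1 else 0.

Lemma box2_ge0 e x : 0 <= box2 e x. Proof. by rewrite /box2; case: ifP. Qed.

Lemma measurable_box2 e : measurable_fun setT (box2 e).
Proof. by rewrite /box2; mfun. Qed.

Lemma integral_box2 e : 0 <= e -> (\int[lam2]_x (box2 e x)%:E = (4 * e ^+ 2)%:E :> \bar R)%E.
Proof. exact: integral_box_norm. Qed.

Definition kern e M al := measurable_fun setT al /\ forall x, `|al x| <= M * box2 e x.

Local Notation dif y x := ((y : R * R).1 - (x : R * R).1, (y : R * R).2 - (x : R * R).2).

(** The kernel is evaluated at y - x, as for a test function centred at x. Hence differentiating the
    convolution in x once puts a minus sign in front of the differentiated kernel. *)
Definition conv f al x : R := \int[lam2]_y (f y * al (dif y x)).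

Lemma integral_box2_dif e x : 0 <= e ->
  (\int[lam2]_y (box2 e (dif y x))%:E = (4 * e ^+ 2)%:E :> \bar R)%E.
Proof.
move=> e0; have mb := measurable_box2 e.
by rewrite (ge0_integral_shift2 (- x.1) (- x.2) mb (box2_ge0 e)) integral_box2.
Qed.

Lemma integral_box2_difr e y : 0 <= e ->
  (\int[lam2]_x (box2 e (dif y x))%:E = (4 * e ^+ 2)%:E :> \bar R)%E.
Proof.
move=> e0; have mb := measurable_box2 e.
by rewrite (ge0_integral_sub2 y.1 y.2 mb (box2_ge0 e)) integral_box2.
Qed.

Lemma itg_kern e M al f x : 0 <= e -> kern e M al -> 0 <= M ->
  measurable_fun setT f -> (\int[lam2]_y (f y ^+ 2)%:E < +oo)%E ->
  itg lam2 (fun y => f y * al (dif y x)).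
Proof.
move=> e0 [mal alM] M0 mf f2; have mb := measurable_box2 e.
apply: (@itg_le _ _ _ _ _ (fun y => M * (f y ^+ 2) + M * box2 e (dif y x))).
- by mfun.
- by mfun.
- move=> y; have h := alM (dif y x); rewrite normrM.
  have b0 := box2_ge0 e (dif y x).
  have b1 : box2 e (dif y x) <= 1 by rewrite /box2; case: ifP.
  apply: (le_trans (ler_wpM2l (normr_ge0 _) h)).
  rewrite mulrCA -mulrDr ler_wpM2l//.
  rewrite -[f y ^+ 2]real_normK ?num_real//; have := normr_ge0 (f y).
  by move: (box2 _ _) b0 b1 => b b0 b1; move: `|f y| => a a0; nra.
- rewrite ge0_integralDT; [|by mfun|by mfun|by move=> y; rewrite mulr_ge0 ?sqr_ge0|by move=> y; rewrite mulr_ge0 ?box2_ge0].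
  rewrite !ge0_integralZlT//; [|by mfun|by move=> y; rewrite box2_ge0|by mfun|by move=> y; rewrite sqr_ge0].
  rewrite integral_box2_dif//; apply: lte_add_pinfty; last by rewrite -EFinM ltry.
  by apply: lte_mul_pinfty.
Qed.

(** Integrand in u = (y, z) of b(x) times the convolutions of f and g at x. *)
Definition trif b f g al be x (u : (R * R) * (R * R)) : R :=
  b x * (f u.1 * al (dif u.1 x)) * (g u.2 * be (dif u.2 x)).

Lemma measurable_trif e M b f g al be : kern e M al -> kern e M be ->
  measurable_fun setT b -> measurable_fun setT f -> measurable_fun setT g ->
  measurable_fun setT (fun v => trif b f g al be v.1 v.2).
Proof. by move=> [mal _] [mbe _] mb mf mg; rewrite /trif; mfun. Qed.

(** The majorant is additive, so each summand depends on one variable; the two others range over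
    windows of area 4 e^2 around it. *)
Lemma tri_bound e M b f g al be (P Q S : R * R -> R) :
  0 <= e -> 0 <= M -> kern e M al -> kern e M be ->
  measurable_fun setT b -> measurable_fun setT f -> measurable_fun setT g ->
  measurable_fun setT P -> measurable_fun setT Q -> measurable_fun setT S ->
  (forall x, 0 <= P x) -> (forall x, 0 <= Q x) -> (forall x, 0 <= S x) ->
  (forall x y z, `|b x * f y * g z| <= P x + Q y + S z) ->
  (\int[lam2]_x \int[lam4]_u `|trif b f g al be x u|%:E <=
   (M ^+ 2 * (4 * e ^+ 2) ^+ 2)%:E * (\int[lam2]_x (P x)%:E + \int[lam2]_x (Q x)%:E
     + \int[lam2]_x (S x)%:E))%E.
Proof.
move=> e0 M0 [mal alM] [mbe beM] mb mf mg mP mQ mS P0 Q0 S0 bfg.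
have mbx := measurable_box2 e.
pose c := 4 * e ^+ 2; have c0 : 0 <= c by rewrite mulr_ge0 ?sqr_ge0.
have bx0 := box2_ge0 e.
have ibox : (\int[lam2]_y (box2 e y)%:E = c%:E)%E by exact: integral_box2.
have iboxd x : (\int[lam2]_y (box2 e (dif y x))%:E = c%:E)%E by exact: integral_box2_dif.
have iboxr y : (\int[lam2]_x (box2 e (dif y x))%:E = c%:E)%E by exact: integral_box2_difr.
pose B x (u : (R * R) * (R * R)) := box2 e (dif u.1 x) * box2 e (dif u.2 x).
have B0 x u : 0 <= B x u by rewrite mulr_ge0.
have mB x : measurable_fun setT (B x) by rewrite /B; mfun.
have iQ (Q1 : R * R -> R) x : measurable_fun setT Q1 -> (forall x, 0 <= Q1 x) ->
    (\int[lam4]_u (Q1 u.1 * B x u)%:E = c%:E * \int[lam2]_y (Q1 y * box2 e (dif y x))%:E)%E.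
  move=> mQ1 Q10; rewrite muleC -(iboxd x).
  rewrite -(ge0_integral_mul lam2 lam2 (f := fun y => Q1 y * box2 e (dif y x))
    (g := fun z => box2 e (dif z x))); [|by mfun|by mfun|by move=> y; rewrite mulr_ge0|by []].
  by apply: eq_integral => u _; rewrite mulrA.
have iS (Q1 : R * R -> R) x : measurable_fun setT Q1 -> (forall x, 0 <= Q1 x) ->
    (\int[lam4]_u (Q1 u.2 * B x u)%:E = c%:E * \int[lam2]_y (Q1 y * box2 e (dif y x))%:E)%E.
  move=> mQ1 Q10; rewrite -(iboxd x).
  rewrite -(ge0_integral_mul lam2 lam2 (g := fun y => Q1 y * box2 e (dif y x))
    (f := fun z => box2 e (dif z x))); [|by mfun|by mfun|by []|by move=> y; rewrite mulr_ge0].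
  by apply: eq_integral => u _; rewrite mulrCA.
have iQQ (Q1 : R * R -> R) : measurable_fun setT Q1 -> (forall x, 0 <= Q1 x) ->
    (\int[lam2]_x (c%:E * \int[lam2]_y (Q1 y * box2 e (dif y x))%:E) =
     (c ^+ 2)%:E * \int[lam2]_y (Q1 y)%:E)%E.
  move=> mQ1 Q10.
  have h1 : measurable_fun setT (fun z : (R * R) * (R * R) => Q1 z.2 * box2 e (dif z.2 z.1)) by mfun.
  have h0 x y : 0 <= Q1 y * box2 e (dif y x) by rewrite mulr_ge0.
  rewrite ge0_integralZl//; last 2 first.
  - exact: (measurable_tonelliF lam2 h1 h0).
  - by move=> x _; apply: integral_ge0 => y _; rewrite lee_fin.
  rewrite (tonelli lam2 lam2 h1 h0).
  transitivity (c%:E * \int[lam2]_y (c * Q1 y)%:E)%E.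
    congr (_ * _)%E; apply: eq_integral => y _.
    by rewrite ge0_integralZlT//; [rewrite iboxr -EFinM mulrC|mfun].
  by rewrite ge0_integralZlT// muleA -EFinM.
have mP1 : measurable_fun setT (fun v : (R * R) * ((R * R) * (R * R)) => M ^+ 2 * ((P v.1 + Q v.2.1 + S v.2.2) * B v.1 v.2)).
  by rewrite /B; mfun.
have P10 x u : 0 <= M ^+ 2 * ((P x + Q u.1 + S u.2) * B x u).
  by rewrite mulr_ge0 ?sqr_ge0// mulr_ge0// !addr_ge0.
have mT : measurable_fun setT (fun v : (R * R) * ((R * R) * (R * R)) => `|trif b f g al be v.1 v.2|).
  by rewrite /trif; mfun.
have mTx x : measurable_fun setT (fun u : (R * R) * (R * R) => `|trif b f g al be x u|).
  by rewrite /trif; mfun.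
apply: (@le_trans _ _ (\int[lam2]_x \int[lam4]_u (M ^+ 2 * ((P x + Q u.1 + S u.2) * B x u))%:E)%E).
  apply: ge0_le_integral => //.
  - by move=> x _; apply: integral_ge0 => u _; rewrite lee_fin.
  - exact: (measurable_tonelliF lam4 mT (fun _ _ => normr_ge0 _)).
  - exact: (measurable_tonelliF lam4 mP1 P10).
  - move=> x _; apply: le_ge0_integralT => //.
      by have h := mB x; mfun.
    move=> u; rewrite /trif.
    rewrite (_ : b x * _ * _ = (b x * f u.1 * g u.2) * (al (dif u.1 x) * be (dif u.2 x))); last by ring.
    rewrite (_ : M ^+ 2 * _ = (P x + Q u.1 + S u.2) *
      ((M * box2 e (dif u.1 x)) * (M * box2 e (dif u.2 x)))); last by rewrite /B; ring.
    by rewrite normrM; apply: ler_pM => //; rewrite normrM; apply: ler_pM.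
have E x : (\int[lam4]_u (M ^+ 2 * ((P x + Q u.1 + S u.2) * B x u))%:E =
   (M ^+ 2)%:E * (c%:E * (c * P x)%:E + c%:E * \int[lam2]_y (Q y * box2 e (dif y x))%:E +
     c%:E * \int[lam2]_y (S y * box2 e (dif y x))%:E))%E.
  have h := mB x.
  rewrite ge0_integralZlT; [|by mfun|by move=> u; rewrite mulr_ge0 ?addr_ge0|exact: sqr_ge0].
  congr (_ * _)%E; rewrite -iQ// -iS//.
  have -> : (c%:E * (c * P x)%:E)%E = (\int[lam4]_u (P x * B x u)%:E)%E.
    rewrite ge0_integralZlT//.
    rewrite (ge0_integral_mul lam2 lam2 (f := fun y => box2 e (dif y x))
      (g := fun y => box2 e (dif y x)))//; [|by mfun|by mfun].
    by rewrite !iboxd -!EFinM; congr EFin; ring.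
  rewrite -ge0_integralDT; [|by mfun|by mfun|by move=> u; rewrite mulr_ge0|by move=> u; rewrite mulr_ge0].
  rewrite -ge0_integralDT; [|by mfun|by mfun|by move=> u; rewrite addr_ge0// mulr_ge0|by move=> u; rewrite mulr_ge0].
  by apply: eq_integral => u _; rewrite !mulrDl.
under eq_integral do rewrite E.
have mI (Q1 : R * R -> R) : measurable_fun setT Q1 -> (forall x, 0 <= Q1 x) ->
    measurable_fun setT (fun x => c%:E * \int[lam2]_y (Q1 y * box2 e (dif y x))%:E)%E.
  move=> mQ1 Q10.
  have h1 : measurable_fun setT (fun z : (R * R) * (R * R) => Q1 z.2 * box2 e (dif z.2 z.1)) by mfun.
  have h0 x y : 0 <= Q1 y * box2 e (dif y x) by rewrite mulr_ge0.
  by apply: measurable_funeM; exact: (measurable_tonelliF lam2 h1 h0).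
have I0 (Q1 : R * R -> R) x : (forall x, 0 <= Q1 x) ->
    (0 <= c%:E * \int[lam2]_y (Q1 y * box2 e (dif y x))%:E)%E.
  by move=> Q10; rewrite mule_ge0// integral_ge0// => y _; rewrite lee_fin mulr_ge0.
have mPE : measurable_fun setT (fun x => (c%:E * (c * P x)%:E)%E).
  by apply: measurable_funeM; mfun.
have PE0 x : (0 <= c%:E * (c * P x)%:E)%E by rewrite mule_ge0// lee_fin mulr_ge0.
rewrite ge0_integralZl//; last 3 first.
- apply: emeasurable_funD; last exact: mI.
  by apply: emeasurable_funD; last exact: mI.
- by move=> x _; rewrite !adde_ge0// I0.
- by rewrite lee_fin sqr_ge0.
rewrite ge0_integralD//; last 4 first.
- by move=> x _; rewrite adde_ge0// I0.
- by apply: emeasurable_funD; last exact: mI.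
- by move=> x _; rewrite I0.
- exact: mI.
rewrite ge0_integralD//; last 2 first.
- by move=> x _; rewrite I0.
- exact: mI.
rewrite !iQQ//.
have -> : (\int[lam2]_x (c%:E * (c * P x)%:E) = (c ^+ 2)%:E * \int[lam2]_x (P x)%:E)%E.
  rewrite ge0_integralZl//; last 2 first.
  - by mfun.
  - by move=> x _; rewrite lee_fin mulr_ge0.
  by rewrite ge0_integralZlT// muleA -EFinM.
have IQ0 (Q1 : R * R -> R) : (forall x, 0 <= Q1 x) -> (0 <= \int[lam2]_x (Q1 x)%:E)%E.
  by move=> Q10; apply: integral_ge0 => x _; rewrite lee_fin.
have IP := IQ0 _ P0; have IQ := IQ0 _ Q0; have IS := IQ0 _ S0.
rewrite -(ge0_muleDr _ IP IQ) -(ge0_muleDr _ (adde_ge0 IP IQ) IS).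
by rewrite muleA -EFinM.
Qed.

End kernels.

Section trilinear.
Context {R : realType}.
Implicit Types (f g b : R * R -> R) (al be : R * R -> R) (x y z : R * R) (e M : R).

Local Notation dif y x := ((y : R * R).1 - (x : R * R).1, (y : R * R).2 - (x : R * R).2).

Lemma itg_loc e M al f (F : R * R -> R) x : 0 <= e -> kern e M al -> 0 <= M ->
  measurable_fun setT f -> measurable_fun setT F ->
  (forall y, `|f y| <= F y + 1) -> (forall y, 0 <= F y) ->
  (\int[lam2]_y (F y)%:E < +oo)%E ->
  itg lam2 (fun y => f y * al (dif y x)) /\ itg lam2 (fun y => f y * al (dif x y)).
Proof.
move=> e0 [mal alM] M0 mf mF fF F0 Foo; have mb := measurable_box2 e.
have key (bx : R * R -> R) (a : R * R -> R) : measurable_fun setT bx -> measurable_fun setT a ->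
    (forall y, 0 <= bx y <= 1) -> (\int[lam2]_y (bx y)%:E < +oo)%E ->
    (forall y, `|a y| <= M * bx y) -> itg lam2 (fun y => f y * a y).
  move=> mbx ma bx01 bxoo aM.
  apply: (@itg_le _ _ _ _ _ (fun y => M * F y + M * bx y)).
  - by mfun.
  - by mfun.
  - move=> y; rewrite normrM; apply: (le_trans (ler_pM _ _ (fF y) (aM y))) => //.
    have /andP[b0 b1] := bx01 y; rewrite mulrCA -mulrDr ler_wpM2l//.
    by have := F0 y; move: (bx y) (F y) b0 b1 => ? ? *; nra.
  - have bx0 y : 0 <= bx y by have /andP[] := bx01 y.
    rewrite ge0_integralDT; [|by mfun|by mfun|by move=> y; rewrite mulr_ge0|by move=> y; rewrite mulr_ge0].
    by rewrite !ge0_integralZlT//; apply: lte_add_pinfty; apply: lte_mul_pinfty.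
have b01 z : 0 <= box2 e z <= 1 by rewrite /box2; case: ifP; rewrite ?lexx ?ler01.
split; [apply: (key (fun y => box2 e (dif y x)))|apply: (key (fun y => box2 e (dif x y)))] => //.
- by mfun.
- by mfun.
- by rewrite integral_box2_dif// ltry.
- by mfun.
- by mfun.
- by rewrite integral_box2_difr// ltry.
Qed.

(** After this exchange the x-integral contains [b] and the two kernels only, f and g becoming
    constants; see [trif_int]. *)
Lemma tri_fubini e M b f g al be (P Q S : R * R -> R) :
  0 <= e -> 0 <= M -> kern e M al -> kern e M be ->
  measurable_fun setT b -> measurable_fun setT f -> measurable_fun setT g ->
  measurable_fun setT P -> measurable_fun setT Q -> measurable_fun setT S ->
  (forall x, 0 <= P x) -> (forall x, 0 <= Q x) -> (forall x, 0 <= S x) ->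
  (forall x y z, `|b x * f y * g z| <= P x + Q y + S z) ->
  (\int[lam2]_x (P x)%:E < +oo)%E -> (\int[lam2]_x (Q x)%:E < +oo)%E ->
  (\int[lam2]_x (S x)%:E < +oo)%E ->
  (\int[lam2]_x (f x ^+ 2)%:E < +oo)%E -> (\int[lam2]_x (g x ^+ 2)%:E < +oo)%E ->
  [/\ itg2 lam2 lam4 (trif b f g al be),
      itg lam2 (fun x => b x * (conv f al x * conv g be x)) &
      \int[lam2]_x (b x * (conv f al x * conv g be x)) =
      \int[lam4]_u \int[lam2]_x trif b f g al be x u].
Proof.
move=> e0 M0 ka kb mb mf mg mP mQ mS P0 Q0 S0 bfg Poo Qoo Soo foo goo.
have h : itg2 lam2 lam4 (trif b f g al be).
  apply: itg2P; first exact: (measurable_trif ka kb).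
  apply: (le_lt_trans (tri_bound e0 M0 ka kb mb mf mg mP mQ mS P0 Q0 S0 bfg)).
  apply: lte_mul_pinfty; first by rewrite lee_fin mulr_ge0 ?sqr_ge0.
    by [].
  by do 2?[apply: lte_add_pinfty => //].
have E x : \int[lam4]_u trif b f g al be x u = b x * (conv f al x * conv g be x).
  have hf := itg_kern x e0 ka M0 mf foo; have hg := itg_kern x e0 kb M0 mg goo.
  have := Rint_mul hf hg; rewrite -/(conv f al x) -/(conv g be x) => <-.
  rewrite -RintZ; last exact: itg2_mul hf hg.
  by rewrite /Rintegral; congr fine; apply: eq_integral => u _; rewrite /trif [in RHS]mulrA.
split => //.
- by have := itg2_itg1 h; congr (itg _ _); apply/funext => x; rewrite E.
- by rewrite -(RFubini h); apply: eq_Rintegral => x _; rewrite E.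
Qed.

Lemma trif_int e M b f g al be (F : R * R -> R) (u : (R * R) * (R * R)) :
  0 <= e -> 0 <= M -> kern e M al -> kern e M be ->
  measurable_fun setT b -> measurable_fun setT F ->
  (forall y, `|b y| <= F y + 1) -> (forall y, 0 <= F y) ->
  (\int[lam2]_y (F y)%:E < +oo)%E ->
  itg lam2 (fun x => b x * (al (dif u.1 x) * be (dif u.2 x))) /\
  \int[lam2]_x trif b f g al be x u =
  f u.1 * g u.2 * \int[lam2]_x (b x * (al (dif u.1 x) * be (dif u.2 x))).
Proof.
move=> e0 M0 [mal alM] [mbe beM] mb mF bF F0 Foo.
have bM z : `|be z| <= M.
  by apply: (le_trans (beM z)); rewrite /box2; case: ifP; rewrite ?mulr1 ?mulr0.
have i : itg lam2 (fun x => b x * (al (dif u.1 x) * be (dif u.2 x))).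
  have ka' : kern e (M * M) (fun z => al z * be (u.2.1 - (u.1.1 - z.1), u.2.2 - (u.1.2 - z.2))).
    split; first by mfun.
    by move=> x; rewrite normrM mulrAC ler_pM.
  have := (itg_loc u.1 e0 ka' (mulr_ge0 M0 M0) mb mF bF F0 Foo).2.
  congr (itg _ _); apply/funext => x /=; congr (_ * (_ * be _)).
  by rewrite !subKr.
split=> //; rewrite -RintZ//; apply: eq_Rintegral => x _; rewrite /trif; ring.
Qed.

End trilinear.

Section kernel_ibp.
Context {R : realType}.

Definition ten (p q : R -> R) (z : R * R) : R := p z.1 * q z.2.

Definition C0c (e : R) (p : R -> R) := continuous p /\ forall s, e <= `|s| -> p s = 0.

Lemma C1c_C0c e p p' : C1c e p p' -> C0c e p /\ C0c e p'.
Proof.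
move=> cp; have [_ cp' ps] := cp; split; split => //.
- exact: C1c_continuous cp.
- by move=> s /ps[].
- by move=> s /ps[].
Qed.

Lemma C0c_bound (e : R) p : 0 < e -> C0c e p ->
  exists2 M : R, 0 <= M & forall s, `|p s| <= M.
Proof. by move=> e0 [cp ps]; exact: continuous_bounded_supp cp (ltW e0) ps. Qed.

Lemma C0c_itg (e : R) p q (y z : R) : 0 < e -> C0c e p -> C0c e q ->
  itg lam1 (fun s => p (y - s) * q (z - s)).
Proof.
move=> e0 cp cq; have [M M0 pM] := C0c_bound e0 cp; have [K K0 qK] := C0c_bound e0 cq.
have mp := continuous_measurable_fun cp.1.
have mq := continuous_measurable_fun cq.1.
apply: (@itg_le _ _ R lam1 _ (fun s : R => M * K * (if `|s| <= `|y| + e then 1 else 0))).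
- by mfun.
- by mfun.
- move=> s; case: (leP `|s| (`|y| + e)) => h; first by rewrite mulr1 normrM ler_pM.
  rewrite cp.2 ?mul0r ?normr0 ?mulr0//.
  by have := lerB_dist s y; rewrite distrC; lra.
- rewrite ge0_integralZlT//; [|by mfun|by move=> s; case: ifP|by rewrite mulr_ge0].
  by apply: lte_mul_pinfty; rewrite ?lee_fin ?mulr_ge0//; exact: indic_int_lty.
Qed.

Lemma ibp_diff (e : R) u u' v v' (y z : R) : 0 < e -> C1c e u u' -> C1c e v v' ->
  \int[lam1]_s (u' (y - s) * v (z - s)) = - \int[lam1]_s (u (y - s) * v' (z - s)).
Proof.
move=> e0 [du cu _] [dv cv ve].
have dsub (h h' : R -> R) (c x : R) : (forall x : R, is_derive x 1 h (h' x)) ->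
    is_derive x 1 (fun s => h (c - s)) (- h' (c - x)).
  move=> dh; have d1 : is_derive x 1 (fun s : R => c - s) (-1).
    by have := is_deriveB (is_derive_cst c x (1 : R)) (is_derive_id x (1 : R)); rewrite sub0r.
  have := @is_derive1_comp R h (fun s : R => c - s) x _ _ (dh (c - x)) d1.
  by rewrite mulrN1.
have csub (h : R -> R) (c : R) : continuous h -> continuous (fun s => - h (c - s)).
  move=> ch s; apply: cvgN; apply: (@continuous_comp _ _ _ (fun s : R => c - s) h); last exact: ch.
  by apply: cvgB; [exact: cvg_cst|exact: cvg_id].
have vN s : `|z| + e <= `|s| -> v (z - s) = 0 /\ - v' (z - s) = 0.
  move=> h; have [|-> ->] := ve (z - s); last by rewrite oppr0.
  by have := lerB_dist s z; rewrite distrC; lra.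
have N0 : 0 < `|z| + e by rewrite ltr_wpDl.
have := Rint_ibp N0 (fun x => dsub u u' y x du) (csub u' y cu) (fun x => dsub v v' z x dv) (csub v' z cv) vN.
rewrite (_ : \int[lam1]_s (u (y - s) * - v' (z - s)) = - \int[lam1]_s (u (y - s) * v' (z - s))); last first.
  by rewrite -RintN; apply: eq_Rintegral => s _; rewrite mulrN.
move=> ->; rewrite -RintN; apply: eq_Rintegral => s _; rewrite mulNr opprK//.
Qed.

Lemma ten_int (e : R) p q r t (y z : R * R) : 0 < e ->
  C0c e p -> C0c e q -> C0c e r -> C0c e t ->
  itg lam2 (fun x => ten p q (y.1 - x.1, y.2 - x.2) * ten r t (z.1 - x.1, z.2 - x.2)) /\
  \int[lam2]_x (ten p q (y.1 - x.1, y.2 - x.2) * ten r t (z.1 - x.1, z.2 - x.2)) =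
  \int[lam1]_s (p (y.1 - s) * r (z.1 - s)) * \int[lam1]_s (q (y.2 - s) * t (z.2 - s)).
Proof.
move=> e0 cp cq cr ct.
have h1 := C0c_itg y.1 z.1 e0 cp cr; have h2 := C0c_itg y.2 z.2 e0 cq ct.
have E x : ten p q (y.1 - x.1, y.2 - x.2) * ten r t (z.1 - x.1, z.2 - x.2) =
  (p (y.1 - x.1) * r (z.1 - x.1)) * (q (y.2 - x.2) * t (z.2 - x.2)).
  by rewrite /ten /= mulrACA.
split; first by under eq_fun do rewrite E; exact: (itg2_mul h1 h2).
by rewrite -(Rint_mul h1 h2); apply: eq_Rintegral => x _; exact: E.
Qed.

(** Both kernels depend on x through y - x and z - x, so integrating by parts in x moves a
    derivative from one to the other at the price of a sign. *)
Lemma kernel_ibp (e : R) u u' v v' w t (y z : R * R) : 0 < e ->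
  C1c e u u' -> C1c e v v' -> C0c e w -> C0c e t ->
  (\int[lam2]_x (ten u' w (y.1 - x.1, y.2 - x.2) * ten v t (z.1 - x.1, z.2 - x.2)) =
  - (\int[lam2]_x (ten u w (y.1 - x.1, y.2 - x.2) * ten v' t (z.1 - x.1, z.2 - x.2)))) /\
  \int[lam2]_x (ten w u' (y.1 - x.1, y.2 - x.2) * ten t v (z.1 - x.1, z.2 - x.2)) =
  - \int[lam2]_x (ten w u (y.1 - x.1, y.2 - x.2) * ten t v' (z.1 - x.1, z.2 - x.2)).
Proof.
move=> e0 cu cv cw ct; have [u0 u1] := C1c_C0c cu; have [v0 v1] := C1c_C0c cv.
split.
- rewrite (ten_int y z e0 u1 cw v0 ct).2 (ten_int y z e0 u0 cw v1 ct).2.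
  by rewrite (ibp_diff y.1 z.1 e0 cu cv) mulNr.
- rewrite (ten_int y z e0 cw u1 ct v0).2 (ten_int y z e0 cw u0 ct v1).2.
  by rewrite (ibp_diff y.2 z.2 e0 cu cv) mulrN.
Qed.

End kernel_ibp.

Section energy.
Context {R : realType}.
Variables (e nu : R) (m : mollifier e).
Hypotheses (e0 : 0 < e) (nu0 : 0 < nu).

Let n0 := eta0 m.
Let n1 := eta1 m.
Let n2 := eta2 m.

Lemma moll_C1c : C1c e n0 n1 /\ C1c e n1 n2.
Proof.
split; split.
- exact: eta0_derive.
- move=> s; apply: differentiable_continuous; apply/derivable1_diffP.
  by have := eta1_derive m s => -[].
- by move=> s /(eta_supp m)[].
- exact: eta1_derive.
- exact: eta2_continuous.
- by move=> s /(eta_supp m)[].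
Qed.

Lemma moll_C0c : [/\ C0c e n0, C0c e n1 & C0c e n2].
Proof.
have [/C1c_C0c[h0 h1] /C1c_C0c[_ h2]] := moll_C1c.
by split.
Qed.

Lemma ten_kern p q : C0c e p -> C0c e q -> exists2 M, 0 <= M & kern e M (ten p q).
Proof.
move=> cp cq; have [M M0 pM] := C0c_bound e0 cp; have [K K0 qK] := C0c_bound e0 cq.
have mp := continuous_measurable_fun cp.1.
have mq := continuous_measurable_fun cq.1.
exists (M * K); first by rewrite mulr_ge0.
split; first by rewrite /ten; mfun.
move=> x; rewrite /ten /box2; case: ifPn => [_|].
  by rewrite mulr1 normrM ler_pM.
rewrite negb_and -!ltNge => /orP[] /ltW.
  by move=> /cp.2 ->; rewrite mul0r normr0 mulr0.
by move=> /cq.2 ->; rewrite mulr0 normr0 mulr0.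
Qed.

Lemma kernW M M' al : M <= M' -> kern e M al -> @kern R e M' al.
Proof.
move=> MM [mal h]; split => // x; apply: (le_trans (h x)).
by rewrite ler_wpM2r// box2_ge0.
Qed.

Lemma moll_kern : exists2 M, 0 <= M &
  [/\ kern e M (ten n0 n0), kern e M (ten n1 n0), kern e M (ten n0 n1),
      kern e M (ten n2 n0) & kern e M (ten n0 n2)].
Proof.
have [c0 c1 c2] := moll_C0c.
have [A A0 hA] := ten_kern c0 c0; have [B B0 hB] := ten_kern c1 c0.
have [C C0 hC] := ten_kern c0 c1; have [D D0 hD] := ten_kern c2 c0.
have [E E0 hE] := ten_kern c0 c2.
exists (A + B + C + D + E); first by rewrite !addr_ge0.
by split; [move: hA|move: hB|move: hC|move: hD|move: hE]; apply: kernW; lra.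
Qed.

End energy.

Section elementary.
Context {R : realType}.

Lemma double_eq0 (r : R) : r + r = 0 -> r = 0.
Proof. lra. Qed.

Lemma expr4_ge0 (s : R) : 0 <= s ^+ 4.
Proof. by rewrite exprn_even_ge0. Qed.

Lemma expr4_norm (s : R) : s ^+ 4 = `|s| ^+ 4.
Proof. by rewrite -normrX ger0_norm// expr4_ge0. Qed.

Lemma norm_le_expr4 (s : R) : `|s| <= s ^+ 4 + 1.
Proof.
rewrite expr4_norm; have := expr4_ge0 `|s|; move: `|s| => t.
have [|t1] := leP t 1; first by lra.
have : t <= t ^+ 4 by rewrite ler_eXnr// ltW.
by lra.
Qed.

(** It rests on c r^2 <= r^2 + c^4 + r^4: for c <= 1 the first term is enough, for c > 1 Young gives
    c^2 + r^4 and c^2 <= c^4. The drift thus enters through its fourth power only. *)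
Lemma triple_bound (b s t : R) : `|b * s * t| <=
  2 * b ^+ 4 + (s ^+ 2 + s ^+ 4) + (t ^+ 2 + t ^+ 4).
Proof.
have h (c r : R) : 0 <= c -> 0 <= r -> c * r ^+ 2 <= r ^+ 2 + c ^+ 4 + r ^+ 4.
  move=> c0 r0; have [c1|c1] := leP c 1.
    have : c * r ^+ 2 <= 1 * r ^+ 2 by rewrite ler_wpM2r ?sqr_ge0.
    by have := expr4_ge0 c; have := expr4_ge0 r; lra.
  have h1 : c * r ^+ 2 <= c ^+ 2 + r ^+ 4.
    rewrite (_ : r ^+ 4 = (r ^+ 2) ^+ 2); last by ring.
    by have := sqr_ge0 r; move: (r ^+ 2) => t' t'0; nra.
  have h2 : c ^+ 2 <= c ^+ 4.
    rewrite (_ : c ^+ 4 = c ^+ 2 * c ^+ 2); last by ring.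
    by rewrite ler_peMr ?sqr_ge0// expr_ge1// ltW.
  by have := sqr_ge0 r; lra.
rewrite !normrM (expr4_norm b) (expr4_norm s) (expr4_norm t).
rewrite -[s ^+ 2]real_normK ?num_real// -[t ^+ 2]real_normK ?num_real//.
have := normr_ge0 b; have := normr_ge0 s; have := normr_ge0 t.
move: `|b| `|s| `|t| => {b s t} c s t t0 s0 c0.
have h1 := h c s c0 s0; have h2 := h c t c0 t0.
have h3 : c * s * t <= c * s ^+ 2 + c * t ^+ 2.
  by rewrite -mulrDr -mulrA ler_wpM2l//; nra.
by move: h1 h2 h3; clear; lra.
Qed.

Lemma RintD4 d (T : measurableType d) (m : {measure set T -> \bar R})
    (f1 f2 f3 f4 : T -> R) : itg m f1 -> itg m f2 -> itg m f3 -> itg m f4 ->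
  \int[m]_x (f1 x + f2 x + (f3 x + f4 x)) =
  \int[m]_x f1 x + \int[m]_x f2 x + (\int[m]_x f3 x + \int[m]_x f4 x).
Proof.
move=> h1 h2 h3 h4; have h12 := itgD h1 h2; have h34 := itgD h3 h4.
by rewrite (RintD h12 h34) (RintD h1 h2) (RintD h3 h4).
Qed.

Lemma Rint_comm (b f g : R * R -> R) :
  \int[lam2]_x (b x * (f x * g x)) = \int[lam2]_x (b x * (g x * f x)).
Proof. by apply: eq_Rintegral => x _; congr (_ * _); rewrite mulrC. Qed.

Lemma C1cW (N1 N2 : R) (p p' : R -> R) : N1 <= N2 -> C1c N1 p p' -> C1c N2 p p'.
Proof. by move=> N12 [h1 h2 h3]; split => // s /(le_trans N12); exact: h3. Qed.

Lemma le_Rint_ge0 d (T : measurableType d) (m : {measure set T -> \bar R})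
    (f g : T -> R) : itg m f -> measurable_fun setT g ->
  (forall x, 0 <= g x) -> (forall x, f x <= g x) ->
  ((\int[m]_x f x)%:E <= \int[m]_x (g x)%:E)%E.
Proof.
move=> hf mg g0 fg; have mf := itg_measurable hf.
have [goo|] := ltP (\int[m]_x (g x)%:E)%E +oo%E; last by rewrite leye_eq => /eqP ->; rewrite leey.
have hg : itg m g.
  by apply: (itg_le mg mg _ goo) => x; rewrite ger0_norm.
by rewrite (RintE hg) lee_fin; exact: le_Rint.
Qed.

(** Here A stands for the pure second derivatives of W, G for minus its gradient, V for the
    mollified flux b w and B for minus the two terms of the divergence of V. The five identities
    reduce the integrand to - nu |G|^2 - (V - b W) . G. *)
Lemma energy_algebra (nu : R) (A1 A2 B1 B2 W G1 G2 V1 V2 b1 b2 : R * R -> R) :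
  0 < nu ->
  measurable_fun setT G1 -> measurable_fun setT G2 -> measurable_fun setT W ->
  measurable_fun setT V1 -> measurable_fun setT V2 ->
  measurable_fun setT b1 -> measurable_fun setT b2 ->
  itg lam2 (fun x => A1 x * W x) -> itg lam2 (fun x => A2 x * W x) ->
  itg lam2 (fun x => B1 x * W x) -> itg lam2 (fun x => B2 x * W x) ->
  itg lam2 (fun x => G1 x * G1 x) -> itg lam2 (fun x => G2 x * G2 x) ->
  itg lam2 (fun x => V1 x * G1 x) -> itg lam2 (fun x => V2 x * G2 x) ->
  itg lam2 (fun x => b1 x * (W x * G1 x)) -> itg lam2 (fun x => b2 x * (W x * G2 x)) ->
  \int[lam2]_x (A1 x * W x) + \int[lam2]_x (G1 x * G1 x) = 0 ->
  \int[lam2]_x (A2 x * W x) + \int[lam2]_x (G2 x * G2 x) = 0 ->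
  \int[lam2]_x (B1 x * W x) + \int[lam2]_x (V1 x * G1 x) = 0 ->
  \int[lam2]_x (B2 x * W x) + \int[lam2]_x (V2 x * G2 x) = 0 ->
  \int[lam2]_x (b1 x * (W x * G1 x)) + \int[lam2]_x (b2 x * (W x * G2 x)) = 0 ->
  itg lam2 (fun x => (nu * (A1 x + A2 x) + (B1 x + B2 x)) * W x) /\
  ((\int[lam2]_x ((nu * (A1 x + A2 x) + (B1 x + B2 x)) * W x))%:E <=
    \int[lam2]_x ((4 * nu)^-1 * ((V1 x - b1 x * W x) ^+ 2 + (V2 x - b2 x * W x) ^+ 2))%:E)%E.
Proof.
move=> nu0 mG1 mG2 mW mV1 mV2 mb1 mb2 iA1 iA2 iB1 iB2 iG1 iG2 iV1 iV2 ib1 ib2 E1 E2 E3 E4 E5.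
have iA := itgZ nu (itgD iA1 iA2); have iB := itgD iB1 iB2.
have hE : (fun x => (nu * (A1 x + A2 x) + (B1 x + B2 x)) * W x) =
    (fun x => nu * (A1 x * W x + A2 x * W x) + (B1 x * W x + B2 x * W x)).
  by apply/funext => x; ring.
have iG := itgZ nu (itgD iG1 iG2); have iV := itgD iV1 iV2; have ib := itgD ib1 ib2.
pose F x := - (nu * (G1 x * G1 x + G2 x * G2 x)
  + ((V1 x * G1 x + V2 x * G2 x) - (b1 x * (W x * G1 x) + b2 x * (W x * G2 x)))).
have iF : itg lam2 F by apply: itgN; apply: itgD => //; exact: itgB.
have EF : \int[lam2]_x ((nu * (A1 x + A2 x) + (B1 x + B2 x)) * W x) = \int[lam2]_x F x.
  rewrite hE (RintD iA iB) (RintZ nu (itgD iA1 iA2)) (RintD iA1 iA2) (RintD iB1 iB2).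
  rewrite RintN (RintD iG (itgB iV ib)) (RintB iV ib) (RintZ nu (itgD iG1 iG2)).
  rewrite (RintD iG1 iG2) (RintD iV1 iV2) (RintD ib1 ib2) E5.
  move/eqP: E1; rewrite addr_eq0 => /eqP ->; move/eqP: E2; rewrite addr_eq0 => /eqP ->.
  move/eqP: E3; rewrite addr_eq0 => /eqP ->; move/eqP: E4; rewrite addr_eq0 => /eqP ->.
  by rewrite subr0 !opprD -!mulrN !opprD.
split; first by rewrite hE; exact: itgD.
rewrite EF; apply: le_Rint_ge0 => //.
- by mfun.
- by move=> x; rewrite mulr_ge0 ?addr_ge0 ?sqr_ge0// invr_ge0 mulr_ge0// ltW.
move=> x; have key (g v b w : R) : - (nu * (g * g) + (v * g - b * (w * g))) <= (4 * nu)^-1 * (v - b * w) ^+ 2.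
  (* With d = v - b w, the quantity nu g^2 + d g + d^2 / (4 nu) is the square of d + 2 nu g divided
     by 4 nu. *)
  rewrite -subr_ge0 (_ : _ - _ = (4 * nu)^-1 * (v - b * w + 2 * nu * g) ^+ 2).
    by rewrite mulr_ge0 ?sqr_ge0// invr_ge0 mulr_ge0// ltW.
  by field; rewrite gt_eqF.
apply: le_trans (_ : _ <= _) _; last first.
  by rewrite mulrDr; apply: (lerD (key (G1 x) _ _ _) (key (G2 x) _ _ _)).
by rewrite /F le_eqVlt; apply/orP; left; apply/eqP; ring.
Qed.

End elementary.

Section zero_integrals.
Context {R : realType}.
Variables (e M : R).
Hypotheses (e0 : 0 < e) (M0 : 0 <= M).
Implicit Types (f g b : R * R -> R) (al be : R * R -> R).

Local Notation dif y x := ((y : R * R).1 - (x : R * R).1, (y : R * R).2 - (x : R * R).2).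

Definition L2fun f := measurable_fun setT f /\ (\int[lam2]_x (f x ^+ 2)%:E < +oo)%E.

Lemma mul_L2fun f g : measurable_fun setT f -> measurable_fun setT g ->
  (\int[lam2]_x (f x ^+ 4)%:E < +oo)%E -> (\int[lam2]_x (g x ^+ 4)%:E < +oo)%E ->
  L2fun (fun y => f y * g y).
Proof.
move=> mf mg foo goo; split; first by mfun.
apply: (@le_lt_trans _ _ (\int[lam2]_x (f x ^+ 4 + g x ^+ 4)%:E)%E).
  apply: le_ge0_integralT; [by mfun|by mfun|by move=> x; exact: sqr_ge0|].
  move=> x; rewrite exprMn.
  rewrite (_ : f x ^+ 4 = (f x ^+ 2) ^+ 2); last by ring.
  rewrite (_ : g x ^+ 4 = (g x ^+ 2) ^+ 2); last by ring.
  by move: (f x ^+ 2) (g x ^+ 2) => s t; nra.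
rewrite ge0_integralDT; [exact: lte_add_pinfty|by mfun|by mfun|by move=> x; exact: expr4_ge0|by move=> x; exact: expr4_ge0].
Qed.

(** An identity between kernels, valid for all y and z, is lifted to convolutions of arbitrary L^2
    functions by expanding and exchanging integrals. *)
Lemma zero_pair f g a1 b1 a2 b2 : L2fun f -> L2fun g ->
  kern e M a1 -> kern e M b1 -> kern e M a2 -> kern e M b2 ->
  (forall y z, \int[lam2]_x (a1 (dif y x) * b1 (dif z x)) =
             - \int[lam2]_x (a2 (dif y x) * b2 (dif z x))) ->
  [/\ itg lam2 (fun x => conv f a1 x * conv g b1 x),
      itg lam2 (fun x => conv f a2 x * conv g b2 x) &
  \int[lam2]_x (conv f a1 x * conv g b1 x) + \int[lam2]_x (conv f a2 x * conv g b2 x) = 0].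
Proof.
move=> [mf foo] [mg goo] ka1 kb1 ka2 kb2 ab.
have c1 : measurable_fun setT (fun _ : R * R => 1 : R) by exact: measurable_cst.
have c0 : measurable_fun setT (fun _ : R * R => 0 : R) by exact: measurable_cst.
have f2 : measurable_fun setT (fun x => f x ^+ 2) by mfun.
have g2 : measurable_fun setT (fun x => g x ^+ 2) by mfun.
have fg (x y z : R * R) : `|1 * f y * g z| <= 0 + f y ^+ 2 + g z ^+ 2.
  rewrite mul1r normrM -[f y ^+ 2]real_normK ?num_real// -[g z ^+ 2]real_normK ?num_real//.
  by move: `|f y| `|g z| => s t; nra.
have i0 : (\int[@lam2 R]_x (0 : R)%:E < +oo)%E by rewrite integral0.
have s2 (h : R * R -> R) x : 0 <= h x ^+ 2 by exact: sqr_ge0.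
have key al be (ka : kern e M al) (kb : kern e M be) :=
  tri_fubini (ltW e0) M0 ka kb c1 mf mg c0 f2 g2 (fun=> lexx 0) (s2 f) (s2 g) fg i0 foo goo foo goo.
have [h1 i1 E1] := key _ _ ka1 kb1; have [h2 i2 E2] := key _ _ ka2 kb2.
have e1 (a b : R * R -> R) : (fun x => 1 * (conv f a x * conv g b x)) = (fun x => conv f a x * conv g b x).
  by apply/funext => x; rewrite mul1r.
rewrite e1 in i1 E1; rewrite e1 in i2 E2.
split => //; rewrite E1 E2 -RintD; [|exact: itg2_itg2 h1|exact: itg2_itg2 h2].
rewrite -[RHS](Rint0 lam4); apply: eq_Rintegral => u _.
have b1x (y : R * R) : `|1 : R| <= 0 + 1 by rewrite normr1 add0r.
rewrite (trif_int f g u (ltW e0) M0 ka1 kb1 c1 c0 b1x (fun=> lexx 0) i0).2.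
rewrite (trif_int f g u (ltW e0) M0 ka2 kb2 c1 c0 b1x (fun=> lexx 0) i0).2.
rewrite -mulrDr.
under eq_Rintegral do rewrite mul1r.
under [X in _ + X]eq_Rintegral do rewrite mul1r.
by rewrite ab addNr mulr0.
Qed.

(** Testing with products p(x1) q(x2) is enough, since the mollifier is itself a product. *)
Definition divfree (b1 b2 : R * R -> R) := forall (N : R) (p p' q q' : R -> R),
  0 < N -> C1c N p p' -> C1c N q q' ->
  \int[lam2]_x (b1 x * (p' x.1 * q x.2) + b2 x * (p x.1 * q' x.2)) = 0.

End zero_integrals.

Section energy.
Context {R : realType}.
Variables (e nu : R) (m : mollifier e).
Hypotheses (e0 : 0 < e) (nu0 : 0 < nu).

Let n0 := eta0 m.
Let n1 := eta1 m.
Let n2 := eta2 m.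

Local Notation dif y x := ((y : R * R).1 - (x : R * R).1, (y : R * R).2 - (x : R * R).2).

Lemma C1c_product (y z : R) :
  C1c (`|y| + e) (fun s => n0 (y - s) * n0 (z - s))
    (fun s => - (n1 (y - s) * n0 (z - s) + n0 (y - s) * n1 (z - s))).
Proof.
have [[d0 c1 s0] _] := moll_C1c m; have [[c0 _] _ _] := moll_C0c m.
have dsub (c x : R) : is_derive x 1 (fun s => n0 (c - s)) (- n1 (c - x)).
  have d1 : is_derive x 1 (fun s : R => c - s) (-1).
    by have := is_deriveB (is_derive_cst c x (1 : R)) (is_derive_id x (1 : R)); rewrite sub0r.
  have := @is_derive1_comp R n0 (fun s : R => c - s) x _ _ (d0 (c - x)) d1.
  by rewrite mulrN1.
have csub (h : R -> R) (c : R) : continuous h -> continuous (fun s => h (c - s)).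
  move=> ch s; apply: (@continuous_comp _ _ _ (fun s : R => c - s) h); last exact: ch.
  by apply: cvgB; [exact: cvg_cst|exact: cvg_id].
split.
- move=> x; have dy := dsub y x; have dz := dsub z x.
  have h : is_derive x 1 (fun s : R => n0 (y - s) * n0 (z - s)) _ := is_deriveM dy dz.
  by apply: is_derive_eq; rewrite /GRing.scale/=; ring.
- move=> s; apply: cvgN; apply: cvgD; apply: cvgM; exact: csub.
- move=> s h; have [|E0 E1] := s0 (y - s); last by rewrite /n0 /n1 E0 E1 !mul0r addr0 oppr0.
  by have := lerB_dist s y; rewrite distrC; lra.
Qed.

Variables (b1 b2 w : R * R -> R).
Hypotheses (mb1 : measurable_fun setT b1) (mb2 : measurable_fun setT b2)
  (mw : measurable_fun setT w)
  (b1oo : (\int[lam2]_x (b1 x ^+ 4)%:E < +oo)%E)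
  (b2oo : (\int[lam2]_x (b2 x ^+ 4)%:E < +oo)%E)
  (w2oo : (\int[lam2]_x (w x ^+ 2)%:E < +oo)%E)
  (w4oo : (\int[lam2]_x (w x ^+ 4)%:E < +oo)%E)
  (divb : divfree b1 b2).

Let W := conv w (ten n0 n0).
Let G1 := conv w (ten n1 n0).
Let G2 := conv w (ten n0 n1).

(** This is b . grad (W^2) = 0 in integrated form. Expanded over (y, z), the gradient falls on x ->
    rho(y - x) rho(z - x), an admissible product in [divfree] for each fixed y and z. *)
Lemma transport_zero :
  [/\ itg lam2 (fun x => b1 x * (W x * G1 x)), itg lam2 (fun x => b2 x * (W x * G2 x)) &
    \int[lam2]_x (b1 x * (W x * G1 x)) + \int[lam2]_x (b2 x * (W x * G2 x)) = 0].
Proof.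
have [M M0 [k00 k10 k01 _ _]] := moll_kern m e0.
have e0' := ltW e0.
pose Q x := w x ^+ 2 + w x ^+ 4.
have mQ : measurable_fun setT Q by rewrite /Q; mfun.
have even4 (s : R) : 0 <= s ^+ 4 by rewrite exprn_even_ge0.
have Q0 x : 0 <= Q x by rewrite addr_ge0 ?sqr_ge0.
have Qoo : (\int[lam2]_x (Q x)%:E < +oo)%E.
  rewrite ge0_integralDT; [exact: lte_add_pinfty|by mfun|by mfun|by move=> x; exact: sqr_ge0|by []].
have key (b : R * R -> R) : measurable_fun setT b -> (\int[lam2]_x (b x ^+ 4)%:E < +oo)%E ->
    forall al be (ka : kern e M al) (kb : kern e M be),
    [/\ itg2 lam2 lam4 (trif b w w al be),
      itg lam2 (fun x => b x * (conv w al x * conv w be x)),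
      \int[lam2]_x (b x * (conv w al x * conv w be x)) =
      \int[lam4]_u \int[lam2]_x trif b w w al be x u &
      forall u, itg lam2 (fun x => b x * (al (dif u.1 x) * be (dif u.2 x))) /\
        \int[lam2]_x trif b w w al be x u =
        w u.1 * w u.2 * \int[lam2]_x (b x * (al (dif u.1 x) * be (dif u.2 x)))].
  move=> mb boo al be ka kb.
  have m2b : measurable_fun setT (fun x => 2 * b x ^+ 4) by mfun.
  have m2b0 x : 0 <= 2 * b x ^+ 4 by rewrite mulr_ge0.
  have m2boo : (\int[lam2]_x (2 * b x ^+ 4)%:E < +oo)%E.
    rewrite ge0_integralZlT//; last by mfun.
    exact: lte_mul_pinfty.
  have P x y z : `|b x * w y * w z| <= 2 * b x ^+ 4 + Q y + Q z.
    exact: triple_bound.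
  have [h1 h2 h3] := tri_fubini e0' M0 ka kb mb mw mw m2b mQ mQ m2b0 Q0 Q0 P m2boo Qoo Qoo w2oo w2oo.
  split => // u.
  have m4 : measurable_fun setT (fun x => b x ^+ 4) by mfun.
  have bb y : `|b y| <= b y ^+ 4 + 1 by exact: norm_le_expr4.
  exact: (trif_int w w u e0' M0 ka kb mb m4 bb (fun y => even4 (b y)) boo).
have [A1 A2 A3 A4] := key _ mb1 b1oo _ _ k00 k10.
have [B1 B2 B3 B4] := key _ mb1 b1oo _ _ k10 k00.
have [C1 C2 C3 C4] := key _ mb2 b2oo _ _ k00 k01.
have [D1 D2 D3 D4] := key _ mb2 b2oo _ _ k01 k00.
split => //.
have X1X2 : \int[lam2]_x (b1 x * (W x * G1 x)) + \int[lam2]_x (b2 x * (W x * G2 x)) =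
    \int[lam2]_x (b1 x * (G1 x * W x)) + \int[lam2]_x (b2 x * (G2 x * W x)).
  by rewrite (Rint_comm b1 W G1) (Rint_comm b2 W G2).
(* The sum is doubled with W and its derivatives exchanged, so that both terms of the product rule
   for rho(y - x) rho(z - x) are present. *)
apply: double_eq0; rewrite [X in _ + X = _]X1X2.
have iA := itg2_itg2 A1; have iB := itg2_itg2 B1; have iC := itg2_itg2 C1; have iD := itg2_itg2 D1.
rewrite /W /G1 /G2 A3 B3 C3 D3.
apply: (etrans (esym (RintD4 iA iC iB iD))).
rewrite -[RHS](Rint0 lam4); apply: eq_Rintegral => u _.
rewrite (A4 u).2 (B4 u).2 (C4 u).2 (D4 u).2 -!mulrDr.
apply/eqP; rewrite mulf_eq0; apply/orP; right; apply/eqP.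
have jA := (A4 u).1; have jB := (B4 u).1; have jC := (C4 u).1; have jD := (D4 u).1.
apply: (etrans (esym (RintD4 jA jC jB jD))).
pose N := `|u.1.1| + e + (`|u.1.2| + e).
have P1 := C1c_product u.1.1 u.2.1; have P2 := C1c_product u.1.2 u.2.2.
have N1 : `|u.1.1| + e <= N by rewrite lerDl addr_ge0.
have N2 : `|u.1.2| + e <= N by rewrite lerDr addr_ge0.
have N0 : 0 < N := ltr_wpDl (addr_ge0 (normr_ge0 _) (ltW e0)) (ltr_wpDl (normr_ge0 _) e0).
have := divb N0 (C1cW N1 P1) (C1cW N2 P2).
move=> /(congr1 -%R); rewrite oppr0 -RintN => <-.
by apply: eq_Rintegral => x _; rewrite /ten/= -/n0 -/n1; ring.
Qed.

Let h x := nu * (conv w (ten n2 n0) x + conv w (ten n0 n2) x) +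
  (conv (fun y => b1 y * w y) (ten n1 n0) x + conv (fun y => b2 y * w y) (ten n0 n1) x).
Let d1 x := conv (fun y => b1 y * w y) (ten n0 n0) x - b1 x * W x.
Let d2 x := conv (fun y => b2 y * w y) (ten n0 n0) x - b2 x * W x.

(* Integration by parts leaves [- nu |grad W| ^ 2 + d . grad W]; complete the square. *)
Lemma energy_inequality : itg lam2 (fun x => h x * W x) /\
  ((\int[lam2]_x (h x * W x))%:E <=
    \int[lam2]_x ((4 * nu)^-1 * (d1 x ^+ 2 + d2 x ^+ 2))%:E)%E.
Proof.
have [M M0 [k00 k10 k01 k20 k02]] := moll_kern m e0.
have [c0 c1 c2] := moll_C0c m; have [C01 C12] := moll_C1c m.
have even4 (s : R) : 0 <= s ^+ 4 by rewrite exprn_even_ge0.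
have wL2 : L2fun w by [].
have w1 := mul_L2fun mb1 mw b1oo w4oo; have w2 := mul_L2fun mb2 mw b2oo w4oo.
have [T1 T2 T3] := transport_zero.
have [Z11 Z12 Z1] := zero_pair e0 M0 wL2 wL2 k20 k00 k10 k10
  (fun y z => (kernel_ibp y z e0 C12 C01 c0 c0).1).
have [Z21 Z22 Z2] := zero_pair e0 M0 wL2 wL2 k02 k00 k01 k01
  (fun y z => (kernel_ibp y z e0 C12 C01 c0 c0).2).
have [Y11 Y12 Y1] := zero_pair e0 M0 w1 wL2 k10 k00 k00 k10
  (fun y z => (kernel_ibp y z e0 C01 C01 c0 c0).1).
have [Y21 Y22 Y2] := zero_pair e0 M0 w2 wL2 k01 k00 k00 k01
  (fun y z => (kernel_ibp y z e0 C01 C01 c0 c0).2).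
have mc al f : kern e M al -> measurable_fun setT f -> measurable_fun setT (conv f al).
  move=> [mal _] mf; apply: (@measurable_Rint _ _ _ _ _ lam2 (fun x y => f y * al (dif y x))).
  by mfun.
have mG1 : measurable_fun setT G1 by exact: mc.
have mG2 : measurable_fun setT G2 by exact: mc.
have mW : measurable_fun setT W by exact: mc.
have mV1 : measurable_fun setT (conv (fun y => b1 y * w y) (ten n0 n0)) by apply: mc => //; mfun.
have mV2 : measurable_fun setT (conv (fun y => b2 y * w y) (ten n0 n0)) by apply: mc => //; mfun.
exact: (energy_algebra nu0 mG1 mG2 mW mV1 mV2 mb1 mb2 Z11 Z21 Y11 Y21 Z12 Z22 Y12 Y22
  T1 T2 Z1 Z2 Y1 Y2 T3).
Qed.

End energy.

(** * Space-time estimates *)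

Section slices.
Context {R : realType}.
Local Open Scope ereal_scope.
Implicit Types (f g : R -> R * R -> R).

Local Notation jmeas f := (measurable_fun setT (fun v : R * (R * R) => f v.1 v.2)).

(** The measure [lam2] on the right carries the parameter (t, x2), so that the one-variable
    translation result applies in x1. *)
Lemma slice_x1 g : jmeas g -> (forall t x, 0 <= g t x)%R ->
  \int[lam1]_t \int[lam2]_x (g t x)%:E =
  \int[lam2]_v \int[lam1]_s (g v.1 (s, v.2))%:E.
Proof.
move=> mg g0.
have mt t : measurable_fun setT (g t).
  by apply: (measurableT_comp mg (g := fun x : R * R => (t, x))); mfun.
have m3 : measurable_fun setT (fun u : (R * R) * R => g u.1.1 (u.2, u.1.2)).
  by apply: (measurableT_comp mg (g := fun u : (R * R) * R => (u.1.1, (u.2, u.1.2)))); mfun.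
have mF := measurable_tonelliF lam1 (f := fun (v : R * R) s => g v.1 (s, v.2)) m3 (fun v s => g0 _ _).
rewrite (fubini_tonelli1 (fun v : R * R => \int[lam1]_s (g v.1 (s, v.2))%:E))//; last first.
  by move=> v; apply: integral_ge0 => s _; rewrite lee_fin.
apply: eq_integral => t _; rewrite (tonelli2 (mt t) (g0 t)).
have mst : measurable_fun setT (fun z : R * R => g t (z.1, z.2)).
  by apply: (measurableT_comp (mt t) (g := fun z : R * R => (z.1, z.2))); mfun.
exact: (tonelli lam1 lam1 mst (fun x y => g0 t (x, y))).
Qed.

Lemma slice_x2 g : jmeas g -> (forall t x, 0 <= g t x)%R ->
  \int[lam1]_t \int[lam2]_x (g t x)%:E =
  \int[lam2]_v \int[lam1]_s (g v.1 (v.2, s))%:E.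
Proof.
move=> mg g0.
have mt t : measurable_fun setT (g t).
  by apply: (measurableT_comp mg (g := fun x : R * R => (t, x))); mfun.
have m3 : measurable_fun setT (fun u : (R * R) * R => g u.1.1 (u.1.2, u.2)).
  by apply: (measurableT_comp mg (g := fun u : (R * R) * R => (u.1.1, (u.1.2, u.2)))); mfun.
have mF := measurable_tonelliF lam1 (f := fun (v : R * R) s => g v.1 (v.2, s)) m3 (fun v s => g0 _ _).
rewrite (fubini_tonelli1 (fun v : R * R => \int[lam1]_s (g v.1 (v.2, s))%:E))//; last first.
  by move=> v; apply: integral_ge0 => s _; rewrite lee_fin.
by apply: eq_integral => t _; rewrite tonelli2.
Qed.

Lemma expr_add_le (p : nat) (a b : R) :
  (`|a + b| ^+ p <= 2 ^+ p * (`|a| ^+ p + `|b| ^+ p))%R.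
Proof.
apply: (@le_trans _ _ ((2 * Num.max `|a| `|b|) ^+ p)%R).
  rewrite lerXn2r ?nnegrE ?mulr_ge0 ?le_max ?normr_ge0//.
  rewrite (le_trans (ler_normD _ _))// mulr_natl mulr2n lerD// le_max lexx ?orbT//.
by rewrite exprMn ler_wpM2l ?exprn_ge0// expr_max_le.
Qed.

(** By contradiction: shifts of size at most 1/(n+1) violating the bound form a sequence tending to
    0. The shift is made one coordinate at a time, and the part already shifted is removed by
    translation invariance. *)
Lemma translation_unif f (p : nat) : jmeas f ->
  \int[lam1]_t \int[lam2]_x (`|f t x| ^+ p.+1)%:E < +oo ->
  forall e : R, (0 < e)%R -> exists2 d : R, (0 < d)%R & forall z1 z2 : R,
    (`|z1| <= d)%R -> (`|z2| <= d)%R ->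
    \int[lam1]_t \int[lam2]_x (`|f t (x.1 + z1, x.2 + z2)%R - f t x| ^+ p.+1)%:E <= e%:E.
Proof.
move=> mf fo e e0; apply: contrapT => hn.
have [z hz] : {z : nat -> R * R & forall n, [/\ (`|(z n).1| <= n.+1%:R^-1)%R,
    (`|(z n).2| <= n.+1%:R^-1)%R &
    ~ \int[lam1]_t \int[lam2]_x (`|f t (x.1 + (z n).1, x.2 + (z n).2)%R - f t x| ^+ p.+1)%:E <= e%:E]}.
  apply: (@choice _ _ (fun n (z : R * R) => [/\ (`|z.1| <= n.+1%:R^-1)%R, (`|z.2| <= n.+1%:R^-1)%R &
    ~ \int[lam1]_t \int[lam2]_x (`|f t (x.1 + z.1, x.2 + z.2)%R - f t x| ^+ p.+1)%:E <= e%:E])) => n.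
  apply: contrapT => hz; apply: hn; exists (n.+1%:R^-1)%R => // z1 z2 h1 h2.
  by apply: contrapT => h; apply: hz; exists (z1, z2).
have cz (c : nat -> R) : (forall n, `|c n| <= n.+1%:R^-1)%R -> (c @ \oo --> (0 : R))%R.
  move=> hc; apply/norm_cvg0P; apply: (@squeeze_cvgr _ _ _ _ (fun=> 0%R) (fun n => n.+1%:R^-1)%R).
  - by apply: nearW => n; rewrite normr_ge0 hc.
  - exact: cvg_cst.
  - exact: cvg_harmonic.
have c1 : ((fun n => (z n).1) @ \oo --> (0 : R))%R by apply: cz => n; have [] := hz n.
have c2 : ((fun n => (z n).2) @ \oo --> (0 : R))%R by apply: cz => n; have [] := hz n.
have m1 : measurable_fun setT (fun u : (R * R) * R => f u.1.1 (u.2, u.1.2)).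
  by apply: (measurableT_comp mf (g := fun u : (R * R) * R => (u.1.1, (u.2, u.1.2)))); mfun.
have m2 : measurable_fun setT (fun u : (R * R) * R => f u.1.1 (u.1.2, u.2)).
  by apply: (measurableT_comp mf (g := fun u : (R * R) * R => (u.1.1, (u.1.2, u.2)))); mfun.
have mft (c d : R) : jmeas (fun t (x : R * R) => f t (x.1 + c, x.2 + d)%R).
  by apply: (measurableT_comp mf (g := fun v : R * (R * R) => (v.1, (v.2.1 + c, v.2.2 + d)%R))); mfun.
have mdiff (c d c' d' : R) : jmeas (fun t (x : R * R) => `|f t (x.1 + c, x.2 + d) - f t (x.1 + c', x.2 + d')| ^+ p.+1)%R.
  by have h1 := mft c d; have h2 := mft c' d'; mfun.
have pw0 (r : R) : (0 <= `|r| ^+ p.+1)%R by exact: exprn_ge0.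
have s1 := @translation_small_slice R _ _ lam2 (fun (v : R * R) s => f v.1 (s, v.2)) p m1.
have s2 := @translation_small_slice R _ _ lam2 (fun (v : R * R) s => f v.1 (v.2, s)) p m2.
have mfp : jmeas (fun t x => `|f t x| ^+ p.+1)%R by mfun.
have fo1 := fo; rewrite (slice_x1 mfp (fun t x => pw0 (f t x))) in fo1; have {}s1 := s1 fo1 _ c1.
have fo2 := fo; rewrite (slice_x2 mfp (fun t x => pw0 (f t x))) in fo2; have {}s2 := s2 fo2 _ c2.
pose A n := \int[lam1]_t \int[lam2]_x (`|f t (x.1 + (z n).1, x.2)%R - f t x| ^+ p.+1)%:E.
pose B n := \int[lam1]_t \int[lam2]_x (`|f t (x.1, x.2 + (z n).2)%R - f t x| ^+ p.+1)%:E.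
have sA : small A.
  apply: le_small s1 => n; rewrite /A slice_x1//.
  have h1 := mft (z n).1 0%R; have h2 := mft 0%R 0%R.
  have := mdiff (z n).1 0%R 0%R 0%R.
  by congr (measurable_fun _ _); apply/funext => -[t [x y]]/=; rewrite !addr0.
have sB : small B.
  apply: le_small s2 => n; rewrite /B slice_x2//.
  have := mdiff 0%R (z n).2 0%R 0%R.
  by congr (measurable_fun _ _); apply/funext => -[t [x y]]/=; rewrite !addr0.
have c20 : (0 <= 2 ^+ p.+1 :> R)%R by rewrite exprn_ge0.
have := smallZ c20 (smallD sA sB).
move=> /(_ _ e0)[N _ /(_ N (leqnn N))] hN.
have [_ _] := hz N; apply; apply: le_trans hN.
set c := (z N).1; set d := (z N).2.
pose G1 t (x : R * R) := (`|f t (x.1 + c, x.2 + d) - f t (x.1 + 0, x.2 + d)| ^+ p.+1)%R.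
pose G2 t (x : R * R) := (`|f t (x.1 + 0, x.2 + d) - f t (x.1 + 0, x.2 + 0)| ^+ p.+1)%R.
have mG1 : jmeas G1 by exact: mdiff.
have mG2 : jmeas G2 by exact: mdiff.
have mt (g : R -> R * R -> R) t : jmeas g -> measurable_fun setT (g t).
  by move=> mg; apply: (measurableT_comp mg (g := fun x : R * R => (t, x))); mfun.
have mF (g : R -> R * R -> R) : jmeas g -> (forall t x, 0 <= g t x)%R ->
    measurable_fun setT (fun t => \int[lam2]_x (g t x)%:E).
  by move=> mg g0; exact: (measurable_tonelliF lam2 mg g0).
have i0 (g : R -> R * R -> R) t : (forall t x, 0 <= g t x)%R -> 0 <= \int[lam2]_x (g t x)%:E.
  by move=> g0; apply: integral_ge0 => x _; rewrite lee_fin.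
have G10 t x : (0 <= G1 t x)%R by exact: pw0.
have G20 t x : (0 <= G2 t x)%R by exact: pw0.
apply: (@le_trans _ _ (\int[lam1]_t ((2 ^+ p.+1)%:E * (\int[lam2]_x (G1 t x)%:E + \int[lam2]_x (G2 t x)%:E)))).
  apply: ge0_le_integral => //.
  - by move=> t _; apply: integral_ge0 => x _; rewrite lee_fin.
  - apply: (mF (fun t x => `|f t (x.1 + c, x.2 + d) - f t x| ^+ p.+1)%R) => //.
    by have h1 := mft c d; mfun.
  - by apply: measurable_funeM; apply: emeasurable_funD; exact: mF.
  - move=> t _; rewrite -ge0_integralDT//; [|exact: mt|exact: mt].
    rewrite -ge0_integralZlT//; last 2 first.
    + by have h1 := mt _ t mG1; have h2 := mt _ t mG2; mfun.
    + by move=> x; rewrite addr_ge0.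
    apply: le_ge0_integralT => //.
    + have := mt (fun t x => `|f t (x.1 + c, x.2 + d) - f t (x.1 + 0, x.2 + 0)| ^+ p.+1)%R t (mdiff c d 0%R 0%R); congr (measurable_fun _ _).
      by apply/funext => -[x y]; rewrite /= !addr0.
    + by have h1 := mt _ t mG1; have h2 := mt _ t mG2; mfun.
    + move=> x; apply: (le_trans _ (expr_add_le _ _ _)).
      by rewrite addrA subrK !addr0 -surjective_pairing.
rewrite ge0_integralZl//; last 2 first.
- by apply: emeasurable_funD; exact: mF.
- by move=> t _; rewrite adde_ge0// i0.
apply: lee_wpmul2l; first by rewrite lee_fin.
have q1 (t : R) (_ : setT t) := i0 G1 t G10; have q2 (t : R) (_ : setT t) := i0 G2 t G20.
rewrite (ge0_integralD lam1 measurableT q1 (mF G1 mG1 G10) q2 (mF G2 mG2 G20)).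
apply: leeD; apply: ge0_le_integral => //.
- exact: (mF G1 mG1 G10).
- apply: (mF (fun t x => `|f t (x.1 + c, x.2) - f t x| ^+ p.+1)%R) => //.
  have := mdiff c 0%R 0%R 0%R; congr (measurable_fun _ _).
  by apply/funext => -[t [x y]]/=; rewrite !addr0.
- move=> t _; rewrite -(ge0_integral_shift2 0 d (f := fun x => `|f t (x.1 + c, x.2) - f t x| ^+ p.+1)%R)//.
    by under eq_integral do rewrite /G1; rewrite le_eqVlt; apply/orP; left; apply/eqP;
      apply: eq_integral => x _; rewrite addr0.
  have := mt (fun t x => `|f t (x.1 + c, x.2 + 0) - f t (x.1 + 0, x.2 + 0)| ^+ p.+1)%R t (mdiff c 0%R 0%R 0%R); congr (measurable_fun _ _).
  by apply/funext => -[x y]; rewrite /= !addr0.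
- exact: (mF G2 mG2 G20).
- apply: (mF (fun t x => `|f t (x.1, x.2 + d) - f t x| ^+ p.+1)%R) => //.
  have := mdiff 0%R d 0%R 0%R; congr (measurable_fun _ _).
  by apply/funext => -[t [x y]]/=; rewrite !addr0.
- move=> t _; rewrite le_eqVlt; apply/orP; left; apply/eqP.
  by apply: eq_integral => x _; rewrite /G2 !addr0 -surjective_pairing.
Qed.

End slices.

(** * Averaging against a mollifier *)

Section averages.
Context {R : realType}.
Local Notation dif y x := ((y : R * R).1 - (x : R * R).1, (y : R * R).2 - (x : R * R).2).
Local Notation add y x := ((y : R * R).1 + (x : R * R).1, (y : R * R).2 + (x : R * R).2).
Local Notation jmeas f := (measurable_fun setT (fun v : R * (R * R) => f v.1 v.2)).
Implicit Types (e : R) (f g : R * R -> R).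

Definition rho e (m : mollifier e) := ten (eta0 m) (eta0 m).

Lemma rho_ge0 e (m : mollifier e) z : 0 <= rho m z.
Proof. by rewrite mulr_ge0// eta0_ge0. Qed.

Lemma measurable_eta0 e (m : mollifier e) : measurable_fun setT (eta0 m).
Proof. by have [[c _] _ _] := moll_C0c m; exact: continuous_measurable_fun. Qed.

Lemma measurable_rho e (m : mollifier e) : measurable_fun setT (rho m).
Proof. by have h := measurable_eta0 m; rewrite /rho /ten; mfun. Qed.

Lemma rho_supp e (m : mollifier e) z : rho m z != 0 -> `|z.1| <= e /\ `|z.2| <= e.
Proof.
rewrite /rho /ten mulf_eq0 negb_or => /andP[z1 z2]; split; rewrite leNgt; apply/negP => /ltW h.
  by have [h0 _ _] := eta_supp m h; rewrite h0 eqxx in z1.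
by have [h0 _ _] := eta_supp m h; rewrite h0 eqxx in z2.
Qed.

Lemma integral_rho e (m : mollifier e) : (\int[lam2]_z (rho m z)%:E = 1)%E.
Proof.
have h := measurable_eta0 m.
by rewrite ge0_integral_prod ?eta0_int1 ?mule1//; exact: eta0_ge0.
Qed.

Lemma integral_rho_dif e (m : mollifier e) x : (\int[lam2]_y (rho m (dif y x))%:E = 1)%E.
Proof.
by rewrite (ge0_integral_shift2 (- x.1) (- x.2) (measurable_rho m) (rho_ge0 m)) integral_rho.
Qed.

(** The square of an average is at most the average of the square. The form with c serves the error
    W - w, and c = 0 serves the commutator. *)
Lemma jensen_rho e (m : mollifier e) f (c : R) x : 0 < e -> L2fun f ->
  (((conv f (rho m) x - c) ^+ 2)%:E <= \int[lam2]_y ((f y - c) ^+ 2 * rho m (dif y x))%:E)%E.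
Proof.
move=> e0 [mf foo]; have [M M0 [k00 _ _ _ _]] := moll_kern m e0.
have mr := measurable_rho m; have r0 := rho_ge0 m.
have hf : itg lam2 (fun y => f y * rho m (dif y x)) := itg_kern x (ltW e0) k00 M0 mf foo.
have f2 : measurable_fun setT (fun y => f y ^+ 2) by mfun.
have z0 : measurable_fun setT (fun _ : R * R => 0 : R) by mfun.
have h2 : itg lam2 (fun y => f y ^+ 2 * rho m (dif y x)).
  apply: (itg_loc x (ltW e0) k00 M0 f2 f2 _ _ foo).1.
    by move=> y; rewrite ger0_norm ?sqr_ge0// lerDl.
  by move=> y; exact: sqr_ge0.
have hr : itg lam2 (fun y => rho m (dif y x)).
  apply: itgP; first by mfun.
  rewrite (_ : (\int[lam2]_y _)%E = (\int[lam2]_y (rho m (dif y x))%:E)%E); last first.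
    by apply: eq_integral => y _; rewrite ger0_norm.
  by rewrite integral_rho_dif ltry.
have r1 : \int[lam2]_y rho m (dif y x) = 1.
  by apply: EFin_inj; rewrite -RintE// integral_rho_dif.
pose mu := conv f (rho m) x - c.
have hfc : itg lam2 (fun y => f y * rho m (dif y x) - c * rho m (dif y x)).
  by apply: itgB => //; exact: itgZ.
have hsq : itg lam2 (fun y => (f y - c) ^+ 2 * rho m (dif y x)).
  have := itgD (itgB h2 (itgZ (2 * c) hf)) (itgZ (c ^+ 2) hr).
  by congr (itg _ _); apply/funext => y; ring.
rewrite (RintE hsq) lee_fin -/mu.
have muE : mu = \int[lam2]_y (f y * rho m (dif y x) - c * rho m (dif y x)).
  by rewrite (RintB hf (itgZ c hr)) (RintZ c hr) r1 mulr1.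
(* This averages 2 mu s <= s^2 + mu^2 with s = f y - c, whose mean is mu. *)
have : 2 * mu * mu <= \int[lam2]_y ((f y - c) ^+ 2 * rho m (dif y x)) + mu ^+ 2.
  rewrite {2}muE -(RintZ _ hfc) -[X in _ + X]mulr1 -[X in _ + _ * X]r1.
  rewrite -(RintZ _ hr) -(RintD hsq (itgZ _ hr)); apply: le_Rint.
  - exact: itgZ.
  - by apply: itgD => //; exact: itgZ.
  - move=> y; rewrite -mulrBl mulrA -mulrDl ler_wpM2r//.
    have := sqr_ge0 (f y - c - mu); move: (f y - c) => s; clear; nra.
by rewrite expr2; move: (\int[lam2]_y _) => I; clear; lra.
Qed.

(** Substituting y = x + z and integrating over z last turns the left side into an average, for the
    probability density rho, of quantities with |z.1|, |z.2| <= e; a bound uniform over such shifts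
    is inherited. *)
Lemma average_bound e (m : mollifier e) (G : R -> R * R -> R * R -> R) (K : R) :
  measurable_fun setT (fun u : R * ((R * R) * (R * R)) => G u.1 u.2.1 u.2.2) ->
  (forall t x y, 0 <= G t x y) -> 0 <= K ->
  (forall z, `|z.1| <= e -> `|z.2| <= e ->
    (\int[lam1]_t \int[lam2]_x (G t x (add x z))%:E <= K%:E)%E) ->
  (\int[lam1]_t \int[lam2]_x \int[lam2]_y (G t x y * rho m (dif y x))%:E <= K%:E)%E.
Proof.
move=> mG G0 K0 hK; have mr := measurable_rho m; have r0 := rho_ge0 m.
pose F t x z := G t x (add x z) * rho m z.
have F0 t x z : 0 <= F t x z by rewrite mulr_ge0.
have mGz : measurable_fun setT (fun u : R * ((R * R) * (R * R)) => G u.1 u.2.1 (add u.2.1 u.2.2)).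
  by apply: (measurableT_comp mG (g := fun u : R * ((R * R) * (R * R)) => (u.1, (u.2.1, add u.2.1 u.2.2)))); mfun.
have mF : measurable_fun setT (fun u : R * ((R * R) * (R * R)) => F u.1 u.2.1 u.2.2).
  by rewrite /F; mfun.
have mFt t : measurable_fun setT (fun u : (R * R) * (R * R) => F t u.1 u.2).
  by apply: (measurableT_comp mF (g := fun u : (R * R) * (R * R) => (t, u))); mfun.
have mFtx t x : measurable_fun setT (F t x).
  by apply: (measurableT_comp (mFt t) (g := fun z : R * R => (x, z))); mfun.
have mtz : measurable_fun setT (fun v : (R * (R * R)) * (R * R) => F v.1.1 v.2 v.1.2).
  by apply: (measurableT_comp mF (g := fun v : (R * (R * R)) * (R * R) => (v.1.1, (v.2, v.1.2)))); mfun.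
have mI : measurable_fun setT (fun v : R * (R * R) => \int[lam2]_x (F v.1 x v.2)%:E)%E.
  exact: (measurable_tonelliF lam2 (f := fun (v : R * (R * R)) x => F v.1 x v.2) mtz (fun v x => F0 _ _ _)).
have I0 t z : (0 <= \int[lam2]_x (F t x z)%:E)%E.
  by apply: integral_ge0 => x _; rewrite lee_fin.
have E t : (\int[lam2]_x \int[lam2]_y (G t x y * rho m (dif y x))%:E =
            \int[lam2]_z \int[lam2]_x (F t x z)%:E)%E.
  rewrite -(tonelli lam2 lam2 (mFt t) (F0 t)); apply: eq_integral => x _.
  rewrite -(ge0_integral_shift2 (- x.1) (- x.2) (mFtx t x) (F0 t x)).
  apply: eq_integral => y _; rewrite /F /=; congr ((G _ _ _ * _)%:E).
  by rewrite !(addrC x.1, addrC x.2) !subrK -surjective_pairing.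
under eq_integral do rewrite E.
rewrite (fubini_tonelli (fun v : R * (R * R) => \int[lam2]_x (F v.1 x v.2)%:E)%E)//.
have mz z : measurable_fun setT (fun v : R * (R * R) => G v.1 v.2 (add v.2 z)).
  by apply: (measurableT_comp mG (g := fun v : R * (R * R) => (v.1, (v.2, add v.2 z)))); mfun.
have mtx t z : measurable_fun setT (fun x => G t x (add x z)).
  by apply: (measurableT_comp (mz z) (g := fun x : R * R => (t, x))); mfun.
have Ez z : (\int[lam1]_t \int[lam2]_x (F t x z)%:E =
    (rho m z)%:E * \int[lam1]_t \int[lam2]_x (G t x (add x z))%:E)%E.
  rewrite -ge0_integralZl//; last 3 first.
  - exact: (measurable_tonelliF lam2 (f := fun t x => G t x (add x z)) (mz z) (fun t x => G0 _ _ _)).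
  - by move=> t _; apply: integral_ge0 => x _; rewrite lee_fin.
  - by rewrite lee_fin.
  apply: eq_integral => t _; rewrite -ge0_integralZlT//.
  by apply: eq_integral => x _; rewrite /F mulrC.
apply: (@le_trans _ _ (\int[lam2]_z (K * rho m z)%:E)%E); last first.
  by rewrite ge0_integralZlT// integral_rho mule1.
apply: ge0_le_integral => //.
- by move=> z _; apply: integral_ge0 => t _.
- exact: (measurable_fun_fubini_tonelli_G (fun v : R * (R * R) => \int[lam2]_x (F v.1 x v.2)%:E)%E).
- by mfun.
- move=> z _; rewrite Ez.
  have [->|/rho_supp[z1 z2]] := eqVneq (rho m z) 0; first by rewrite mul0e mulr0.
  have -> : ((K * rho m z)%:E = (rho m z)%:E * K%:E)%E by rewrite -EFinM mulrC.
  by apply: lee_wpmul2l; [rewrite lee_fin|exact: hK].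
Qed.

End averages.

Section spacetime.
Context {R : realType}.
Local Notation dif y x := ((y : R * R).1 - (x : R * R).1, (y : R * R).2 - (x : R * R).2).
Local Notation add y x := ((y : R * R).1 + (x : R * R).1, (y : R * R).2 + (x : R * R).2).
Local Notation jmeas f := (measurable_fun setT (fun v : R * (R * R) => f v.1 v.2)).
Implicit Types (e : R) (f g b w : R -> R * R -> R).

(** Used with p = 2 and p = 4, so no absolute value is taken. *)
Definition Qfin (p : nat) f := (\int[lam1]_t \int[lam2]_x (f t x ^+ p)%:E < +oo)%E.

Lemma jmeas_slice f t : jmeas f -> measurable_fun setT (f t).
Proof.
by move=> mf; apply: (measurableT_comp mf (g := fun x : R * R => (t, x))); mfun.
Qed.

Lemma measurable_slice_int f : jmeas f -> (forall t x, 0 <= f t x) ->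
  measurable_fun setT (fun t => \int[lam2]_x (f t x)%:E)%E.
Proof. by move=> mf f0; exact: (measurable_tonelliF lam2 mf f0). Qed.

Lemma ae_lty d (X : measurableType d) (m : {measure set X -> \bar R}) (g : X -> \bar R) :
  measurable_fun setT g -> (forall t, 0 <= g t)%E -> (\int[m]_t g t < +oo)%E ->
  {ae m, forall t, g t < +oo}%E.
Proof.
move=> mg g0 goo; have ig : m.-integrable setT g.
  apply/integrableP; split => //.
  by under eq_integral do rewrite gee0_abs//.
have := integrable_ae measurableT ig; apply: filterS => t /(_ I).
by rewrite ge0_fin_numE.
Qed.

Lemma Qfin_ae (p : nat) f : jmeas f -> (forall t x, 0 <= f t x ^+ p) -> Qfin p f ->
  {ae lam1, forall t, (\int[lam2]_x (f t x ^+ p)%:E < +oo)%E}.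
Proof.
move=> mf f0; apply: ae_lty; first by apply: (measurable_slice_int (f := fun t x => f t x ^+ p)) => //; mfun.
by move=> t; apply: integral_ge0 => x _; rewrite lee_fin.
Qed.

Lemma le_Qint f g : jmeas f -> jmeas g -> (forall t x, 0 <= f t x) ->
  (forall t x, f t x <= g t x) ->
  (\int[lam1]_t \int[lam2]_x (f t x)%:E <= \int[lam1]_t \int[lam2]_x (g t x)%:E)%E.
Proof.
move=> mf mg f0 fg; have g0 t x : 0 <= g t x by exact: le_trans (fg t x).
apply: ge0_le_integral => //.
- by move=> t _; apply: integral_ge0 => x _; rewrite lee_fin.
- exact: measurable_slice_int.
- exact: measurable_slice_int.
- by move=> t _; apply: le_ge0_integralT => //; exact: jmeas_slice.
Qed.

Lemma QintD f g : jmeas f -> jmeas g -> (forall t x, 0 <= f t x) -> (forall t x, 0 <= g t x) ->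
  (\int[lam1]_t \int[lam2]_x (f t x + g t x)%:E =
   \int[lam1]_t \int[lam2]_x (f t x)%:E + \int[lam1]_t \int[lam2]_x (g t x)%:E)%E.
Proof.
move=> mf mg f0 g0.
have i0 (h : R -> R * R -> R) : (forall t x, 0 <= h t x) -> forall t, setT t -> (0 <= \int[lam2]_x (h t x)%:E)%E.
  by move=> h0 t _; apply: integral_ge0 => x _; rewrite lee_fin.
rewrite -(ge0_integralD lam1 measurableT (i0 f f0) (measurable_slice_int mf f0)
  (i0 g g0) (measurable_slice_int mg g0)).
by apply: eq_integral => t _; rewrite ge0_integralDT//; exact: jmeas_slice.
Qed.

Lemma QintZ (k : R) f : jmeas f -> (forall t x, 0 <= f t x) -> 0 <= k ->
  (\int[lam1]_t \int[lam2]_x (k * f t x)%:E = k%:E * \int[lam1]_t \int[lam2]_x (f t x)%:E)%E.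
Proof.
move=> mf f0 k0; rewrite -ge0_integralZl//; last 2 first.
- exact: measurable_slice_int.
- by move=> t _; apply: integral_ge0 => x _; rewrite lee_fin.
by apply: eq_integral => t _; rewrite ge0_integralZlT//; exact: jmeas_slice.
Qed.

Lemma Qint_ge0 f : (forall t x, 0 <= f t x) -> (0 <= \int[lam1]_t \int[lam2]_x (f t x)%:E)%E.
Proof. by move=> f0; apply: integral_ge0 => t _; apply: integral_ge0 => x _; rewrite lee_fin. Qed.

Lemma Qint_shift (z : R * R) f : jmeas f -> (forall t x, 0 <= f t x) ->
  (\int[lam1]_t \int[lam2]_x (f t (add x z))%:E = \int[lam1]_t \int[lam2]_x (f t x)%:E)%E.
Proof.
move=> mf f0; apply: eq_integral => t _.
by rewrite (ge0_integral_shift2 z.1 z.2 (jmeas_slice t mf)).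
Qed.

Lemma itg2_RintE d1 d2 (X : measurableType d1) (Y : measurableType d2)
    (m1 : {sigma_finite_measure set X -> \bar R}) (m2 : {sigma_finite_measure set Y -> \bar R})
    (f : X -> Y -> R) : itg2 m1 m2 f ->
  (\int[m1]_x \int[m2]_y (f x y)%:E)%E = (\int[m1]_x \int[m2]_y f x y)%:E.
Proof.
move=> h; rewrite -(RintE (itg2_itg1 h)); apply: ae_eq_integral => //.
- exact: measurable_fubini_F h.
- exact: measurable_int (itg2_itg1 h).
- by apply: filterS (itg2_ae1 h) => x hx _; rewrite RintE.
Qed.

Lemma jmeas_conv f al : jmeas f -> measurable_fun setT al -> jmeas (fun t => conv (f t) al).
Proof.
move=> mf mal.
apply: (@measurable_Rint _ _ _ _ _ lam2 (fun (v : R * (R * R)) y => f v.1 y * al (dif y v.2))).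
have h : measurable_fun setT (fun u : (R * (R * R)) * (R * R) => f u.1.1 u.2).
  by apply: (measurableT_comp mf (g := fun u : (R * (R * R)) * (R * R) => (u.1.1, u.2))); mfun.
by mfun.
Qed.

(** Valid without integrability, since [fine] sends the infinities to 0. *)
Lemma conv_bound (f : R * R -> R) al x : measurable_fun setT f -> measurable_fun setT al ->
  ((`|conv f al x|)%:E <= \int[lam2]_y (`|f y * al (dif y x)|)%:E)%E.
Proof.
move=> mf mal.
have h : measurable_fun setT (fun y => (f y * al (dif y x))%:E) by mfun.
have := le_abse_integral lam2 measurableT h; apply: le_trans.
by rewrite /conv /Rintegral; case: (\int[_]_y _)%E => [r||]//=; rewrite normr0 ?lexx ?leey.
Qed.

Lemma itg2_conv2 e M f g al be : 0 <= e -> 0 <= M -> kern e M al -> kern e M be ->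
  jmeas f -> jmeas g -> Qfin 2 f -> Qfin 2 g ->
  itg2 lam1 lam2 (fun t x => conv (f t) al x * conv (g t) be x).
Proof.
move=> e0 M0 ka kb mf mg foo goo; have [mal _] := ka; have [mbe _] := kb.
have mcf := jmeas_conv mf mal; have mcg := jmeas_conv mg mbe.
have mf2 : jmeas (fun t x => f t x ^+ 2) by mfun.
have mg2 : jmeas (fun t x => g t x ^+ 2) by mfun.
apply: itg2P; first by mfun.
pose C := M ^+ 2 * (4 * e ^+ 2) ^+ 2.
have C0 : 0 <= C by rewrite mulr_ge0 ?sqr_ge0.
apply: (@le_lt_trans _ _ (\int[lam1]_t \int[lam2]_x (C * (f t x ^+ 2 + g t x ^+ 2))%:E)%E); last first.
  rewrite QintZ//; [|by mfun|by move=> t x; rewrite addr_ge0 ?sqr_ge0].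
  apply: (lte_EFin_mul C0); rewrite QintD; first exact: (lte_add_pinfty foo goo).
  - exact: mf2.
  - exact: mg2.
  - by move=> t x; exact: sqr_ge0.
  - by move=> t x; exact: sqr_ge0.
apply: ge0_le_integral => //.
- by move=> t _; apply: integral_ge0 => x _; rewrite lee_fin.
- by apply: (measurable_slice_int (f := fun t x => `|conv (f t) al x * conv (g t) be x|)) => //; mfun.
- apply: (measurable_slice_int (f := fun t x => C * (f t x ^+ 2 + g t x ^+ 2))); first by mfun.
  by move=> t x; rewrite mulr_ge0 ?addr_ge0 ?sqr_ge0.
move=> t _.
have mft := jmeas_slice t mf; have mgt := jmeas_slice t mg.
have mft2 : measurable_fun setT (fun x => f t x ^+ 2) by mfun.
have mgt2 : measurable_fun setT (fun x => g t x ^+ 2) by mfun.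
have c1 : measurable_fun setT (fun _ : R * R => 1 : R) by exact: measurable_cst.
have c0 : measurable_fun setT (fun _ : R * R => 0 : R) by exact: measurable_cst.
have fg (x y z : R * R) : `|1 * f t y * g t z| <= 0 + f t y ^+ 2 + g t z ^+ 2.
  rewrite mul1r normrM -[f t y ^+ 2]real_normK ?num_real// -[g t z ^+ 2]real_normK ?num_real//.
  by move: `|f t y| `|g t z| => s r; nra.
have s2 (h : R * R -> R) x : 0 <= h x ^+ 2 by exact: sqr_ge0.
have := tri_bound e0 M0 ka kb c1 mft mgt c0 mft2 mgt2 (fun=> lexx 0) (s2 (f t)) (s2 (g t)) fg.
rewrite integral0 add0e -/C.
rewrite -ge0_integralDT//.
rewrite -ge0_integralZlT//; last 2 first.
- by mfun.
- by move=> x; rewrite addr_ge0 ?s2.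
apply: le_trans; apply: ge0_le_integral => //.
- have h1 := jmeas_slice (f := fun t => conv (f t) al) t mcf.
  by have h2 := jmeas_slice (f := fun t => conv (g t) be) t mcg; mfun.
- have := measurable_trif ka kb c1 mft mgt => mt.
  have mt' : measurable_fun setT (fun v : (R * R) * ((R * R) * (R * R)) => `|trif (fun=> 1) (f t) (g t) al be v.1 v.2|) by mfun.
  exact: (measurable_tonelliF lam4 mt' (fun _ _ => normr_ge0 _)).
move=> x _; rewrite normrM EFinM.
apply: le_trans (lee_pmul _ _ (conv_bound x mft mal) (conv_bound x mgt mbe)) _; rewrite ?lee_fin//.
rewrite -(ge0_integral_mul lam2 lam2 (f := fun y => `|f t y * al (dif y x)|)
  (g := fun y => `|g t y * be (dif y x)|))//; [|by mfun|by mfun].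
rewrite le_eqVlt; apply/orP; left; apply/eqP; apply: eq_integral => u _.
by rewrite /trif mul1r [in RHS]normrM.
Qed.

(** Integrability holds at every x and not only almost everywhere, because the equation is tested at
    each point: on the bounded window (0, T) x box the bound |f| <= f^2 + 1 suffices. *)
Lemma itg_conv_time e M (T : R) f al x : 0 < T -> 0 <= e -> 0 <= M -> kern e M al ->
  jmeas f -> Qfin 2 f -> (forall t y, ~~ (0 < t < T) -> f t y = 0) ->
  itg lam1 (fun t => conv (f t) al x).
Proof.
move=> T0 e0 M0 [mal alM] mf foo fT.
have mb := measurable_box2 e.
have mc : measurable_fun setT (fun t => conv (f t) al x).
  by apply: (measurableT_comp (jmeas_conv mf mal) (g := fun t : R => (t, x))); mfun.
have hI := itg_itv01 T0; have mI := itg_measurable hI.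
pose I (t : R) : R := if (0 < t) && (t < T) then 1 else 0.
apply: itgP => //.
pose G t y := M * f t y ^+ 2 + M * (I t * box2 e (dif y x)).
have mG : jmeas G by rewrite /G; mfun.
have b0 := @box2_ge0 R e.
have I0 t : 0 <= I t by rewrite /I; case: ifP.
have G0 t y : 0 <= G t y.
  by apply: addr_ge0; apply: mulr_ge0 => //; [exact: sqr_ge0|exact: mulr_ge0].
apply: (@le_lt_trans _ _ (\int[lam1]_t \int[lam2]_y (G t y)%:E)%E).
  apply: ge0_le_integral => //.
  - by mfun.
  - exact: measurable_slice_int.
  move=> t _; apply: (le_trans (conv_bound x (jmeas_slice t mf) mal)).
  have h1 := jmeas_slice t mf; have h2 := jmeas_slice t mG.
  apply: le_ge0_integralT => //; first by mfun.
  move=> y; rewrite /G /I; case: (boolP (0 < t < T)) => [_|/fT ->]; last first.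
    by rewrite mul0r normr0 !mul0r mulr0 addr0 mulr_ge0 ?sqr_ge0.
  rewrite mul1r normrM; apply: (le_trans (ler_wpM2l (normr_ge0 _) (alM _))).
  have b1 : box2 e (dif y x) <= 1 by rewrite /box2; case: ifP.
  rewrite mulrCA -mulrDr ler_wpM2l// -[f t y ^+ 2]real_normK ?num_real//.
  move: b1 (b0 (dif y x)) (normr_ge0 (f t y)); move: (box2 _ _) `|f t y| => b s; clear; nra.
have m1 : jmeas (fun t y => f t y ^+ 2) by mfun.
have m2 : jmeas (fun t y => I t * box2 e (dif y x)) by mfun.
have p1 t y : 0 <= f t y ^+ 2 by exact: sqr_ge0.
have p2 t y : 0 <= I t * box2 e (dif y x) by exact: mulr_ge0.
have m1' : jmeas (fun t y => M * f t y ^+ 2) by mfun.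
have m2' : jmeas (fun t y => M * (I t * box2 e (dif y x))) by mfun.
rewrite (QintD m1' m2' (fun t y => mulr_ge0 M0 (p1 t y)) (fun t y => mulr_ge0 M0 (p2 t y))).
rewrite (QintZ m1 p1 M0) (QintZ m2 p2 M0).
apply: lte_add_pinfty; first exact: lte_EFin_mul.
apply: (lte_EFin_mul M0); rewrite (_ : (\int[lam1]_t _)%E = ((4 * e ^+ 2)%:E * \int[lam1]_t (I t)%:E)%E); last first.
  rewrite -ge0_integralZlT//; last by rewrite mulr_ge0 ?sqr_ge0.
  apply: eq_integral => t _; rewrite ge0_integralZlT//; last by mfun.
  by rewrite integral_box2_dif// -EFinM mulrC.
apply: lte_EFin_mul; first by rewrite mulr_ge0 ?sqr_ge0.
have := itg_lty hI; rewrite (_ : (\int[lam1]_t `|_|%:E)%E = (\int[lam1]_t (I t)%:E)%E)//.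
by apply: eq_integral => t _; rewrite ger0_norm//; exact: I0.
Qed.

End spacetime.

Section vanishing.
Context {R : realType}.
Local Notation dif y x := ((y : R * R).1 - (x : R * R).1, (y : R * R).2 - (x : R * R).2).
Local Notation add y x := ((y : R * R).1 + (x : R * R).1, (y : R * R).2 + (x : R * R).2).
Local Notation jmeas f := (measurable_fun setT (fun v : R * (R * R) => f v.1 v.2)).
Implicit Types (e : R) (f g : R -> R * R -> R).

Lemma sqr_diff_le (a b c : R) : (a * b) ^+ 2 <= c^-1 * a ^+ 4 + c * b ^+ 4 \/ c <= 0.
Proof.
have [c0|c0] := leP c 0; [by right|left].
rewrite exprMn (_ : a ^+ 4 = (a ^+ 2) ^+ 2); last by ring.
rewrite (_ : b ^+ 4 = (b ^+ 2) ^+ 2); last by ring.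
move: (a ^+ 2) (b ^+ 2) => x y; rewrite -subr_ge0.
rewrite (_ : _ - _ = c^-1 * ((x - c * y / 2) ^+ 2 + 3 / 4 * (c * y) ^+ 2)).
  apply: mulr_ge0; first by rewrite invr_ge0 ltW.
  by apply: addr_ge0; [exact: sqr_ge0|apply: mulr_ge0; [rewrite divr_ge0|exact: sqr_ge0]].
by field; rewrite gt_eqF.
Qed.

Lemma mollify_small (w : R -> R * R -> R) : jmeas w -> Qfin 2 w ->
  forall k : R, 0 < k -> exists2 d : R, 0 < d & forall e (m : mollifier e), 0 < e -> e <= d ->
  (\int[lam1]_t \int[lam2]_x ((conv (w t) (rho m) x - w t x) ^+ 2)%:E <= k%:E)%E.
Proof.
move=> mw woo k k0.
have woo' : (\int[lam1]_t \int[lam2]_x (`|w t x| ^+ 2)%:E < +oo)%E.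
  by under eq_integral do under eq_integral do rewrite real_normK ?num_real//.
have [d d0 hd] := translation_unif (p := 1) mw woo' k0.
exists d => // e m e0 ed.
pose G t x y := (w t y - w t x) ^+ 2.
have mG : measurable_fun setT (fun u : R * ((R * R) * (R * R)) => G u.1 u.2.1 u.2.2).
  have h1 : measurable_fun setT (fun u : R * ((R * R) * (R * R)) => w u.1 u.2.1).
    by apply: (measurableT_comp mw (g := fun u : R * ((R * R) * (R * R)) => (u.1, u.2.1))); mfun.
  have h2 : measurable_fun setT (fun u : R * ((R * R) * (R * R)) => w u.1 u.2.2).
    by apply: (measurableT_comp mw (g := fun u : R * ((R * R) * (R * R)) => (u.1, u.2.2))); mfun.
  by rewrite /G; mfun.
have G0 t x y : 0 <= G t x y by exact: sqr_ge0.
apply: le_trans (@average_bound _ _ m _ _ mG G0 (ltW k0) _); last first.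
  move=> z z1 z2; apply: le_trans (hd z.1 z.2 (le_trans z1 ed) (le_trans z2 ed)).
  rewrite le_eqVlt; apply/orP; left; apply/eqP.
  by apply: eq_integral => t _; apply: eq_integral => x _; rewrite /G real_normK ?num_real.
have mr := measurable_rho m; have r0 := rho_ge0 m.
have mc := jmeas_conv mw mr.
have mGr : measurable_fun setT (fun u : (R * (R * R)) * (R * R) => G u.1.1 u.1.2 u.2 * rho m (dif u.2 u.1.2)).
  have h := measurableT_comp mG (g := fun u : (R * (R * R)) * (R * R) => (u.1.1, (u.1.2, u.2))).
  by apply: measurable_funM; [apply: h; mfun|mfun].
have mGt t : measurable_fun setT (fun u : (R * R) * (R * R) => G t u.1 u.2 * rho m (dif u.2 u.1)).
  by apply: (measurableT_comp mGr (g := fun u : (R * R) * (R * R) => ((t, u.1), u.2))); mfun.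
have Gr0 t x y : 0 <= G t x y * rho m (dif y x) by exact: mulr_ge0.
have mI : measurable_fun setT (fun v : R * (R * R) => \int[lam2]_y (G v.1 v.2 y * rho m (dif y v.2))%:E)%E.
  exact: (measurable_tonelliF lam2 (f := fun (v : R * (R * R)) y => G v.1 v.2 y * rho m (dif y v.2)) mGr (fun v y => Gr0 _ _ _)).
have mwE t x : 0 <= w t x ^+ 2 by exact: sqr_ge0.
apply: ae_ge0_le_integral => //.
- by move=> t _; apply: integral_ge0 => x _; rewrite lee_fin sqr_ge0.
- apply: (measurable_slice_int (f := fun t x => (conv (w t) (rho m) x - w t x) ^+ 2)).
    by mfun.
  by move=> t x; exact: sqr_ge0.
- by move=> t _; apply: integral_ge0 => x _; apply: integral_ge0 => y _; rewrite lee_fin.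
- apply: (measurable_fun_fubini_tonelli_F (fun v : R * (R * R) => \int[lam2]_y (G v.1 v.2 y * rho m (dif y v.2))%:E)%E) => //.
  by move=> v; apply: integral_ge0 => y _; rewrite lee_fin.
apply: filterS (Qfin_ae mw mwE woo) => t wt _.
have mwt := jmeas_slice t mw.
apply: ge0_le_integral => //.
- by move=> x _; rewrite lee_fin sqr_ge0.
- by have h := jmeas_slice (f := fun t => conv (w t) (rho m)) t mc; mfun.
- exact: (measurable_tonelliF lam2 (f := fun x y => G t x y * rho m (dif y x)) (mGt t) (Gr0 t)).
- by move=> x _; exact: (jensen_rho m (w t x) x e0).
Qed.

(** At x the commutator is the rho-average of (b(y) - b(x)) w(y). Jensen and [average_bound] leave
    the square of (b(x+z) - b(x)) w(x+z), split by a weighted Young inequality into a translation of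
    b in L^4 and the L^4 norm of w. *)
Lemma commutator_small (b w : R -> R * R -> R) : jmeas b -> jmeas w ->
  Qfin 4 b -> Qfin 2 w -> Qfin 4 w ->
  forall k : R, 0 < k -> exists2 d : R, 0 < d & forall e (m : mollifier e), 0 < e -> e <= d ->
  (\int[lam1]_t \int[lam2]_x
    ((conv (fun y => b t y * w t y) (rho m) x - b t x * conv (w t) (rho m) x) ^+ 2)%:E <= k%:E)%E.
Proof.
move=> mb mw boo w2oo w4oo k k0.
have w4p t x : 0 <= w t x ^+ 4 by exact: expr4_ge0.
have b4p t x : 0 <= b t x ^+ 4 by exact: expr4_ge0.
have mw4 : jmeas (fun t x => w t x ^+ 4) by mfun.
pose W4 := fine (\int[lam1]_t \int[lam2]_x (w t x ^+ 4)%:E)%E.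
have W4E : (\int[lam1]_t \int[lam2]_x (w t x ^+ 4)%:E = W4%:E)%E.
  by rewrite fineK// ge0_fin_numE// Qint_ge0.
have W40 : 0 <= W4 by rewrite -lee_fin -W4E Qint_ge0.
(* This weight makes the term in w at most k / 2; the translations of b are then required to be at
   most c k / 2, which c^-1 turns into k / 2. *)
pose c := k / 2 / (W4 + 1).
have W41 : 0 < W4 + 1 by rewrite ltr_wpDl.
have c0 : 0 < c by rewrite !divr_gt0.
have boo' : (\int[lam1]_t \int[lam2]_x (`|b t x| ^+ 4)%:E < +oo)%E.
  rewrite [ltLHS](_ : _ = (\int[lam1]_t \int[lam2]_x (b t x ^+ 4)%:E)%E); first exact: boo.
  by apply: eq_integral => t _; apply: eq_integral => x _; rewrite -expr4_norm.
have ck0 : 0 < c * (k / 2) by rewrite mulr_gt0// divr_gt0.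
have [d d0 hd] := translation_unif (p := 3) mb boo' ck0.
exists d => // e m e0 ed.
pose G t x y := ((b t y - b t x) * w t y) ^+ 2.
have jj f : jmeas f -> measurable_fun setT (fun u : R * ((R * R) * (R * R)) => f u.1 u.2.1) /\
    measurable_fun setT (fun u : R * ((R * R) * (R * R)) => f u.1 u.2.2).
  move=> mf; split.
    by apply: (measurableT_comp mf (g := fun u : R * ((R * R) * (R * R)) => (u.1, u.2.1))); mfun.
  by apply: (measurableT_comp mf (g := fun u : R * ((R * R) * (R * R)) => (u.1, u.2.2))); mfun.
have mG : measurable_fun setT (fun u : R * ((R * R) * (R * R)) => G u.1 u.2.1 u.2.2).
  by have [h1 h2] := jj b mb; have [h3 h4] := jj w mw; rewrite /G; mfun.
have G0 t x y : 0 <= G t x y by exact: sqr_ge0.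
apply: le_trans (@average_bound _ _ m _ _ mG G0 (ltW k0) _); last first.
  move=> z z1 z2.
  have msh f : jmeas f -> jmeas (fun t x => f t (add x z)).
    by move=> mf; apply: (measurableT_comp mf (g := fun v : R * (R * R) => (v.1, add v.2 z))); mfun.
  have mbz := msh b mb; have mwz := msh w mw.
  have ci : 0 <= c^-1 by rewrite invr_ge0 ltW.
  apply: (@le_trans _ _ (\int[lam1]_t \int[lam2]_x
    (c^-1 * `|b t (add x z) - b t x| ^+ 4 + c * w t (add x z) ^+ 4)%:E)%E).
    apply: le_Qint => [||t x|t x].
    - by rewrite /G; mfun.
    - by mfun.
    - exact: G0.
    - rewrite /G -expr4_norm; have [//|] := sqr_diff_le (b t (add x z) - b t x) (w t (add x z)) c.
      by rewrite leNgt c0.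
  rewrite QintD; [|by mfun|by mfun|by move=> t x; rewrite mulr_ge0// exprn_ge0|by move=> t x; rewrite mulr_ge0// ltW].
  rewrite QintZ//; last by mfun.
  rewrite (QintZ (f := fun t x => w t (add x z) ^+ 4)); [|by mfun|by move=> t x; exact: expr4_ge0|exact: ltW].
  rewrite (Qint_shift z mw4 w4p) W4E.
  have h := hd z.1 z.2 (le_trans z1 ed) (le_trans z2 ed).
  apply: (@le_trans _ _ (c^-1%:E * (c * (k / 2))%:E + c%:E * W4%:E)%E).
    by apply: leeD => //; apply: lee_wpmul2l; rewrite ?lee_fin.
  rewrite -!EFinM -EFinD lee_fin mulKf ?gt_eqF//.
  have : c * W4 <= k / 2.
    rewrite /c -mulrA ler_piMr//; first by rewrite ltW// divr_gt0.
    by rewrite mulrC ler_pdivrMr// mul1r lerDl.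
  by clear -k0; lra.
have mr := measurable_rho m; have r0 := rho_ge0 m.
have mbw : jmeas (fun t x => b t x * w t x) by mfun.
have mc1 := jmeas_conv (f := fun t x => b t x * w t x) mbw mr; have mc := jmeas_conv mw mr.
have mGr : measurable_fun setT (fun u : (R * (R * R)) * (R * R) => G u.1.1 u.1.2 u.2 * rho m (dif u.2 u.1.2)).
  have h := measurableT_comp mG (g := fun u : (R * (R * R)) * (R * R) => (u.1.1, (u.1.2, u.2))).
  by apply: measurable_funM; [apply: h; mfun|mfun].
have mGt t : measurable_fun setT (fun u : (R * R) * (R * R) => G t u.1 u.2 * rho m (dif u.2 u.1)).
  by apply: (measurableT_comp mGr (g := fun u : (R * R) * (R * R) => ((t, u.1), u.2))); mfun.
have Gr0 t x y : 0 <= G t x y * rho m (dif y x) by exact: mulr_ge0.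
have mI : measurable_fun setT (fun v : R * (R * R) => \int[lam2]_y (G v.1 v.2 y * rho m (dif y v.2))%:E)%E.
  exact: (measurable_tonelliF lam2 (f := fun (v : R * (R * R)) y => G v.1 v.2 y * rho m (dif y v.2)) mGr (fun v y => Gr0 _ _ _)).
have w2p t x : 0 <= w t x ^+ 2 by exact: sqr_ge0.
apply: ae_ge0_le_integral => //.
- by move=> t _; apply: integral_ge0 => x _; rewrite lee_fin sqr_ge0.
- apply: (measurable_slice_int (f := fun t x => (conv (fun y => b t y * w t y) (rho m) x - b t x * conv (w t) (rho m) x) ^+ 2)).
    by mfun.
  by move=> t x; exact: sqr_ge0.
- by move=> t _; apply: integral_ge0 => x _; apply: integral_ge0 => y _; rewrite lee_fin.
- apply: (measurable_fun_fubini_tonelli_F (fun v : R * (R * R) => \int[lam2]_y (G v.1 v.2 y * rho m (dif y v.2))%:E)%E) => //.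
  by move=> v; apply: integral_ge0 => y _; rewrite lee_fin.
apply: filterS2 (filterI (Qfin_ae mw w2p w2oo) (Qfin_ae mw w4p w4oo)) (Qfin_ae mb b4p boo) => t [w2t w4t] b4t _.
have mwt := jmeas_slice t mw; have mbt := jmeas_slice t mb.
have bwL2 : L2fun (fun y => b t y * w t y) by exact: mul_L2fun.
have [M M0 [k00 _ _ _ _]] := moll_kern m e0.
apply: ge0_le_integral => //.
- by move=> x _; rewrite lee_fin sqr_ge0.
- have h1 := jmeas_slice (f := fun t => conv (fun y => b t y * w t y) (rho m)) t mc1.
  by have h2 := jmeas_slice (f := fun t => conv (w t) (rho m)) t mc; mfun.
- exact: (measurable_tonelliF lam2 (f := fun x y => G t x y * rho m (dif y x)) (mGt t) (Gr0 t)).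
- move=> x _.
  (* Here x is fixed and b t x is a constant, so it is enough that w t and b t * w t are in L^2. *)
  have gL2 : L2fun (fun y => (b t y - b t x) * w t y).
    split; first by mfun.
    apply: (@le_lt_trans _ _ (\int[lam2]_y (2 * (b t y * w t y) ^+ 2 + 2 * b t x ^+ 2 * w t y ^+ 2)%:E)%E).
      apply: le_ge0_integralT => //; [by mfun|by mfun|by move=> y; exact: sqr_ge0|].
      move=> y; rewrite -subr_ge0 (_ : _ - _ = ((b t y + b t x) * w t y) ^+ 2) ?sqr_ge0//.
      ring.
    rewrite ge0_integralDT; [|by mfun|by mfun|by move=> y; rewrite mulr_ge0 ?sqr_ge0|by move=> y; rewrite mulr_ge0 ?sqr_ge0// mulr_ge0 ?sqr_ge0].
    rewrite ge0_integralZlT//; [|by mfun|by move=> y; exact: sqr_ge0].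
    rewrite ge0_integralZlT//; [|by mfun|by rewrite mulr_ge0 ?sqr_ge0].
    have [_ bwoo] := bwL2.
    by apply: lte_add_pinfty; apply: lte_mul_pinfty => //; rewrite lee_fin mulr_ge0 ?sqr_ge0.
  have := jensen_rho m 0 x e0 gL2; rewrite subr0.
  have -> : conv (fun y => (b t y - b t x) * w t y) (rho m) x =
     conv (fun y => b t y * w t y) (rho m) x - b t x * conv (w t) (rho m) x.
    have i1 := itg_kern x (ltW e0) k00 M0 mwt w2t.
    have i2 := itg_kern x (ltW e0) k00 M0 bwL2.1 bwL2.2.
    rewrite /conv -(RintZ _ i1) -(RintB i2 (itgZ _ i1)).
    by apply: eq_Rintegral => y _; rewrite /rho -mulrA mulrBl mulrA; ring.
  move=> h; apply: (le_trans h); rewrite le_eqVlt; apply/orP; left; apply/eqP.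
  by apply: eq_integral => y _; rewrite subr0.
Qed.

End vanishing.

Lemma le_Rint_ae_ge0 d (X : measurableType d) (R : realType)
    (m : {measure set X -> \bar R}) (f : X -> R) (G : X -> \bar R) :
  itg m f -> measurable_fun setT G -> (forall t, 0 <= G t)%E ->
  {ae m, forall t, ((f t)%:E <= G t)%E} ->
  ((\int[m]_t f t)%:E <= \int[m]_t G t)%E.
Proof.
move=> hf mG G0 fG; have mf := itg_measurable hf.
rewrite -(RintE hf) integralE.
apply: (@le_trans _ _ (\int[m]_t ((fun t => (f t)%:E) ^\+ t))%E).
  by rewrite -[leRHS]adde0 leeD2l// oppe_le0 integral_ge0.
apply: ae_ge0_le_integral => //.
- by apply: measurable_funepos; mfun.
- by apply: filterS fG => t ft _; rewrite funeposE ge_max ft G0.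
Qed.

Lemma sqr_le_split (R : realType) (a b : R) : b ^+ 2 <= 2 * (a - b) ^+ 2 + 2 * a ^+ 2.
Proof. by have := sqr_ge0 (2 * a - b); nra. Qed.

(** * Energy estimate in space-time and vanishing of the difference *)

Section spacetime_energy.
Context {R : realType}.
Local Notation jmeas f := (measurable_fun setT (fun v : R * (R * R) => f v.1 v.2)).
Variables (T nu : R) (b1 b2 w : R -> R * R -> R).

(** This is nu Lap W - div ((b w) * rho): the plus sign in front of the drift comes from the kernel
    being evaluated at y - x. *)
Definition rhs_conv e (m : mollifier e) t x : R :=
  nu * (conv (w t) (ten (eta2 m) (eta0 m)) x + conv (w t) (ten (eta0 m) (eta2 m)) x) +
  (conv (fun y => b1 t y * w t y) (ten (eta1 m) (eta0 m)) x +
   conv (fun y => b2 t y * w t y) (ten (eta0 m) (eta1 m)) x).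

Hypotheses (T0 : 0 < T) (nu0 : 0 < nu) (mb1 : jmeas b1) (mb2 : jmeas b2) (mw : jmeas w)
  (b1oo : Qfin 4 b1) (b2oo : Qfin 4 b2) (w2oo : Qfin 2 w) (w4oo : Qfin 4 w)
  (wT : forall t y, ~~ (0 < t < T) -> w t y = 0)
  (divb : {ae lam1, forall t, divfree (b1 t) (b2 t)})
  (weak : forall e (m : mollifier e) x a, 0 < e -> a < T ->
    \int[lam1]_t (3 * ramp (a - t) ^+ 2 * conv (w t) (rho m) x) =
    \int[lam1]_t (ramp (a - t) ^+ 3 * rhs_conv m t x)).

Lemma mul_Qfin b : jmeas b -> Qfin 4 b -> Qfin 2 (fun t y => b t y * w t y).
Proof.
move=> mb boo.
have e4 (f : R -> R * R -> R) t x : 0 <= f t x ^+ 4 by exact: expr4_ge0.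
apply: (@le_lt_trans _ _ (\int[lam1]_t \int[lam2]_x (b t x ^+ 4 + w t x ^+ 4)%:E)%E).
  apply: le_Qint => [||t x|t x]; [by mfun|by mfun|exact: sqr_ge0|].
  rewrite exprMn (_ : b t x ^+ 4 = (b t x ^+ 2) ^+ 2); last by ring.
  rewrite (_ : w t x ^+ 4 = (w t x ^+ 2) ^+ 2); last by ring.
  by move: (b t x ^+ 2) (w t x ^+ 2) => r s; nra.
have m1 : jmeas (fun t x => b t x ^+ 4) by mfun.
have m2 : jmeas (fun t x => w t x ^+ 4) by mfun.
by rewrite (QintD m1 m2 (e4 b) (e4 w)); exact: (lte_add_pinfty boo w4oo).
Qed.

(** The time identity is used at each fixed x and the energy inequality at almost every t; Fubini
    joins them. The weight T - t is replaced by T only after the spatial integral has been bounded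
    by a nonnegative quantity. *)
Lemma spacetime_energy e (m : mollifier e) : 0 < e ->
  (\int[lam1]_t \int[lam2]_x (conv (w t) (rho m) x ^+ 2)%:E <=
   (2 * (T * (4 * nu)^-1))%:E * \int[lam1]_t \int[lam2]_x
     ((conv (fun y => b1 t y * w t y) (rho m) x - b1 t x * conv (w t) (rho m) x) ^+ 2 +
      (conv (fun y => b2 t y * w t y) (rho m) x - b2 t x * conv (w t) (rho m) x) ^+ 2)%:E)%E.
Proof.
move=> e0; have [M M0 [k00 k10 k01 k20 k02]] := moll_kern m e0; have e0' := ltW e0.
have mbw1 : jmeas (fun t y => b1 t y * w t y) by mfun.
have mbw2 : jmeas (fun t y => b2 t y * w t y) by mfun.
have bw1 := mul_Qfin mb1 b1oo; have bw2 := mul_Qfin mb2 b2oo.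
have bwT b t y : ~~ (0 < t < T) -> b t y * w t y = 0 by move=> /wT ->; rewrite mulr0.
pose W t x := conv (w t) (rho m) x; pose h t x := rhs_conv m t x.
have conv0 (f : R * R -> R) al x : (forall y, f y = 0) -> conv f al x = 0.
  by move=> f0; rewrite /conv -[RHS](Rint0 lam2); apply: eq_Rintegral => y _; rewrite f0 mul0r.
have WT t x : W t x != 0 -> 0 < t < T.
  by apply: contraNT => tT; apply/eqP; apply: conv0 => y; exact: wT.
have hT t x : h t x != 0 -> 0 < t < T.
  apply: contraNT => tT; apply/eqP; rewrite /h /rhs_conv !conv0 ?addr0 ?mulr0// => y;
    [exact: (bwT b2)|exact: (bwT b1)|exact: wT|exact: wT].
have iW x : itg lam1 (W^~ x) by exact: (itg_conv_time x T0 e0' M0 k00 mw w2oo wT).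
have ih x : itg lam1 (h^~ x).
  apply: itgD.
    by apply: itgZ; apply: itgD; [exact: (itg_conv_time x T0 e0' M0 k20 mw w2oo wT)|exact: (itg_conv_time x T0 e0' M0 k02 mw w2oo wT)].
  by apply: itgD; [exact: (itg_conv_time x T0 e0' M0 k10 mbw1 bw1 (bwT b1))|exact: (itg_conv_time x T0 e0' M0 k01 mbw2 bw2 (bwT b2))].
have iWW : itg2 lam1 lam2 (fun t x => W t x ^+ 2).
  have := itg2_conv2 e0' M0 k00 k00 mw mw w2oo w2oo.
  by congr (itg2 _ _ _); apply/funext => t; apply/funext => x; rewrite expr2.
have ihW : itg2 lam1 lam2 (fun t x => h t x * W t x).
  have j1 := itg2_conv2 e0' M0 k20 k00 mw mw w2oo w2oo.
  have j2 := itg2_conv2 e0' M0 k02 k00 mw mw w2oo w2oo.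
  have j3 := itg2_conv2 e0' M0 k10 k00 mbw1 mw bw1 w2oo.
  have j4 := itg2_conv2 e0' M0 k01 k00 mbw2 mw bw2 w2oo.
  have := itgD (itgZ nu (itgD j1 j2)) (itgD j3 j4).
  congr (itg _ _); apply/funext => v; rewrite /h /W /rhs_conv -/(rho m).
  by move: (conv _ _ _) (conv _ _ _) (conv _ _ _) (conv _ _ _) (conv _ _ _) => *; ring.
have iThW : itg2 lam1 lam2 (fun t x => (T - t) * (h t x * W t x)).
  apply: (itg_dom _ (itgZ T (itg_norm ihW))).
    by have mh := itg2_measurable ihW; apply: measurable_funM => //; mfun.
  move=> [t x] /=; have [->|/hT/andP[t0 tT]] := eqVneq (h t x) 0.
    by rewrite mul0r normr0 !mulr0 normr0.
  by rewrite normrM ler_wpM2r// ger0_norm ?subr_ge0 ?ltW// gtrBl.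
have timeid x := time_identity T0 (iW x) (ih x) (WT^~ x) (hT^~ x) (fun a => weak m x e0).
have E : \int[lam1]_t \int[lam2]_x (W t x ^+ 2) =
    2 * \int[lam1]_t ((T - t) * \int[lam2]_x (h t x * W t x)).
  rewrite (RFubini iWW).
  transitivity (2 * \int[lam2]_x \int[lam1]_t ((T - t) * (h t x * W t x))).
    rewrite -RintZ; last exact: itg2_itg2 iThW.
    by apply: eq_Rintegral => x _; have [_ _] := timeid x.
  rewrite -(RFubini iThW); congr (_ * _).
  rewrite /Rintegral; congr fine; apply: ae_eq_integral => //.
  - exact: measurable_int (itg2_itg1 iThW).
  - have := itg_measurable (itg2_itg1 ihW) => mI.
    apply/measurable_EFinP; apply: measurable_funM; first by mfun.
    exact: mI.
  - by apply: filterS (itg2_ae1 ihW) => t ht _; congr EFin; exact: (RintZ _ ht).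
pose D t x := (conv (fun y => b1 t y * w t y) (rho m) x - b1 t x * W t x) ^+ 2 +
      (conv (fun y => b2 t y * w t y) (rho m) x - b2 t x * W t x) ^+ 2.
have D0 t x : 0 <= D t x by rewrite addr_ge0 ?sqr_ge0.
have mr := measurable_rho m.
have mD : jmeas D.
  have h1 := jmeas_conv (f := fun t y => b1 t y * w t y) mbw1 mr.
  have h2 := jmeas_conv (f := fun t y => b2 t y * w t y) mbw2 mr.
  by have h3 := jmeas_conv mw mr; rewrite /D /W; mfun.
have nu4 : 0 <= (4 * nu)^-1 by rewrite invr_ge0 mulr_ge0// ltW.
have hW0 t : ~~ (0 < t < T) -> \int[lam2]_x (h t x * W t x) = 0.
  move=> tT; rewrite -[RHS](Rint0 lam2); apply: eq_Rintegral => x _.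
  by have [->|/hT ht] := eqVneq (h t x) 0; [rewrite mul0r|rewrite ht in tT].
have ig : itg lam1 (fun t => (T - t) * \int[lam2]_x (h t x * W t x)).
  have ih1 := itg2_itg1 ihW; have mh1 := itg_measurable ih1.
  apply: (itg_dom _ (itgZ T (itg_norm ih1))).
    by apply: measurable_funM; [mfun|exact: mh1].
  move=> t; have [/andP[t0 tT]|/hW0 ->] := boolP (0 < t < T).
    by rewrite normrM ler_wpM2r// ger0_norm ?subr_ge0 ?ltW// gtrBl.
  by rewrite mulr0 !normr0 mulr0.
have key : ((\int[lam1]_t ((T - t) * \int[lam2]_x (h t x * W t x)))%:E <=
    \int[lam1]_t \int[lam2]_x (T * ((4 * nu)^-1 * D t x))%:E)%E.
  have TD0 t x : 0 <= T * ((4 * nu)^-1 * D t x) by rewrite mulr_ge0 ?(ltW T0)// mulr_ge0.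
  have mTD : jmeas (fun t x => T * ((4 * nu)^-1 * D t x)) by mfun.
  apply: le_Rint_ae_ge0 => //.
  - exact: measurable_slice_int.
  - by move=> t; apply: integral_ge0 => x _; rewrite lee_fin.
  have e4 (f : R -> R * R -> R) t x : 0 <= f t x ^+ 4 by exact: expr4_ge0.
  have w2p t x : 0 <= w t x ^+ 2 by exact: sqr_ge0.
  apply: filterS2 (filterI (filterI (Qfin_ae mw w2p w2oo) (Qfin_ae mw (e4 w) w4oo)) divb)
    (filterI (Qfin_ae mb1 (e4 b1) b1oo) (Qfin_ae mb2 (e4 b2) b2oo)) => t [[w2t w4t] dt] [b1t b2t].
  have [/andP[t0 tT]|/hW0 ->] := boolP (0 < t < T); last first.
    by rewrite mulr0; apply: integral_ge0 => x _; rewrite lee_fin.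
  have [_ en] := energy_inequality m e0 nu0 (jmeas_slice t mb1) (jmeas_slice t mb2)
    (jmeas_slice t mw) b1t b2t w2t w4t dt.
  have mDt := jmeas_slice t mD.
  rewrite ge0_integralZlT ?(ltW T0)//; last 2 first.
  - by mfun.
  - by move=> x; rewrite mulr_ge0.
  rewrite EFinM; apply: (@le_trans _ _ ((T - t)%:E * \int[lam2]_x ((4 * nu)^-1 * D t x)%:E)%E).
    by apply: lee_wpmul2l; [rewrite lee_fin subr_ge0 ltW|exact: en].
  apply: lee_wpmul2r; last by rewrite lee_fin gerBl ltW.
  by apply: integral_ge0 => x _; rewrite lee_fin mulr_ge0.
rewrite (itg2_RintE iWW) E EFinM.
have -> : ((2 * (T * (4 * nu)^-1))%:E = 2%:E * (T * (4 * nu)^-1)%:E)%E by rewrite -EFinM.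
rewrite -muleA.
apply: lee_wpmul2l; first by rewrite lee_fin.
apply: (le_trans key); rewrite QintZ; [|by mfun|by move=> t x; rewrite mulr_ge0|exact: ltW].
by rewrite QintZ// muleA -EFinM.
Qed.

Lemma vanishing : (\int[lam1]_t \int[lam2]_x (w t x ^+ 2)%:E = 0)%E.
Proof.
apply/eqP; rewrite eq_le Qint_ge0 ?andbT; last by move=> t x; exact: sqr_ge0.
apply/lee_addgt0Pr => k k0; rewrite add0e.
pose C := 2 * (T * (4 * nu)^-1).
have C0 : 0 <= C by rewrite mulr_ge0// mulr_ge0 ?(ltW T0)// invr_ge0 mulr_ge0// ltW.
(* The final bound is 2 k1 + 2 C (k1 + k1) = 2 k1 (1 + 2 C) = k. *)
pose k1 := k / 2 / (1 + 2 * C).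
have c10 : 0 < 1 + 2 * C by rewrite ltr_pwDl// mulr_ge0.
have k10 : 0 < k1 by rewrite !divr_gt0.
have [d1 d10 h1] := mollify_small mw w2oo k10.
have [d2 d20 h2] := commutator_small mb1 mw b1oo w2oo w4oo k10.
have [d3 d30 h3] := commutator_small mb2 mw b2oo w2oo w4oo k10.
pose e := Num.min d1 (Num.min d2 d3).
have e0 : 0 < e by rewrite !lt_min d10 d20.
have [m _] := mollifier_exists e0.
have {}h1 := h1 e m e0; have {}h2 := h2 e m e0; have {}h3 := h3 e m e0.
rewrite ge_min lexx in h1; rewrite !ge_min lexx orbT in h2; rewrite !ge_min lexx !orbT in h3.
have {}h1 := h1 isT; have {}h2 := h2 isT; have {}h3 := h3 isT.
have mr := measurable_rho m.
have mW := jmeas_conv mw mr.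
have mbw1 : jmeas (fun t y => b1 t y * w t y) by mfun.
have mbw2 : jmeas (fun t y => b2 t y * w t y) by mfun.
have mV1 := jmeas_conv (f := fun t y => b1 t y * w t y) mbw1 mr.
have mV2 := jmeas_conv (f := fun t y => b2 t y * w t y) mbw2 mr.
have := spacetime_energy m e0; rewrite -/C.
rewrite QintD; last 4 first.
- by mfun.
- by mfun.
- by move=> t x; exact: sqr_ge0.
- by move=> t x; exact: sqr_ge0.
move=> hE; have {}hE := le_trans hE (lee_wpmul2l _ (leeD h2 h3)).
have {}hE : (\int[lam1]_t \int[lam2]_x (conv (w t) (rho m) x ^+ 2)%:E <= (C * (k1 + k1))%:E)%E.
  by rewrite EFinM; apply: hE; rewrite lee_fin.
apply: (@le_trans _ _ (\int[lam1]_t \int[lam2]_x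
  (2 * (conv (w t) (rho m) x - w t x) ^+ 2 + 2 * conv (w t) (rho m) x ^+ 2)%:E)%E).
  apply: le_Qint => [||t x|t x].
  - by mfun.
  - by mfun.
  - exact: sqr_ge0.
  - exact: sqr_le_split.
have s2 (f : R -> R * R -> R) t x : 0 <= 2 * f t x ^+ 2 by rewrite mulr_ge0 ?sqr_ge0.
rewrite QintD; [|by mfun|by mfun|by move=> t x; rewrite mulr_ge0 ?sqr_ge0|by move=> t x; rewrite mulr_ge0 ?sqr_ge0].
rewrite (QintZ (f := fun t x => (conv (w t) (rho m) x - w t x) ^+ 2)); [|by mfun|by move=> t x; exact: sqr_ge0|by []].
rewrite (QintZ (f := fun t x => conv (w t) (rho m) x ^+ 2)); [|by mfun|by move=> t x; exact: sqr_ge0|by []].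
apply: (@le_trans _ _ (2%:E * k1%:E + 2%:E * (C * (k1 + k1))%:E)%E).
  have two0 : (0 <= 2%:E :> \bar R)%E by rewrite lee_fin.
  by apply: leeD; apply: (lee_wpmul2l two0); [exact: h1|exact: hE].
rewrite -!EFinM -EFinD lee_fin.
have eq_k1 (x y : R) : 2 * x + 2 * (y * (x + x)) = x * (1 + 2 * y) * 2 by ring.
rewrite eq_k1.
by rewrite /k1 divfK ?gt_eqF// divfK.
Qed.

End spacetime_energy.

(** * The Biot-Savart field of the given solution *)

Section transfer.
Context {R : realType}.
Local Notation jmeas f := (measurable_fun setT (fun v : R * (R * R) => f v.1 v.2)).

Lemma ge0_integral_leb2 (f : R * R -> \bar R) : measurable_fun setT f ->
  (forall x, 0 <= f x)%E -> (\int[@leb2 R]_x f x = \int[lam2]_x f x)%E.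
Proof.
move=> mf f0.
rewrite (fubini_tonelli1 (m1 := @lebesgue_measure R) (m2 := @lebesgue_measure R) f)//.
rewrite (fubini_tonelli1 (m1 := @lam1 R) (m2 := @lam1 R) f)//.
have mF := measurable_fun_fubini_tonelli_F (T1 := R) (m2 := @lam1 R) f mf f0.
rewrite [RHS]ge0_integral_lam1//; last first.
  by move=> x _; apply: integral_ge0.
apply: eq_integral => x _; rewrite /fubini_F ge0_integral_lam1//.
exact: (measurableT_comp mf (measurable_pair1 x)).
Qed.

Lemma integral_leb2 (f : R * R -> \bar R) : measurable_fun setT f ->
  (\int[@leb2 R]_x f x = \int[lam2]_x f x)%E.
Proof.
move=> mf; rewrite [LHS]integralE [RHS]integralE.
by rewrite -!ge0_integral_leb2//; [exact: measurable_funeneg|exact: measurable_funepos].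
Qed.

Lemma Rint_leb2 (f : R * R -> R) : measurable_fun setT f ->
  \int[@leb2 R]_x f x = \int[lam2]_x f x.
Proof. by move=> mf; rewrite /Rintegral integral_leb2//; mfun. Qed.

Lemma Rint_leb1 (T : R) (f : R -> R) : measurable_fun setT f ->
  \int[@leb1 R]_(t in `]0, T[) f t = \int[lam1]_t ((if (0 < t) && (t < T) then 1 else 0) * f t).
Proof.
move=> mf; rewrite /leb1 Rint_lebesgue//; apply: eq_Rintegral => t _; congr (_ * _).
by rewrite indicE mem_setE in_itv/=; case: (_ && _).
Qed.

Lemma integral_leb1 (T : R) (f : R -> \bar R) : measurable_fun setT f -> (forall t, 0 <= f t)%E ->
  (\int[@leb1 R]_(t in `]0%R, T[) f t =
   \int[lam1]_t ((if (0 < t) && (t < T) then 1 else 0)%R%:E * f t))%E.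
Proof.
move=> mf f0; rewrite integral_mkcond /leb1 -ge0_integral_lam1//; last 2 first.
- by apply/(measurable_restrictT _ _).1 => //; exact: measurable_funTS.
- by move=> t _; rewrite patchE; case: ifP.
apply: eq_integral => t _; rewrite patchE mem_setE in_itv/=.
by case: ifP => _; rewrite ?mul1e ?mul0e.
Qed.

End transfer.

Section norms.
Context {R : realType}.
Local Notation jmeas f := (measurable_fun setT (fun v : R * (R * R) => f v.1 v.2)).

Definition itvI (T t : R) : R := if (0 < t) && (t < T) then 1 else 0.

Lemma itvI_ge0 T t : 0 <= itvI T t. Proof. by rewrite /itvI; case: ifP. Qed.

Lemma measurable_itvI T : 0 < T -> measurable_fun setT (itvI T).
Proof. by move=> T0; exact: itg_measurable (itg_itv01 T0). Qed.

(** Removes the real exponent of a norm: the fourth power of the L^4 norm is the integral itself (c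
    = 1/4), that of the L^(4/3) norm is the cube of the integral (c = 3/4). *)
Lemma expe_poweR (z : \bar R) (c : R) (p n : nat) : (0 <= z)%E -> (0 < n)%N ->
  (0 < p)%N -> c * p%:R = n%:R -> ((z `^ c) ^+ p = z ^+ n)%E.
Proof.
move=> + n0 p0 cp; have c0 : c != 0.
  by apply: contraTneq n0 => c0; move: cp; rewrite c0 mul0r => /esym/eqP; rewrite pnatr_eq0 => /eqP ->.
have ooX (k : nat) : (0 < k)%N -> ((+oo : \bar R) ^+ k = +oo)%E.
  by case: k => // k _; elim: k => [|k IH]; rewrite ?expe1// expeS IH mulyy.
case: z => [r| |]//.
- rewrite lee_fin => r0; rewrite poweR_EFin -!EFin_expe; congr EFin.
  by rewrite -powR_mulrn ?powR_ge0// -powRrM cp powR_mulrn.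
- by move=> _; rewrite poweRyr// !ooX.
Qed.

(** Gives the s with s^3 = |z| to which the potential estimates apply; s^4 is then |z|^(4/3). *)
Definition cbrt (r : R) : R := `|r| `^ (3%:R^-1).

Lemma cbrt_ge0 r : 0 <= cbrt r. Proof. exact: powR_ge0. Qed.

Lemma cbrt3 r : cbrt r ^+ 3 = `|r|.
Proof. by rewrite -powR_mulrn ?cbrt_ge0// -powRrM mulVf ?pnatr_eq0// powRr1. Qed.

Lemma cbrt4 r : cbrt r ^+ 4 = `|r| `^ (4 / 3).
Proof. by rewrite -powR_mulrn ?cbrt_ge0// -powRrM mulrC. Qed.

Lemma measurable_cbrt : measurable_fun setT cbrt.
Proof.
by apply: (measurableT_comp (measurable_powR 3%:R^-1) (g := fun r : R => `|r|)); mfun.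
Qed.

(** Interpolation of L^2 between L^(4/3) and L^4: with s = [cbrt r] it reads s^6 <= s^12 + s^4, by
    cases on s <= 1. *)
Lemma sqr_le_cbrt r : r ^+ 2 <= r ^+ 4 + cbrt r ^+ 4.
Proof.
have e2 : r ^+ 2 = cbrt r ^+ (3 * 2) by rewrite exprM cbrt3 real_normK ?num_real.
have e4 : r ^+ 4 = cbrt r ^+ (3 * 4) by rewrite exprM cbrt3 -expr4_norm.
rewrite [leLHS]e2 [X in _ <= X + _]e4.
have := cbrt_ge0 r; move: (cbrt r) => s s0.
have [s1|/ltW s1] := leP s 1.
  apply: (@le_trans _ _ (s ^+ 4)); first exact: ler_wiXn2l.
  by rewrite lerDr exprn_ge0.
apply: (@le_trans _ _ (s ^+ (3 * 4))); first exact: ler_weXn2l.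
by rewrite lerDl exprn_ge0.
Qed.

Definition S43 (v : R * R -> R) : \bar R := (\int[lam2]_x (cbrt (v x) ^+ 4)%:E)%E.

Lemma S43_ge0 v : (0 <= S43 v)%E.
Proof. by apply: integral_ge0 => x _; rewrite lee_fin exprn_ge0// cbrt_ge0. Qed.

Lemma Lnorm4 (v : R * R -> R) : measurable_fun setT v ->
  ((Lnorm (@leb2 R) 4%:E (fun x => (v x)%:E)) ^+ 4 = \int[lam2]_x (v x ^+ 4)%:E)%E.
Proof.
move=> mv; rewrite unlock.
have E : (\int[@leb2 R]_x (`|(v x)%:E| `^ 4) = \int[lam2]_x (v x ^+ 4)%:E)%E.
  rewrite -integral_leb2; last by mfun.
  apply: eq_integral => x _.
  by rewrite /= powR_mulrn// -expr4_norm.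
rewrite E (expe_poweR (n := 1)) ?expe1//; last by rewrite mulVf ?pnatr_eq0.
by apply: integral_ge0 => x _; rewrite lee_fin expr4_ge0.
Qed.

Lemma Lnorm43 (v : R * R -> R) : measurable_fun setT v ->
  ((Lnorm (@leb2 R) (4 / 3)%:E (fun x => (v x)%:E)) ^+ 4 = (S43 v) ^+ 3)%E.
Proof.
move=> mv; have mc := measurable_cbrt; rewrite unlock.
have E : (\int[@leb2 R]_x (`|(v x)%:E| `^ (4 / 3)) = S43 v)%E.
  rewrite /S43 -integral_leb2; last by mfun.
  by apply: eq_integral => x _; rewrite /= cbrt4.
rewrite E (expe_poweR (n := 3)) ?S43_ge0//; lra.
Qed.

Variable T : R.
Hypothesis T0 : 0 < T.
Implicit Type v : R -> R * R -> R.

(** Extension by 0 outside (0, T), the only times seen by the norms, whereas the argument integrates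
    over the whole time line. *)
Definition cut v t x : R := itvI T t * v t x.

Lemma measurable_cut v : jmeas v -> jmeas (cut v).
Proof. by move=> mv; have h := measurable_itvI T0; rewrite /cut; mfun. Qed.

Lemma cutT v t x : ~~ (0 < t < T) -> cut v t x = 0.
Proof. by rewrite /cut /itvI => /negbTE ->; rewrite mul0r. Qed.

Lemma cut_id v t : 0 < t < T -> cut v t = v t.
Proof. by move=> tT; apply/funext => x; rewrite /cut /itvI tT mul1r. Qed.

Lemma Qint_cut (p : nat) v : jmeas v -> (forall t x, 0 <= v t x ^+ p.+1) ->
  (\int[lam1]_t \int[lam2]_x (cut v t x ^+ p.+1)%:E =
   \int[lam1]_t ((itvI T t)%:E * \int[lam2]_x (v t x ^+ p.+1)%:E))%E.
Proof.
move=> mv v0; apply: eq_integral => t _; rewrite /cut /itvI; case: ifP => _.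
  by rewrite mul1e; apply: eq_integral => x _; rewrite mul1r.
rewrite mul0e -[RHS](integral0 lam2 setT); apply: eq_integral => x _.
by rewrite mul0r expr0n.
Qed.

Lemma LpLq_jmeas p q v : in_LpLq p q T v -> jmeas v.
Proof. by move=> []. Qed.

Lemma LpLq_Qfin4 v : in_LpLq 4 4%:E T v -> Qfin 4 (cut v).
Proof.
move=> [mv]; rewrite /Qfin (Qint_cut (p := 3)) => //; last by move=> t x; exact: expr4_ge0.
have mv4 : jmeas (fun t x => v t x ^+ 4).
  by have h : jmeas v := mv; mfun.
under eq_integral do rewrite (Lnorm4 (jmeas_slice _ mv)).
rewrite integral_leb1//.
- by apply: (measurable_slice_int mv4) => t x; exact: expr4_ge0.
- by move=> t; apply: integral_ge0 => x _; rewrite lee_fin expr4_ge0.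
Qed.

Lemma measurable_S43 v : jmeas v -> measurable_fun setT (fun t => S43 (v t)).
Proof.
move=> mv; have mc := measurable_cbrt.
by apply: (measurable_slice_int (f := fun t x => cbrt (v t x) ^+ 4));
  [mfun|move=> t x; exact: expr4_ge0].
Qed.

Lemma measurable_S43X v : jmeas v -> measurable_fun setT (fun t => (S43 (v t) ^+ 3)%E).
Proof.
move=> mv; have mS := measurable_S43 mv.
by apply: emeasurable_funM => //; apply: emeasurable_funM.
Qed.

Lemma LpLq_S43 v : in_LpLq 4 (4 / 3)%:E T v ->
  (\int[lam1]_t ((itvI T t)%:E * (S43 (v t)) ^+ 3) < +oo)%E.
Proof.
move=> [mv]; have mS := measurable_S43 mv.
under eq_integral do rewrite (Lnorm43 (jmeas_slice _ mv)).
rewrite integral_leb1//.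
- exact: measurable_S43X.
- by move=> t; rewrite expe_ge0// S43_ge0.
Qed.

(** The cube of [S43] is what the time norm controls. The added 1 is integrable because (0, T) is
    bounded, and a finite cube forces a finite value. *)
Lemma S43_cubic (S : \bar R) : (0 <= S)%E -> (S <= 1 + S ^+ 3)%E /\
  ((0 <= S)%E /\ (S = +oo -> S ^+ 3 = +oo)%E).
Proof.
case: S => [r r0|_|//].
- split => //; rewrite -EFin_expe -EFinD lee_fin; rewrite lee_fin in r0.
  have : r <= 1 + r * (r * r) by have := sqr_ge0 (r - 1); nra.
  by rewrite !exprS expr0 mulr1.
- by rewrite !expeS expe0 mule1 !mulyy addey// leey.
Qed.

Lemma measurable_itvIe : measurable_fun setT (fun t => (itvI T t)%:E).
Proof. by have h := measurable_itvI T0; mfun. Qed.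

Lemma itvI_lty : (\int[lam1]_t (itvI T t)%:E < +oo)%E.
Proof.
have := itg_lty (itg_itv01 T0); rewrite (_ : (\int[lam1]_t `|_|%:E)%E = (\int[lam1]_t (itvI T t)%:E)%E)//.
by apply: eq_integral => t _; rewrite ger0_norm//; exact: (itvI_ge0 T t).
Qed.

Lemma LpLq_one_S43 v : in_LpLq 4 (4 / 3)%:E T v ->
  (\int[lam1]_t ((itvI T t)%:E * (1 + S43 (v t) ^+ 3)) < +oo)%E.
Proof.
move=> hv; have mv := LpLq_jmeas hv; have hS := LpLq_S43 hv.
have mI := measurable_itvIe; have mS3 := measurable_S43X mv.
have S30 t : (0 <= S43 (v t) ^+ 3)%E by rewrite expe_ge0// S43_ge0.
have -> : (\int[lam1]_t ((itvI T t)%:E * (1 + S43 (v t) ^+ 3)) =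
   \int[lam1]_t (itvI T t)%:E + \int[lam1]_t ((itvI T t)%:E * S43 (v t) ^+ 3))%E.
  rewrite -ge0_integralD//.
  - by apply: eq_integral => t _; rewrite ge0_muleDr// mule1.
  - by move=> t _; rewrite lee_fin itvI_ge0.
  - by move=> t _; rewrite mule_ge0// lee_fin itvI_ge0.
  - exact: emeasurable_funM.
by apply: lte_add_pinfty => //; exact: itvI_lty.
Qed.

Lemma LpLq_Qfin2 v : in_LpLq 4 4%:E T v -> in_LpLq 4 (4 / 3)%:E T v -> Qfin 2 (cut v).
Proof.
move=> h4 h43; have mv := LpLq_jmeas h4; have f4 := LpLq_Qfin4 h4.
have f43 := LpLq_one_S43 h43; have mc := measurable_cbrt.
have mI := measurable_itvIe; have mS3 := measurable_S43X mv.
rewrite /Qfin (Qint_cut (p := 1))//; last by move=> t x; exact: sqr_ge0.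
rewrite /Qfin (Qint_cut (p := 3) mv (fun t x => expr4_ge0 (v t x))) in f4.
have mv4 : measurable_fun setT (fun t => \int[lam2]_x (v t x ^+ 4)%:E)%E.
  by apply: (measurable_slice_int (f := fun t x => v t x ^+ 4)); [mfun|move=> t x; exact: expr4_ge0].
have mv2 : measurable_fun setT (fun t => \int[lam2]_x (v t x ^+ 2)%:E)%E.
  by apply: (measurable_slice_int (f := fun t x => v t x ^+ 2)); [mfun|move=> t x; exact: sqr_ge0].
have v40 t : (0 <= \int[lam2]_x (v t x ^+ 4)%:E)%E.
  by apply: integral_ge0 => x _; rewrite lee_fin expr4_ge0.
have v20 t : (0 <= \int[lam2]_x (v t x ^+ 2)%:E)%E.
  by apply: integral_ge0 => x _; rewrite lee_fin sqr_ge0.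
have S30 t : (0 <= S43 (v t) ^+ 3)%E by rewrite expe_ge0// S43_ge0.
have I0 t : (0 <= (itvI T t)%:E)%E by rewrite lee_fin itvI_ge0.
apply: (@le_lt_trans _ _ (\int[lam1]_t ((itvI T t)%:E * \int[lam2]_x (v t x ^+ 4)%:E +
   (itvI T t)%:E * (1 + S43 (v t) ^+ 3)))%E).
  apply: ge0_le_integral => //.
  - by move=> t _; exact: mule_ge0.
  - exact: emeasurable_funM.
  - apply: emeasurable_funD; first exact: emeasurable_funM.
    by apply: emeasurable_funM => //; apply: emeasurable_funD => //; exact: measurable_cst.
  move=> t _; rewrite -ge0_muleDr//; last by rewrite adde_ge0.
  apply: lee_wpmul2l => //.
  apply: (@le_trans _ _ (\int[lam2]_x (v t x ^+ 4)%:E + S43 (v t))%E); last first.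
    by apply: leeD2l; have [] := S43_cubic (S43_ge0 (v t)).
  have mvt := jmeas_slice t mv.
  rewrite /S43 -ge0_integralDT//; [|by mfun|by mfun|by move=> x; exact: expr4_ge0|by move=> x; exact: expr4_ge0].
  apply: le_ge0_integralT; [by mfun|by mfun|by move=> x; exact: sqr_ge0|].
  by move=> x; exact: sqr_le_cbrt.
rewrite ge0_integralD//.
- exact: lte_add_pinfty.
- by move=> t _; exact: mule_ge0.
- exact: emeasurable_funM.
- by move=> t _; rewrite mule_ge0// adde_ge0.
- by apply: emeasurable_funM => //; apply: emeasurable_funD => //; exact: measurable_cst.
Qed.

Section potential.
Variable k : R * R -> R.
Hypotheses (mk : measurable_fun setT k) (kk : forall z, `|k z| <= kap z).

Definition pot (z : R * R -> R) (x : R * R) : R :=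
  \int[lam2]_y (k (x.1 - y.1, x.2 - y.2) * z y).

Lemma measurable_pot v : jmeas v -> jmeas (fun t => pot (v t)).
Proof.
move=> mv; apply: (@measurable_Rint _ _ _ _ _ lam2
  (fun (p : R * (R * R)) y => k (p.2.1 - y.1, p.2.2 - y.2) * v p.1 y)).
have h : measurable_fun setT (fun u : (R * (R * R)) * (R * R) => v u.1.1 u.2).
  by apply: (measurableT_comp mv (g := fun u : (R * (R * R)) * (R * R) => (u.1.1, u.2))); mfun.
by mfun.
Qed.

Lemma pot_bound (z : R * R -> R) x : measurable_fun setT z ->
  ((`|pot z x|)%:E <= rpot (cbrt \o z) x)%E.
Proof.
move=> mz; have mkap := @measurable_kap R; have mc := measurable_cbrt.
have h : measurable_fun setT (fun y : R * R => (k (x.1 - y.1, x.2 - y.2) * z y)%:E) by mfun.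
apply: (@le_trans _ _ (\int[lam2]_y `|(k (x.1 - y.1, x.2 - y.2) * z y)%:E|)%E).
  have := le_abse_integral lam2 measurableT h; apply: le_trans.
  by rewrite /pot /Rintegral; case: (\int[_]_y _)%E => [r||]//=; rewrite normr0 ?lexx ?leey.
apply: le_ge0_integralT; [by mfun| |by []|].
  have mcz : measurable_fun setT (fun y => cbrt (z y)) by mfun.
  by rewrite /comp; mfun.
by move=> y; rewrite /= cbrt3 normrM mulrC ler_wpM2l.
Qed.

(** The bound 2 hlsC (1 + S)^3 is weakened to one linear in S^3, the fourth power of the L^(4/3)
    norm, so that it can be integrated in time. *)
Lemma pot_L4 (z : R * R -> R) : measurable_fun setT z ->
  (\int[lam2]_x (pot z x ^+ 4)%:E <= (8 * @hlsC R)%:E * (1 + S43 z ^+ 3))%E.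
Proof.
move=> mz; have mc := measurable_cbrt.
have C0 : 0 <= @hlsC R by rewrite /hlsC; lra.
have mcz : measurable_fun setT (cbrt \o z) by rewrite /comp; mfun.
(* If S is infinite so is the right-hand side, [hlsC] being positive; the estimate thus holds at
   every time. *)
have [Soo|Soo] := eqVneq (S43 z) +oo%E.
  rewrite Soo !expeS expe0 mule1 !mulyy addey// gt0_muley ?leey// lte_fin /hlsC; lra.
have Sfin : S43 z \is a fin_num by rewrite ge0_fin_numE ?S43_ge0// ltey.
have S0 : 0 <= fine (S43 z) by rewrite fine_ge0// S43_ge0.
have mpot : measurable_fun setT (pot z).
  by apply: (@measurable_Rint _ _ _ _ _ lam2 (fun x y : R * R => k (x.1 - y.1, x.2 - y.2) * z y)); mfun.
have := hls_scaled mcz (fun x => cbrt_ge0 (z x)) S0 _ mpot (fun x => pot_bound x mz).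
rewrite fineK// => /(_ (lexx _)) h; apply: (le_trans h).
have -> : (S43 z ^+ 3 = (fine (S43 z))%:E ^+ 3)%E by rewrite fineK.
move: (fine _) S0 => s s0.
rewrite -EFin_expe -EFinD -EFinM lee_fin.
(* The difference factors as 3 (s - 1)^2 (s + 1). *)
have h3 : (1 + s) ^+ 3 <= 4 * (1 + s ^+ 3).
  rewrite -subr_ge0 (_ : _ - _ = 3 * (s - 1) ^+ 2 * (s + 1)); last by ring.
  by rewrite mulr_ge0 ?addr_ge0// mulr_ge0 ?sqr_ge0.
apply: (le_trans (ler_wpM2l _ h3)); first by rewrite mulr_ge0.
by rewrite le_eqVlt; apply/orP; left; apply/eqP; ring.
Qed.

Lemma pot_Qfin4 v : in_LpLq 4 (4 / 3)%:E T v -> Qfin 4 (cut (fun t => pot (v t))).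
Proof.
move=> h43; have mv := LpLq_jmeas h43; have f43 := LpLq_one_S43 h43.
have mp := measurable_pot mv; have mI := measurable_itvIe; have mS3 := measurable_S43X mv.
have C0 : 0 <= 8 * @hlsC R by rewrite /hlsC; lra.
have S30 t : (0 <= S43 (v t) ^+ 3)%E by rewrite expe_ge0// S43_ge0.
have I0 t : (0 <= (itvI T t)%:E)%E by rewrite lee_fin itvI_ge0.
have m1 : measurable_fun setT (fun t => ((itvI T t)%:E * (1 + S43 (v t) ^+ 3))%E).
  by apply: emeasurable_funM => //; apply: emeasurable_funD => //; exact: measurable_cst.
rewrite /Qfin (Qint_cut (p := 3))//; last by move=> t x; exact: expr4_ge0.
apply: (@le_lt_trans _ _ (\int[lam1]_t ((8 * @hlsC R)%:E * ((itvI T t)%:E * (1 + S43 (v t) ^+ 3))))%E).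
  apply: ge0_le_integral => //.
  - move=> t _; apply: mule_ge0 => //; apply: integral_ge0 => x _.
    by rewrite lee_fin expr4_ge0.
  - apply: emeasurable_funM => //.
    by apply: (measurable_slice_int (f := fun t x => pot (v t) x ^+ 4)); [mfun|move=> t x; exact: expr4_ge0].
  - exact: measurable_funeM.
  - move=> t _; rewrite muleCA; apply: lee_wpmul2l => //.
    exact: pot_L4 (jmeas_slice t mv).
rewrite ge0_integralZl//; last first.
  by move=> t _; rewrite mule_ge0// adde_ge0.
exact: lte_mul_pinfty.
Qed.

End potential.

Lemma S43_ae_fin v : in_LpLq 4 (4 / 3)%:E T v ->
  {ae lam1, forall t, 0 < t < T -> (S43 (v t) < +oo)%E}.
Proof.
move=> h43; have mv := LpLq_jmeas h43; have f43 := LpLq_S43 h43.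
have mI := measurable_itvIe; have mS3 := measurable_S43X mv.
have h0 t : (0 <= (itvI T t)%:E * S43 (v t) ^+ 3)%E.
  by rewrite mule_ge0// ?lee_fin ?itvI_ge0// expe_ge0// S43_ge0.
have := ae_lty (emeasurable_funM mI mS3) h0 f43.
apply: filterS => t + tT; rewrite /itvI tT mul1e.
apply: contraTT; rewrite -!leNgt !leye_eq => /eqP h.
by have [_ [_ ->]] := S43_cubic (S43_ge0 (v t)).
Qed.

End norms.

Section biot_savart.
Context {R : realType}.
Local Notation jmeas f := (measurable_fun setT (fun v : R * (R * R) => f v.1 v.2)).
Local Notation dif y x := ((y : R * R).1 - (x : R * R).1, (y : R * R).2 - (x : R * R).2).

(** Integrability is known of the product only: for c = 0 nothing is known of f, but both sides are
    0. *)
Lemma RintZ_itg d (X : measurableType d) (m : {measure set X -> \bar R}) (c : R) (f : X -> R) :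
  itg m (fun x => c * f x) -> \int[m]_x (c * f x) = c * \int[m]_x f x.
Proof.
have [->|c0] := eqVneq c 0.
  move=> _; rewrite mul0r -[RHS](Rint0 m); apply: eq_Rintegral => x _; exact: mul0r.
move=> h; rewrite RintZ//; have := itgZ c^-1 h.
by congr (itg _ _); apply/funext => x; rewrite mulKf.
Qed.

Lemma ae_eq_Rint d (X : measurableType d) (m : {measure set X -> \bar R}) (f g : X -> R) :
  measurable_fun setT f -> measurable_fun setT g -> {ae m, forall x, f x = g x} ->
  \int[m]_x f x = \int[m]_x g x.
Proof.
move=> mf mg fg; rewrite /Rintegral; congr fine; apply: ae_eq_integral => //; [by mfun|by mfun|].
by apply: filterS fg => x -> _.
Qed.

Lemma measurable_kBS : measurable_fun setT (@kBS1 R) /\ measurable_fun setT (@kBS2 R).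
Proof. by have [<- <-] := @kreg0 R; exact: measurable_kreg. Qed.

(** The potential superposes kernels with sources y, each divergence free by [kBS_divfree]; the
    exchange of integrals is licensed by [hls_box], the test functions living in a box. *)
Lemma pot_divfree (z : R * R -> R) : measurable_fun setT z -> (S43 z < +oo)%E ->
  divfree (pot (@kBS1 R) z) (pot (@kBS2 R) z).
Proof.
move=> mz Soo N p p' q q' N0 cp cq.
have [dp cp' pN] := cp; have [dq cq' qN] := cq.
have mp := continuous_measurable_fun (C1c_continuous cp).
have mq := continuous_measurable_fun (C1c_continuous cq).
have mp' := continuous_measurable_fun cp'.
have mq' := continuous_measurable_fun cq'.
have [M M0 pM] := C1c_bound N0 cp; have [K K0 qK] := C1c_bound N0 cq.
have mkap := @measurable_kap R; have mc := @measurable_cbrt R.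
have [mk1 mk2] := measurable_kBS.
have Sfin : S43 z \is a fin_num by rewrite ge0_fin_numE ?S43_ge0.
have S0 : 0 <= fine (S43 z) by rewrite fine_ge0// S43_ge0.
have mcz : measurable_fun setT (cbrt \o z) by rewrite /comp; mfun.
have hbox := hls_box mcz (fun x => cbrt_ge0 (z x)) S0 _ (ltW N0).
rewrite fineK// in hbox; have {}hbox := hbox (lexx _).
have bnd (k : R * R -> R) (f g : R -> R) : measurable_fun setT k -> (forall z, `|k z| <= kap z) ->
    measurable_fun setT f -> measurable_fun setT g ->
    (forall s, `|f s| <= M) -> (forall s, `|g s| <= K) ->
    (forall s, N <= `|s| -> f s = 0) -> (forall s, N <= `|s| -> g s = 0) ->
    itg2 lam2 lam2 (fun x y => (f x.1 * g x.2) * (k (dif x y) * z y)).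
  move=> mk kk mf mg fM gK fN gN; apply: itg2P; first by mfun.
  pose G (x y : R * R) : R := (if (`|x.1| <= N) && (`|x.2| <= N) then 1 else 0) *
        ((cbrt \o z) y ^+ 3 * kap (dif x y)).
  have mcz' : measurable_fun setT (fun u : (R * R) * (R * R) => cbrt (z u.2)) by mfun.
  have mG : measurable_fun setT (fun u : (R * R) * (R * R) => G u.1 u.2) by rewrite /G /comp; mfun.
  have G0 x y : 0 <= G x y.
    by rewrite mulr_ge0//; [case: ifP|rewrite mulr_ge0 ?kap_ge0// exprn_ge0// cbrt_ge0].
  have mGx x : measurable_fun setT (G x).
    by apply: (measurableT_comp mG (g := fun y : R * R => (x, y))); mfun.
  apply: (@le_lt_trans _ _ (\int[lam2]_x ((M * K)%:E * \int[lam2]_y (G x y)%:E))%E).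
    apply: ge0_le_integral => //.
    - by move=> x _; apply: integral_ge0 => y _; rewrite lee_fin.
    - have mF : measurable_fun setT (fun u : (R * R) * (R * R) =>
        `|(f u.1.1 * g u.1.2) * (k (dif u.1 u.2) * z u.2)|) by mfun.
      exact: (measurable_tonelliF lam2 (f := fun x y => `|(f x.1 * g x.2) * (k (dif x y) * z y)|) mF (fun _ _ => normr_ge0 _)).
    - by apply: measurable_funeM; exact: (measurable_tonelliF lam2 mG G0).
    move=> x _; rewrite -ge0_integralZlT ?mulr_ge0//.
    apply: le_ge0_integralT; [by mfun|by have h := mGx x; mfun|by []|].
    move=> y; rewrite /G /=; case: ifPn => xN; last first.
      have -> : f x.1 * g x.2 = 0.
        move: xN; rewrite negb_and -!ltNge => /orP[] /ltW.
          by move/fN => ->; rewrite mul0r.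
        by move/gN => ->; rewrite mulr0.
      by rewrite mul0r normr0 mul0r mulr0.
    rewrite mul1r cbrt3 !normrM; apply: ler_pM; rewrite ?mulr_ge0//; first exact: ler_pM.
    by rewrite mulrC ler_wpM2l.
  rewrite ge0_integralZl//.
  - by apply: lte_mul_pinfty; rewrite ?lee_fin ?mulr_ge0.
  - exact: (measurable_tonelliF lam2 mG G0).
  - by move=> x _; apply: integral_ge0 => y _; rewrite lee_fin.
  - by rewrite lee_fin mulr_ge0.
have i1 : itg2 lam2 lam2 (fun x y => (p' x.1 * q x.2) * (@kBS1 R (dif x y) * z y)).
  by apply: bnd => // [w|s|s|s h|s h]; [have [] := kBS_bound w|have [] := pM s|
    have [] := qK s|have [] := pN s h|have [] := qN s h].
have i2 : itg2 lam2 lam2 (fun x y => (p x.1 * q' x.2) * (@kBS2 R (dif x y) * z y)).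
  by apply: bnd => // [w|s|s|s h|s h]; [have [] := kBS_bound w|have [] := pM s|
    have [] := qK s|have [] := pN s h|have [] := qN s h].
have i12 := itgD i1 i2.
have mpot (k : R * R -> R) : measurable_fun setT k -> measurable_fun setT (pot k z).
  by move=> mk; apply: (@measurable_Rint _ _ _ _ _ lam2 (fun x y : R * R => k (x.1 - y.1, x.2 - y.2) * z y)); mfun.
have m1 := mpot _ mk1; have m2 := mpot _ mk2.
pose F (x y : R * R) := (p' x.1 * q x.2) * (@kBS1 R (dif x y) * z y) +
   (p x.1 * q' x.2) * (@kBS2 R (dif x y) * z y).
have iF : itg2 lam2 lam2 F by exact: i12.
transitivity (\int[lam2]_x \int[lam2]_y F x y).
  apply: ae_eq_Rint; [by mfun|exact: itg_measurable (itg2_itg1 iF)|].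
  apply: filterS2 (itg2_ae1 i1) (itg2_ae1 i2) => x h1 h2.
  apply: esym; apply: (etrans (RintD h1 h2)).
  by rewrite (RintZ_itg h1) (RintZ_itg h2) /pot mulrC [in X in _ + X]mulrC.
rewrite (RFubini iF) -[RHS](Rint0 lam2); apply: ae_eq_Rint => //.
  exact: itg_measurable (itg2_itg2 iF).
apply: filterS (itg2_ae2 iF) => y hy.
have E x : F x y = z y * (kBS1 (dif x y) * (p' x.1 * q x.2) + kBS2 (dif x y) * (p x.1 * q' x.2)).
  by rewrite /F; ring.
transitivity (\int[lam2]_x (z y * (kBS1 (dif x y) * (p' x.1 * q x.2) + kBS2 (dif x y) * (p x.1 * q' x.2)))).
  by apply: eq_Rintegral => x _; exact: E.
rewrite RintZ_itg; last by move: hy; congr (itg _ _); apply/funext => x; exact: E.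
by rewrite /Rintegral (kBS_divfree y N0 cp cq) /= mulr0.
Qed.

Lemma KBS_pot (z : R * R -> R) : measurable_fun setT z ->
  KBS1 z = pot (@kBS1 R) z /\ KBS2 z = pot (@kBS2 R) z.
Proof.
move=> mz; have [mk1 mk2] := measurable_kBS.
by split; apply/funext => x; rewrite /KBS1 /KBS2 /pot Rint_leb2//; mfun.
Qed.

End biot_savart.

(** * The mollified equation and uniqueness *)

Section test_function.
Context {R : realType}.
Variables (e : R) (m : mollifier e) (x : R * R) (a : R).

(** The cube makes it C^2. It is positive before a, so for a > 0 the term with the initial datum is
    present in the tested equation. *)
Definition theta (t : R) : R := ramp (a - t) ^+ 3.

Definition product_test : RxR2 R -> R :=
  tensor3 theta (fun s => eta0 m (s - x.1)) (fun s => eta0 m (s - x.2)).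

Let is_derive_sub (t : R) : is_derive t 1 (fun s : R => a - s) (-1).
Proof.
have := is_deriveB (is_derive_cst a t 1) (is_derive_id t (1 : R)).
by rewrite sub0r.
Qed.

Lemma is_derive_theta (t : R) : is_derive t 1 theta (- (3 * ramp (a - t) ^+ 2)).
Proof.
have := @is_derive1_comp _ _ _ t _ _ (is_derive_rampX 1 (a - t)) (is_derive_sub t).
by rewrite mulrN1.
Qed.

Lemma is_derive_theta1 (t : R) :
  is_derive t 1 (fun t => - (3 * ramp (a - t) ^+ 2)) (6 * ramp (a - t)).
Proof.
have h := @is_derive1_comp _ _ _ t _ _ (is_derive_rampX 0 (a - t)) (is_derive_sub t).
have h1 := @is_deriveZ _ _ _ _ (-3) t 1 _ h.
rewrite (_ : (fun t : R => - (3 * ramp (a - t) ^+ 2)) = (fun t => -3 * ramp (a - t) ^+ 2)); last first.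
  by apply/funext => s; rewrite mulNr.
apply: is_derive_eq; rewrite /GRing.scale/=; ring.
Qed.

Lemma theta_C2 : C1D 2 theta.
Proof.
apply: (C1D_build is_derive_theta is_derive_theta1) => t.
apply: cvgM; first exact: cvg_cst.
apply: (@continuous_comp _ _ _ (fun s : R => a - s) ramp); last exact: ramp_continuous.
by apply: cvgB; [exact: cvg_cst|exact: cvg_id].
Qed.

Lemma eta0_C2 : C1D 2 (eta0 m).
Proof.
apply: (C1D_build (@eta0_derive _ _ m) (@eta1_derive _ _ m)).
exact: eta2_continuous.
Qed.

Lemma derive1_eta0 (c : R) : derive1 (fun s => eta0 m (s - c)) = (fun s => eta1 m (s - c)).
Proof.
have d (s : R) : derivable (eta0 m) s 1 by have [] := @eta0_derive _ _ m s.
by rewrite derive1_shift// (derive1_eq (@eta0_derive _ _ m)).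
Qed.

Lemma derive1_eta1 (c : R) : derive1 (fun s => eta1 m (s - c)) = (fun s => eta2 m (s - c)).
Proof.
have d (s : R) : derivable (eta1 m) s 1 by have [] := @eta1_derive _ _ m s.
by rewrite derive1_shift// (derive1_eq (@eta1_derive _ _ m)).
Qed.

Lemma eta_shift_derivable (c s : R) : derivable (fun s => eta0 m (s - c)) s 1 /\
  derivable (fun s => eta1 m (s - c)) s 1.
Proof.
have [_ h0 h1] := C1D_shift c eta0_C2; split; first exact: h0.
by move: h1; rewrite derive1_eta0 => -[_ h1 _]; exact: h1.
Qed.

Lemma product_test_pdiff t (y : R * R) :
  [/\ pdiff (et R) product_test (t, y) =
        - (3 * ramp (a - t) ^+ 2) * (eta0 m (y.1 - x.1) * eta0 m (y.2 - x.2)),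
      pdiff (ex1 R) product_test (t, y) = theta t * (eta1 m (y.1 - x.1) * eta0 m (y.2 - x.2)),
      pdiff (ex2 R) product_test (t, y) = theta t * (eta0 m (y.1 - x.1) * eta1 m (y.2 - x.2)),
      pdiff (ex1 R) (pdiff (ex1 R) product_test) (t, y) =
        theta t * (eta2 m (y.1 - x.1) * eta0 m (y.2 - x.2)) &
      pdiff (ex2 R) (pdiff (ex2 R) product_test) (t, y) =
        theta t * (eta0 m (y.1 - x.1) * eta2 m (y.2 - x.2))].
Proof.
have d0 c s := (eta_shift_derivable c s).1; have d1 c s := (eta_shift_derivable c s).2.
have dt (s : R) : derivable theta s 1 by have [] := is_derive_theta s.
rewrite /product_test (tensor3_et _ _ dt).2 (derive1_eq is_derive_theta).
rewrite !(tensor3_ex1 _ _ (d0 _)).2 !(tensor3_ex2 _ _ (d0 _)).2 !derive1_eta0.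
by rewrite !(tensor3_ex1 _ _ (d1 _)).2 !(tensor3_ex2 _ _ (d1 _)).2 !derive1_eta1.
Qed.

(** The norm on pairs is the maximum: beyond the chosen radius one coordinate of y is at distance at
    least e from that of x, and its factor vanishes. In time, T - (T - a) = a is where [theta]
    stops. *)
Lemma product_test_fun T : a < T -> test_fun T product_test.
Proof.
move=> aT; split.
  apply: tensor3_isCk; [exact: theta_C2|exact: C1D_shift eta0_C2|exact: C1D_shift eta0_C2].
exists (e + `|x.1| + `|x.2|), (T - a); split; first by rewrite subr_gt0.
move=> t y _ [|]; rewrite /product_test /tensor3 /=.
  by rewrite subKr => at_; rewrite /theta ramp_neg ?subr_le0// expr0n mul0r.
rewrite prod_normE lt_max => /orP[] h.
  have /(eta_supp m)[-> _ _] : e <= `|y.1 - x.1|.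
    by have := lerB_dist y.1 x.1; have := normr_ge0 x.2; lra.
  by rewrite mul0r mulr0.
have /(eta_supp m)[-> _ _] : e <= `|y.2 - x.2|.
  by have := lerB_dist y.2 x.2; have := normr_ge0 x.1; lra.
by rewrite !mulr0.
Qed.

End test_function.

Section weak_form.
Context {R : realType}.
Local Notation jmeas f := (measurable_fun setT (fun v : R * (R * R) => f v.1 v.2)).
Local Notation dif y x := ((y : R * R).1 - (x : R * R).1, (y : R * R).2 - (x : R * R).2).

Lemma conv0 (f : R * R -> R) al x : (forall y, f y = 0) -> conv f al x = 0.
Proof.
by move=> f0; rewrite /conv -[RHS](Rint0 lam2); apply: eq_Rintegral => y _; rewrite f0 mul0r.
Qed.

Lemma ramp_itg (T a : R) (k : nat) (f : R -> R) : itg lam1 f ->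
  (forall t, ~~ (0 < t < T) -> f t = 0) -> a < T ->
  itg lam1 (fun t => ramp (a - t) ^+ k * f t).
Proof.
move=> hf fT aT; have mr := continuous_measurable_fun (@ramp_continuous R).
have mf := itg_measurable hf.
apply: (itg_dom _ (itgZ (T ^+ k) (itg_norm hf))); first by mfun.
move=> t; have [/andP[t0 tT]|/fT ->] := boolP (0 < t < T); last by rewrite !mulr0 normr0 mulr0.
rewrite normrM ler_wpM2r// ger0_norm ?exprn_ge0 ?ramp_ge0// lerXn2r ?nnegrE ?ramp_ge0//.
  by rewrite (le_trans (ltW t0))// ltW.
by rewrite /ramp ge_max; apply/andP; split; lra.
Qed.

Variables (T nu : R) (b1 b2 w : R -> R * R -> R).
Hypotheses (T0 : 0 < T) (mb1 : jmeas b1) (mb2 : jmeas b2) (mw : jmeas w)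
  (b1oo : Qfin 4 b1) (b2oo : Qfin 4 b2) (w2oo : Qfin 2 w) (w4oo : Qfin 4 w)
  (wT : forall t y, ~~ (0 < t < T) -> w t y = 0).

Lemma slices_L2 : {ae lam1, forall t, [/\ L2fun (w t), L2fun (fun y => b1 t y * w t y) &
  L2fun (fun y => b2 t y * w t y)]}.
Proof.
have e4 (f : R -> R * R -> R) t x : 0 <= f t x ^+ 4 by exact: expr4_ge0.
have a1 := Qfin_ae mb1 (e4 b1) b1oo; have a2 := Qfin_ae mb2 (e4 b2) b2oo.
have a3 := Qfin_ae mw (e4 w) w4oo; have a4 := Qfin_ae mw (fun t x => sqr_ge0 (w t x)) w2oo.
apply: filterS2 (filterI a1 a2) (filterI a3 a4) => t [h1 h2] [h3 h4].
have mwt := jmeas_slice t mw.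
by split => //; apply: mul_L2fun => //; exact: jmeas_slice.
Qed.

Variables (e : R) (m : mollifier e) (x : R * R) (a : R).
Hypotheses (e0 : 0 < e) (aT : a < T).

Lemma conv_outside t : ~~ (0 < t < T) ->
  conv (w t) (rho m) x = 0 /\ rhs_conv nu b1 b2 w m t x = 0.
Proof.
move=> tT; have w0 y : w t y = 0 by exact: wT.
by rewrite /rhs_conv !conv0 ?addr0 ?mulr0// => y; rewrite w0 mulr0.
Qed.

Lemma itg_weak_terms :
  itg lam1 (fun t => 3 * ramp (a - t) ^+ 2 * conv (w t) (rho m) x) /\
  itg lam1 (fun t => ramp (a - t) ^+ 3 * rhs_conv nu b1 b2 w m t x).
Proof.
have [M M0 [k00 k10 k01 k20 k02]] := moll_kern m e0; have e0' := ltW e0.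
have mbw1 : jmeas (fun t y => b1 t y * w t y) by mfun.
have mbw2 : jmeas (fun t y => b2 t y * w t y) by mfun.
have bw1 := mul_Qfin mw w4oo mb1 b1oo; have bw2 := mul_Qfin mw w4oo mb2 b2oo.
have bwT b t y : ~~ (0 < t < T) -> b t y * w t y = 0 by move=> /wT ->; rewrite mulr0.
split.
  have := itgZ 3 (ramp_itg 2 (itg_conv_time x T0 e0' M0 k00 mw w2oo wT)
    (fun t h => (conv_outside h).1) aT).
  by congr (itg _ _); apply/funext => t; rewrite mulrA.
apply: (@ramp_itg T) => // [|t h]; last by have [] := conv_outside h.
apply: itgD.
  by apply: itgZ; apply: itgD; [exact: (itg_conv_time x T0 e0' M0 k20 mw w2oo wT)|
    exact: (itg_conv_time x T0 e0' M0 k02 mw w2oo wT)].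
by apply: itgD; [exact: (itg_conv_time x T0 e0' M0 k10 mbw1 bw1 (bwT b1))|
  exact: (itg_conv_time x T0 e0' M0 k01 mbw2 bw2 (bwT b2))].
Qed.

End weak_form.

Section weak_solution.
Context {R : realType}.
Local Notation jmeas f := (measurable_fun setT (fun v : R * (R * R) => f v.1 v.2)).
Local Notation dif y x := ((y : R * R).1 - (x : R * R).1, (y : R * R).2 - (x : R * R).2).
Variables (T nu : R) (u : R -> R * R -> R).
Hypotheses (T0 : 0 < T) (hu : in_LpLq 4 (4 / 3)%:E T u).

Definition drift k := cut T (fun t => pot k (u t)).

Lemma measurable_drift : jmeas (drift (@kBS1 R)) /\ jmeas (drift (@kBS2 R)).
Proof.
have [m1 m2] := @measurable_kBS R; have mu := LpLq_jmeas hu.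
by split; apply: (@measurable_cut _ _ T0 (fun t => pot _ (u t))); exact: measurable_pot.
Qed.

Lemma drift_Qfin4 : Qfin 4 (drift (@kBS1 R)) /\ Qfin 4 (drift (@kBS2 R)).
Proof.
have [m1 m2] := @measurable_kBS R.
by split; apply: pot_Qfin4 => // z; have [] := kBS_bound z.
Qed.

Lemma drift_divfree : {ae lam1, forall t, divfree (drift (@kBS1 R) t) (drift (@kBS2 R) t)}.
Proof.
have mu := LpLq_jmeas hu; apply: filterS (S43_ae_fin T0 hu) => t ht.
have [tT|tT] := boolP (0 < t < T).
  by rewrite /drift !cut_id//; apply: pot_divfree; [exact: jmeas_slice|exact: ht].
move=> N p p' q q' _ _ _; rewrite -[RHS](Rint0 lam2); apply: eq_Rintegral => x _.
by rewrite /drift !cutT// !mul0r addr0.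
Qed.

Section mollified.
Variable v : R -> R * R -> R.
Hypotheses (h4 : in_LpLq 4 4%:E T v) (h43 : in_LpLq 4 (4 / 3)%:E T v).
Variables (e : R) (m : mollifier e) (x : R * R) (a : R).
Hypotheses (e0 : 0 < e) (aT : a < T).
Let b1 := drift (@kBS1 R).
Let b2 := drift (@kBS2 R).
Let w := cut T v.

Let F t y :=
  (pdiff (et R) (product_test m x a) (t, y)
   + nu * (pdiff (ex1 R) (pdiff (ex1 R) (product_test m x a)) (t, y)
           + pdiff (ex2 R) (pdiff (ex2 R) (product_test m x a)) (t, y))
   + (KBS1 (u t) y * pdiff (ex1 R) (product_test m x a) (t, y)
      + KBS2 (u t) y * pdiff (ex2 R) (product_test m x a) (t, y))) * v t y.

Lemma weak_integrandE t y : F t y =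
  (- (3 * ramp (a - t) ^+ 2) * ten (eta0 m) (eta0 m) (dif y x) +
   nu * (theta a t * ten (eta2 m) (eta0 m) (dif y x) + theta a t * ten (eta0 m) (eta2 m) (dif y x)) +
   (pot (@kBS1 R) (u t) y * (theta a t * ten (eta1 m) (eta0 m) (dif y x)) +
    pot (@kBS2 R) (u t) y * (theta a t * ten (eta0 m) (eta1 m) (dif y x)))) * v t y.
Proof.
have [k1 k2] := KBS_pot (jmeas_slice t (LpLq_jmeas hu)).
by have [p1 p2 p3 p4 p5] := product_test_pdiff m x a t y; rewrite /F p1 p2 p3 p4 p5 k1 k2.
Qed.

Lemma measurable_weak_integrand : jmeas F.
Proof.
have mu := LpLq_jmeas hu; have mv := LpLq_jmeas h4.
have [mk1 mk2] := @measurable_kBS R.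
have m1 := measurable_pot mk1 mu; have m2 := measurable_pot mk2 mu.
have [M M0 [[k00 _] [k10 _] [k01 _] [k20 _] [k02 _]]] := moll_kern m e0.
have mr := continuous_measurable_fun (@ramp_continuous R).
rewrite (_ : (fun p : R * (R * R) => F p.1 p.2) = fun p : R * (R * R) =>
  (- (3 * ramp (a - p.1) ^+ 2) * ten (eta0 m) (eta0 m) (dif p.2 x) +
   nu * (ramp (a - p.1) ^+ 3 * ten (eta2 m) (eta0 m) (dif p.2 x) +
         ramp (a - p.1) ^+ 3 * ten (eta0 m) (eta2 m) (dif p.2 x)) +
   (pot (@kBS1 R) (u p.1) p.2 * (ramp (a - p.1) ^+ 3 * ten (eta1 m) (eta0 m) (dif p.2 x)) +
    pot (@kBS2 R) (u p.1) p.2 * (ramp (a - p.1) ^+ 3 * ten (eta0 m) (eta1 m) (dif p.2 x)))) * v p.1 p.2).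
  by mfun.
by apply/funext => p; rewrite weak_integrandE.
Qed.

Lemma slice_weak_integral t :
  L2fun (w t) -> L2fun (fun y => b1 t y * w t y) -> L2fun (fun y => b2 t y * w t y) ->
  itvI T t * \int[lam2]_y F t y =
  ramp (a - t) ^+ 3 * rhs_conv nu b1 b2 w m t x - 3 * ramp (a - t) ^+ 2 * conv (w t) (rho m) x.
Proof.
move=> [mw w2] [mw1 w12] [mw2 w22].
have [M M0 [k00 k10 k01 k20 k02]] := moll_kern m e0; have e0' := ltW e0.
have i00 := itg_kern x e0' k00 M0 mw w2.
have i20 := itg_kern x e0' k20 M0 mw w2; have i02 := itg_kern x e0' k02 M0 mw w2.
have i10 := itg_kern x e0' k10 M0 mw1 w12; have i01 := itg_kern x e0' k01 M0 mw2 w22.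
have iA := itgZ nu (itgD i20 i02); have iB := itgD i10 i01.
have iL := itgZ (ramp (a - t) ^+ 3) (itgD iA iB).
have iR := itgZ (3 * ramp (a - t) ^+ 2) i00.
have E y : itvI T t * F t y = ramp (a - t) ^+ 3 *
    (nu * (w t y * ten (eta2 m) (eta0 m) (dif y x) + w t y * ten (eta0 m) (eta2 m) (dif y x)) +
     (b1 t y * w t y * ten (eta1 m) (eta0 m) (dif y x) + b2 t y * w t y * ten (eta0 m) (eta1 m) (dif y x)))
   - 3 * ramp (a - t) ^+ 2 * (w t y * ten (eta0 m) (eta0 m) (dif y x)).
  (* The cut-off occurs once in w and twice in each product b w; it takes the values 0 and 1
     only. *)
  rewrite weak_integrandE /w /b1 /b2 /drift /cut /theta /itvI.
  by case: ifP => _; ring.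
have iF : itg lam2 (fun y => itvI T t * F t y).
  by have := itgB iL iR; congr (itg _ _); apply/funext => y; rewrite E.
rewrite -(RintZ_itg iF).
transitivity (\int[lam2]_y (ramp (a - t) ^+ 3 *
    (nu * (w t y * ten (eta2 m) (eta0 m) (dif y x) + w t y * ten (eta0 m) (eta2 m) (dif y x)) +
     (b1 t y * w t y * ten (eta1 m) (eta0 m) (dif y x) + b2 t y * w t y * ten (eta0 m) (eta1 m) (dif y x)))
   - 3 * ramp (a - t) ^+ 2 * (w t y * ten (eta0 m) (eta0 m) (dif y x)))).
  by apply: eq_Rintegral => y _; exact: E.
apply: (etrans (RintB iL iR)).
rewrite (RintZ _ i00) (RintZ _ (itgD iA iB)); congr (_ * _ - _).
apply: (etrans (RintD iA iB)).
by rewrite (RintZ _ (itgD i20 i02)) /rhs_conv /conv; congr (_ * _ + _); [exact: RintD|exact: RintD].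
Qed.

(** The terms of the initial datum are left unevaluated: they depend on the test function alone, so
    they are common to both solutions. *)
Lemma weak_sol_mollified u0p u0n : weak_sol nu T u u0p u0n v ->
  \int[lam1]_t (ramp (a - t) ^+ 3 * rhs_conv nu b1 b2 w m t x) -
  \int[lam1]_t (3 * ramp (a - t) ^+ 2 * conv (w t) (rho m) x) +
  (Rintegral u0p setT (fun y => product_test m x a (0, y))
   - Rintegral u0n setT (fun y => product_test m x a (0, y))) = 0.
Proof.
move=> /(_ _ (product_test_fun m x aT)).
have [mb1 mb2] := measurable_drift; have [b1oo b2oo] := drift_Qfin4.
have mw := measurable_cut T0 (LpLq_jmeas h4).
have w2 := LpLq_Qfin2 T0 h4 h43; have w4 := LpLq_Qfin4 h4.
have wT t y : ~~ (0 < t < T) -> w t y = 0 := cutT v y.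
have [iP iQ] := itg_weak_terms nu T0 mb1 mb2 mw b1oo b2oo w2 w4 wT m x e0 aT.
have mF := measurable_weak_integrand.
have mI : measurable_fun setT (fun t => \int[lam2]_y F t y) by exact: (@measurable_Rint _ _ _ _ _ lam2 F mF).
have mT := measurable_itvI T0.
rewrite -(RintB iQ iP) => W0; apply: (etrans _ W0); congr (_ + _).
transitivity (\int[lam1]_t (itvI T t * \int[lam2]_y F t y)).
  apply: ae_eq_Rint; [exact: itg_measurable (itgB iQ iP)|by mfun|].
  apply: filterS (slices_L2 mb1 mb2 mw b1oo b2oo w2 w4) => t [h0 h1 h2].
  by rewrite (slice_weak_integral h0 h1 h2).
rewrite -(Rint_leb1 _ mI); apply: eq_Rintegral => t _.
by rewrite -Rint_leb2//; exact: jmeas_slice mF.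
Qed.

End mollified.
End weak_solution.

Section uniqueness.
Context {R : realType}.
Local Notation jmeas f := (measurable_fun setT (fun v : R * (R * R) => f v.1 v.2)).
Local Notation dif y x := ((y : R * R).1 - (x : R * R).1, (y : R * R).2 - (x : R * R).2).

Lemma conv_sub (f g : R * R -> R) al x :
  itg lam2 (fun y => f y * al (dif y x)) -> itg lam2 (fun y => g y * al (dif y x)) ->
  conv (fun y => f y - g y) al x = conv f al x - conv g al x.
Proof.
by move=> hf hg; rewrite /conv -(RintB hf hg); apply: eq_Rintegral => y _; rewrite mulrBl.
Qed.

Lemma rhs_conv_sub nu (b1 b2 f g : R -> R * R -> R) e (m : mollifier e) t x : 0 < e ->
  L2fun (f t) -> L2fun (fun y => b1 t y * f t y) -> L2fun (fun y => b2 t y * f t y) ->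
  L2fun (g t) -> L2fun (fun y => b1 t y * g t y) -> L2fun (fun y => b2 t y * g t y) ->
  rhs_conv nu b1 b2 (fun t y => f t y - g t y) m t x =
  rhs_conv nu b1 b2 f m t x - rhs_conv nu b1 b2 g m t x /\
  conv (fun y => f t y - g t y) (rho m) x = conv (f t) (rho m) x - conv (g t) (rho m) x.
Proof.
move=> e0 [mf f2] [mf1 f12] [mf2 f22] [mg g2] [mg1 g12] [mg2 g22].
have [M M0 [k00 k10 k01 k20 k02]] := moll_kern m e0.
have K al (h k : R * R -> R) : kern e M al -> measurable_fun setT h -> measurable_fun setT k ->
    (\int[lam2]_y (h y ^+ 2)%:E < +oo)%E -> (\int[lam2]_y (k y ^+ 2)%:E < +oo)%E ->
    conv (fun y => h y - k y) al x = conv h al x - conv k al x.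
  by move=> ka mh mk h2 k2; apply: conv_sub; apply: (itg_kern x (ltW e0) ka M0).
split; last exact: K.
rewrite /rhs_conv (K _ _ _ k20 mf mg f2 g2) (K _ _ _ k02 mf mg f2 g2).
have E (b : R -> R * R -> R) : (fun y => b t y * (f t y - g t y)) = (fun y => b t y * f t y - b t y * g t y).
  by apply/funext => y; rewrite mulrBr.
rewrite !E (K _ _ _ k10 mf1 mg1 f12 g12) (K _ _ _ k01 mf2 mg2 f22 g22).
by move: (conv _ _ _) (conv _ _ _) (conv _ _ _) (conv _ _ _) (conv _ _ _) (conv _ _ _) => *; ring.
Qed.

Lemma sqr_sub_le (r s : R) : (r - s) ^+ 2 <= 2 * r ^+ 2 + 2 * s ^+ 2.
Proof. by rewrite -subr_ge0 (_ : _ - _ = (r + s) ^+ 2) ?sqr_ge0//; ring. Qed.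

Lemma expr4_sub_le (r s : R) : (r - s) ^+ 4 <= 8 * r ^+ 4 + 8 * s ^+ 4.
Proof.
have -> : (r - s) ^+ 4 = ((r - s) ^+ 2) ^+ 2 by ring.
have -> : r ^+ 4 = (r ^+ 2) ^+ 2 by ring.
have -> : s ^+ 4 = (s ^+ 2) ^+ 2 by ring.
apply: (@le_trans _ _ ((2 * r ^+ 2 + 2 * s ^+ 2) ^+ 2)).
  by rewrite lerXn2r ?nnegrE ?sqr_ge0 ?sqr_sub_le// addr_ge0// mulr_ge0 ?sqr_ge0.
rewrite -subr_ge0 (_ : _ - _ = (2 * (r ^+ 2 - s ^+ 2)) ^+ 2) ?sqr_ge0//; ring.
Qed.

Lemma Qfin_sub (p : nat) (C : R) (f g : R -> R * R -> R) : jmeas f -> jmeas g -> 0 <= C ->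
  (forall r : R, 0 <= r ^+ p) -> (forall r s : R, (r - s) ^+ p <= C * r ^+ p + C * s ^+ p) ->
  Qfin p f -> Qfin p g -> Qfin p (fun t x => f t x - g t x).
Proof.
move=> mf mg C0 p0 hC hf hg.
have mfp : jmeas (fun t x => f t x ^+ p) by mfun.
have mgp : jmeas (fun t x => g t x ^+ p) by mfun.
have mCf : jmeas (fun t x => C * f t x ^+ p) by mfun.
have mCg : jmeas (fun t x => C * g t x ^+ p) by mfun.
apply: (@le_lt_trans _ _ (\int[lam1]_t \int[lam2]_x (C * f t x ^+ p + C * g t x ^+ p)%:E)%E).
  by apply: le_Qint => [||t x|t x]; [mfun|mfun|exact: p0|exact: hC].
rewrite (QintD mCf mCg (fun t x => mulr_ge0 C0 (p0 _)) (fun t x => mulr_ge0 C0 (p0 _))).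
rewrite (QintZ mfp (fun t x => p0 _) C0) (QintZ mgp (fun t x => p0 _) C0).
exact: (lte_add_pinfty (lte_EFin_mul C0 hf) (lte_EFin_mul C0 hg)).
Qed.

Lemma ae_leb1 (P : set R) : {ae lam1, forall t, P t} -> {ae @leb1 R, forall t, P t}.
Proof. by move=> [A [mA A0 PA]]; exists A. Qed.

Lemma ae_eq_leb (T : R) (f g : R -> R * R -> R) : jmeas f -> jmeas g ->
  (\int[lam1]_t \int[lam2]_x ((cut T f t x - cut T g t x) ^+ 2)%:E = 0)%E ->
  0 < T ->
  {ae @leb1 R, forall t, 0 < t < T -> {ae @leb2 R, forall x, f t x = g t x}}.
Proof.
move=> mf mg h0 T0.
have mcf := measurable_cut T0 mf; have mcg := measurable_cut T0 mg.
have mD : jmeas (fun t x => (cut T f t x - cut T g t x) ^+ 2) by mfun.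
have mG := measurable_slice_int (f := fun t x => (cut T f t x - cut T g t x) ^+ 2) mD
  (fun t x => sqr_ge0 _).
have G0 t : (0 <= \int[lam2]_x ((cut T f t x - cut T g t x) ^+ 2)%:E)%E.
  by apply: integral_ge0 => x _; rewrite lee_fin sqr_ge0.
have ae1 : {ae lam1, forall t, (\int[lam2]_x ((cut T f t x - cut T g t x) ^+ 2)%:E = 0)%E}.
  have E : (\int[lam1]_t `|\int[lam2]_x ((cut T f t x - cut T g t x) ^+ 2)%:E| = 0)%E.
    by rewrite -[RHS]h0; apply: eq_integral => t _; rewrite gee0_abs.
  have := (ae_eq_integral_abs lam1 measurableT mG).1 E.
  by apply: filterS => t /(_ I).
apply: ae_leb1; apply: filterS ae1 => t + tT.
rewrite !cut_id// => ht.
have mft := jmeas_slice t mf; have mgt := jmeas_slice t mg.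
have mfg : measurable_fun setT (fun x => ((f t x - g t x) ^+ 2)%:E) by mfun.
have E : (\int[@leb2 R]_x `|((f t x - g t x) ^+ 2)%:E| = 0)%E.
  rewrite -[RHS]ht -ge0_integral_leb2//; last by move=> x; rewrite lee_fin sqr_ge0.
  by apply: eq_integral => x _; rewrite gee0_abs// lee_fin sqr_ge0.
have := (ae_eq_integral_abs (@leb2 R) measurableT mfg).1 E.
apply: filterS => x /(_ I) /= [] /eqP; rewrite sqrf_eq0 subr_eq0 => /eqP.
by [].
Qed.

End uniqueness.

Theorem theorem4p2 (R : realType) (nu T : R)
  (u0p u0n : {finite_measure set R2 R -> \bar R})
  (u u1 u2 : R -> R2 R -> R) :
  0 < nu -> 0 < T ->
  in_LpLq 4 (4 / 3)%:E T u ->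
  in_LpLq 4 4%:E T u1 -> in_LpLq 4 (4 / 3)%:E T u1 ->
  in_LpLq 4 4%:E T u2 -> in_LpLq 4 (4 / 3)%:E T u2 ->
  in_Linf_Hm1 T (fun t x => u1 t x - u2 t x) ->
  {ae @leb1 R, forall t, 0 < t < T ->
     (@leb2 R).-integrable setT (fun x => (u1 t x - u2 t x)%:E)} ->
  (forall phi : R2 R -> R, Cc_inf2 phi ->
     esssup_on `]0, t[ (fun s => Rintegral (@leb2 R) setT
                          (fun x => (u1 s x - u2 s x) * phi x))
       @[t --> 0^'+] --> 0%E) ->
  weak_sol nu T u u0p u0n u1 ->
  weak_sol nu T u u0p u0n u2 ->
  {ae @leb1 R, forall t, 0 < t < T -> {ae @leb2 R, forall x, u1 t x = u2 t x}}.
Proof.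
move=> nu0 T0 hu h14 h143 h24 h243 _ _ _ weak1 weak2.
have m1 := LpLq_jmeas h14; have m2 := LpLq_jmeas h24.
have mc1 := measurable_cut T0 m1; have mc2 := measurable_cut T0 m2.
have q14 := LpLq_Qfin4 h14; have q24 := LpLq_Qfin4 h24.
have q12 := LpLq_Qfin2 T0 h14 h143; have q22 := LpLq_Qfin2 T0 h24 h243.
have [mb1 mb2] := measurable_drift T0 hu; have [b14 b24] := drift_Qfin4 T0 hu.
have mw : measurable_fun setT (fun v : R * (R * R) => cut T u1 v.1 v.2 - cut T u2 v.1 v.2) by mfun.
have w2 := Qfin_sub (p := 2) mc1 mc2 (ler0n _ 2) (fun r => sqr_ge0 r) sqr_sub_le q12 q22.
have w4 := Qfin_sub (p := 4) mc1 mc2 (ler0n _ 8) (fun r => expr4_ge0 r) expr4_sub_le q14 q24.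
have c1T t y : ~~ (0 < t < T) -> cut T u1 t y = 0 := cutT u1 y.
have c2T t y : ~~ (0 < t < T) -> cut T u2 t y = 0 := cutT u2 y.
have wT t y : ~~ (0 < t < T) -> cut T u1 t y - cut T u2 t y = 0.
  by move=> tT; rewrite c1T// c2T// subrr.
apply: (ae_eq_leb m1 m2 _ T0).
apply: (@vanishing _ T nu _ _ (fun t y => cut T u1 t y - cut T u2 t y) T0 nu0 mb1 mb2 mw
  b14 b24 w2 w4 wT (drift_divfree T0 hu)) => e m x a e0 aT.
have E1 := weak_sol_mollified T0 hu h14 h143 m x e0 aT weak1.
have E2 := weak_sol_mollified T0 hu h24 h243 m x e0 aT weak2.
have [iP1 iQ1] := itg_weak_terms nu T0 mb1 mb2 mc1 b14 b24 q12 q14 c1T m x e0 aT.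
have [iP2 iQ2] := itg_weak_terms nu T0 mb1 mb2 mc2 b14 b24 q22 q24 c2T m x e0 aT.
have [iP iQ] := itg_weak_terms nu T0 mb1 mb2 mw b14 b24 w2 w4 wT m x e0 aT.
(* Linearity of the convolutions holds at almost every time, when the slices of both solutions and
   of their products with the drift are in L^2. *)
have sub : {ae lam1, forall t,
    rhs_conv nu (drift T u (@kBS1 R)) (drift T u (@kBS2 R))
      (fun t y => cut T u1 t y - cut T u2 t y) m t x =
    rhs_conv nu (drift T u (@kBS1 R)) (drift T u (@kBS2 R)) (cut T u1) m t x -
    rhs_conv nu (drift T u (@kBS1 R)) (drift T u (@kBS2 R)) (cut T u2) m t x /\
    conv (fun y => cut T u1 t y - cut T u2 t y) (rho m) x =
    conv (cut T u1 t) (rho m) x - conv (cut T u2 t) (rho m) x}.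
  apply: filterS2 (slices_L2 mb1 mb2 mc1 b14 b24 q12 q14) (slices_L2 mb1 mb2 mc2 b14 b24 q22 q24).
  by move=> t [f0 f1 f2] [g0 g1 g2]; exact: rhs_conv_sub.
rewrite (ae_eq_Rint (itg_measurable iP) (itg_measurable (itgB iP1 iP2))); last first.
  by apply: filterS sub => t [_ ->]; rewrite mulrBr.
rewrite (ae_eq_Rint (itg_measurable iQ) (itg_measurable (itgB iQ1 iQ2))); last first.
  by apply: filterS sub => t [-> _]; rewrite mulrBr.
rewrite (RintB iP1 iP2) (RintB iQ1 iQ2).
(* The common datum term is generalized to [c] and cancels between the two equations. *)
move: E1 E2; move: (\int[lam1]_t _) (\int[lam1]_t _) (\int[lam1]_t _) (\int[lam1]_t _) (Rintegral u0p _ _ - _).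
move=> q1 p1 q2 p2 c; clear; lra.
Qed.
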